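(* Let $\alpha_1,\alpha_2$ be coprime positive integers, let $d$ be a positive integer, and let $$F(z_0,z_1,z_2)=f(z_1,z_2)-z_0^d$$ be a $(1,\alpha_1,\alpha_2)$-weighted homogeneous polynomial of degree $d$, where $f$ is a complex polynomial in $z_1,z_2$. The complex algebraic curve $C=\{F=0\}$ in the weighted complex projective plane $\mathbb{P}(1,\alpha_1,\alpha_2)$ defines a positive $d$-section for the flow $(z_1,z_2)\mapsto(\mathrm{e}^{\mathrm{i}\alpha_1\theta}z_1,\mathrm{e}^{\mathrm{i}\alpha_2\theta}z_2)$ on $S^3$ if and only if $F$ is non-singular.
   Context: $S^3\subset\mathbb{C}^2$ is the unit sphere with its standard orientation. The weighted projective plane $\mathbb{P}(1,\alpha_1,\alpha_2)$ is the quotient of $\mathbb{C}^3\setminus\{(0,0,0)\}$ by the $\mathbb{C}^*$-action $\lambda(z_0,z_1,z_2)=(\lambda z_0,\lambda^{\alpha_1}z_1,\lambda^{\alpha_2}z_2)$. A complex polynomial $F$ in $z_0,z_1,z_2$ is $(1,\alpha_1,\alpha_2)$-weighted homogeneous of degree $d$ if $F(\lambda z_0,\lambda^{\alpha_1}z_1,\lambda^{\alpha_2}z_2)=\lambda^dF(z_0,z_1,z_2)$ for all $\lambda\in\mathbb{C}^*$ and $(z_0,z_1,z_2)\in\mathbb{C}^3$. It is non-singular if the system $F=\partial F/\partial z_0=\partial F/\partial z_1=\partial F/\partial z_2=0$ has no solutions in $\mathbb{C}^3\setminus\{(0,0,0)\}$. The flow $\theta(z_1,z_2)=(\mathrm{e}^{\mathrm{i}\alpha_1\theta}z_1,\mathrm{e}^{\mathrm{i}\alpha_2\theta}z_2)$,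 $\theta\in\mathbb{R}/2\pi\mathbb{Z}$, defines a Seifert fibration of $S^3$, whose fibres are the orbits, oriented by the flow. The orbits $C_1=\{z_2=0\}\cap S^3$ and $C_2=\{z_1=0\}\cap S^3$ have multiplicities $\alpha_1$ and $\alpha_2$ respectively (singular if the multiplicity is $>1$); all other orbits are regular. A global surface of section for this flow is an embedded compact surface $\Sigma\subset S^3$ whose boundary is a collection of orbits and whose interior intersects all other orbits transversely. It is a $d$-section if its interior meets every regular orbit not in $\partial\Sigma$ in exactly $d$ points. $\Sigma$ is oriented so that these intersection points are positive; it is positive if for every component of $\partial\Sigma$ the boundary orientation agrees with the orientation of the orbit. The weighted radial projection $\mathbb{C}^2\setminus\{(0,0)\}\to S^3$ sends $(z_1,z_2)$ to the unique point of $S^3$ of the form $(z_1/r^{\alpha_1},z_2/r^{\alpha_2})$ with $r\in\mathbb{R}^+$. The affine part of $C$ is $C_{\mathrm{aff}}=\{(z_1,z_2)\in\mathbb{C}^2 : f(z_1,z_2)=1\}$ (which does not contain $(0,0)$). That $C$ defines a positive $d$-section means that the weighted radial projection embeds $C_{\mathrm{aff}}$ into $S^3$ as the interior of a positive $d$-section $\Sigma$; the boundary components of $\Sigma$ are the orbits through those points $(a,b)\in S^3$ with $f(a,b)=0$, i.e. they correspond to the points $[0:a:b]$ at infinity on $C$.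
   Formalization: For d = 1 the polynomial f is assumed nonzero: for d = 1 and f = 0, F = -z_0 is non-singular, but the affine part {f = 1} is empty, so C cannot define a positive 1-section. *)

(* Defs.v *)
From HB Require Import structures.
From mathcomp Require Import all_boot all_order all_algebra.
From mathcomp Require Import all_classical all_reals all_analysis.
From mathcomp Require Import complex.
(* The notations of mpoly clash with those of the analysis library. *)
From mathcomp Require Import -(notations) mpoly.

Set Implicit Arguments.
Unset Strict Implicit.
Unset Printing Implicit Defensive.

Import Order.TTheory GRing.Theory Num.Theory.
Import numFieldNormedType.Exports.

Local Open Scope classical_set_scope.
Local Open Scope card_scope.
Local Open Scope complex_scope.
Local Open Scope ring_scope.

Section WeightedPolynomials.
Variable C : fieldType.

Definition vec2 (z1 z2 : C) : 'I_2 -> C := tnth [tuple z1; z2].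
Definition vec3 (z0 z1 z2 : C) : 'I_3 -> C := tnth [tuple z0; z1; z2].

Definition eval2 (f : mpoly 2 C) (z1 z2 : C) : C :=
  meval (vec2 z1 z2) f.
Definition eval3 (F : mpoly 3 C) (z0 z1 z2 : C) : C :=
  meval (vec3 z0 z1 z2) F.

Definition var3 (i : 'I_3) : mpoly 3 C :=
  mpolyX C (mnm1 i).

(* F(z0, z1, z2) = f(z1, z2) - z0 ^ d *)
Definition curve_poly (f : mpoly 2 C) (d : nat) : mpoly 3 C :=
  comp_mpoly [tuple var3 1; var3 2] f - var3 0 ^+ d.

Definition weighted_homogeneous (a1 a2 d : nat) (F : mpoly 3 C) : Prop :=
  forall l z0 z1 z2 : C, l != 0 ->
    eval3 F (l * z0) (l ^+ a1 * z1) (l ^+ a2 * z2) = l ^+ d * eval3 F z0 z1 z2.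

Definition nonsingular (F : mpoly 3 C) : Prop :=
  ~ exists z0 z1 z2 : C,
      [/\ (z0, z1, z2) != (0, 0, 0),
          eval3 F z0 z1 z2 = 0 &
          forall i : 'I_3, eval3 (mderiv i F) z0 z1 z2 = 0].

End WeightedPolynomials.

Section Sections.
Variable R : realType.

(* C^2 is identified with R^4 by (z1, z2) |-> (Re z1, Im z1, Re z2, Im z2);
   this also fixes the orientation of C^2. *)
Local Notation E := 'rV[R]_4.

Definition cpt (z1 z2 : R[i]) : E :=
  \row_i tnth [tuple complex.Re z1; complex.Im z1;
                     complex.Re z2; complex.Im z2] i.
Definition z1 (p : E) : R[i] := p 0 0 +i* p 0 1.
Definition z2 (p : E) : R[i] := p 0 2 +i* p 0 3.

Definition dot (u v : E) : R := \sum_i u 0 i * v 0 i.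

Definition S3 : set E := [set p | dot p p = 1].
Definition tangentS3 (p v : E) : Prop := dot p v = 0.

(* S^3 is oriented as the boundary of the unit ball of C^2: (u, v, w) is a
   positive basis of T_p S^3 iff 0 < det4 p u v w. *)
Definition det4 (p u v w : E) : R :=
  \det (\matrix_(i < 4) tnth [tuple p; u; v; w] i).

Fixpoint Ck_on (k : nat) (U : set E) (g : E -> R) : Prop :=
  match k with
  | 0%N => forall x, U x -> {for x, continuous g}
  | k'.+1 => (forall x, U x -> differentiable (g : E -> R^o) x) /\
      forall i : 'I_4, Ck_on k' U (fun x => 'D_(delta_mx 0 i) (g : E -> R^o) x)
  end.
Definition smooth_on (U : set E) (g : E -> R) : Prop :=
  forall k, Ck_on k U g.

(* Velocities at 0 of curves [0, e) -> A starting at x.  If A is a surface with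
   boundary this is T_x A at an interior point x, and the closed half-plane of
   T_x A of boundary-tangent and inward-pointing vectors at a boundary point. *)
Definition half_tangent (A : set E) (x v : E) : Prop :=
  exists c : R -> E,
    [/\ c 0 = x,
        \forall t \near 0^'+, A (c t) &
        (fun t => t^-1 *: (c t - x)) @ 0^'+ --> v].

(* A smooth embedding of a (boundaryless) submanifold A of R^4: a smooth map
   that is immersive on A and a homeomorphism from A onto its image. *)
Definition smooth_embedding (A : set E) (phi : E -> E) : Prop :=
  [/\ exists U : set E, [/\ open U, A `<=` U &
        forall i : 'I_4, smooth_on U (fun x => phi x 0 i)],
      forall x v, A x -> half_tangent A x v -> v != 0 -> 'D_v phi x != 0 &
      exists psi : E -> E,
        (forall x, A x -> psi (phi x) = x) /\
        {within phi @` A, continuous psi}].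

(* S is near p the zero set in S^3 of a smooth function g which is part of a
   local coordinate system of S^3 at p. *)
Definition interior_point (S : set E) (p : E) : Prop :=
  S p /\ exists (U : set E) (g : E -> R),
    [/\ open U, U p, smooth_on U g,
        S `&` U = [set q | [/\ S3 q, U q & g q = 0]] &
        exists v, tangentS3 p v /\ 'D_v (g : E -> R^o) p != 0].

(* S is near p the half surface {g = 0, h >= 0} of S^3, where h p = 0 and the
   smooth functions g, h are part of a local coordinate system of S^3 at p. *)
Definition boundary_point (S : set E) (p : E) : Prop :=
  S p /\ exists (U : set E) (g h : E -> R),
    [/\ [/\ open U, U p & h p = 0], smooth_on U g, smooth_on U h,
        S `&` U = [set q | [/\ S3 q, U q, g q = 0 & 0 <= h q]] &
        forall a b : R, exists v, [/\ tangentS3 p v,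
          'D_v (g : E -> R^o) p = a & 'D_v (h : E -> R^o) p = b]].

Definition surface_interior (S : set E) : set E := [set p | interior_point S p].
Definition surface_boundary (S : set E) : set E := [set p | boundary_point S p].

Definition compact_surface (S : set E) : Prop :=
  [/\ compact S, S `<=` S3 &
      S `<=` surface_interior S `|` surface_boundary S].

Section Flow.
Variables a1 a2 : nat.

Definition expi (t : R) : R[i] := cos t +i* sin t.

Definition flow (t : R) (p : E) : E :=
  cpt (expi (a1%:R * t) * z1 p) (expi (a2%:R * t) * z2 p).

Definition orbit (p : E) : set E := range (fun t => flow t p).

Definition flow_field (p : E) : E := 'D_1 (fun t : R^o => flow t p) 0.

Definition multiplicity (p : E) : nat :=
  if z2 p == 0 then a1 else if z1 p == 0 then a2 else 1%N.
Definition regular_orbit (p : E) : Prop := multiplicity p = 1%N.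

Definition surface_of_section (S : set E) : Prop :=
  [/\ compact_surface S,
      forall p, surface_boundary S p -> orbit p `<=` surface_boundary S &
      forall p, S3 p -> ~ (orbit p `<=` surface_boundary S) ->
        (surface_interior S `&` orbit p) !=set0 /\
        forall q, (surface_interior S `&` orbit p) q ->
          ~ half_tangent S q (flow_field q)].

Definition d_section (d : nat) (S : set E) : Prop :=
  surface_of_section S /\
  forall p, S3 p -> regular_orbit p -> ~ (orbit p `<=` surface_boundary S) ->
    surface_interior S `&` orbit p #= `I_d.

(* An orientation of S is encoded by a continuous field N of normal vectors of
   S in S^3: (u, v) is a positive basis of T_q S iff (u, v, N q) is one of
   T_q S^3.  The last condition says that the flow meets the interior of S
   positively; it determines the orientation, also on the boundary, where the
   flow is tangent to S. *)
Definition flow_orientation (S : set E) (N : E -> E) : Prop :=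
  [/\ {within S, continuous N},
      forall q, S q -> [/\ N q != 0, tangentS3 q (N q) &
        forall v, half_tangent S q v -> dot (N q) v = 0] &
      forall q, surface_interior S q -> 0 < dot (N q) (flow_field q)].

Definition outward (S : set E) (p n : E) : Prop :=
  half_tangent S p (- n) /\ ~ half_tangent S p n.

(* Boundary orientation: outward vector first. *)
Definition positive_d_section (d : nat) (S : set E) : Prop :=
  d_section d S /\
  exists N, flow_orientation S N /\
    forall p n, surface_boundary S p -> outward S p n ->
      0 < det4 p n (flow_field p) (N p).

(* Meaningful for z != 0. *)
Definition weighted_proj (z : E) : E :=
  get [set p | S3 p /\ exists r : R, 0 < r /\
    p = cpt (z1 z / (r ^+ a1)%:C) (z2 z / (r ^+ a2)%:C)].

Definition affine_part (f : mpoly 2 R[i]) : set E :=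
  [set z | eval2 f (z1 z) (z2 z) = 1].

Definition defines_positive_d_section (d : nat) (f : mpoly 2 R[i]) :
    Prop :=
  exists S : set E,
    [/\ positive_d_section d S,
        smooth_embedding (affine_part f) weighted_proj &
        weighted_proj @` affine_part f = surface_interior S].

End Flow.
End Sections.

(* Main.v *)
Require Import Defs.
From HB Require Import structures.
From mathcomp Require Import all_boot all_order all_algebra.
From mathcomp Require Import all_classical all_reals all_analysis.
From mathcomp Require Import complex ring lra.
From mathcomp Require Import -(notations) mpoly.
Import Order.TTheory GRing.Theory Num.Theory.
Import numFieldNormedType.Exports.

Set Implicit Arguments.
Unset Strict Implicit.
Unset Printing Implicit Defensive.

Local Open Scope classical_set_scope.
Local Open Scope complex_scope.
Local Open Scope ring_scope.

(* Proof idea.  Let Y = (a1 z1, a2 z2) be the weighted radial field and X = iY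
   the flow field.  Since f is weighted homogeneous, the weighted radial
   projection of {f = 1} is the part of S^3 where f is real and positive; on it
   d(Im f)(X) = d f > 0, so it is a surface transverse to the flow, and every
   regular orbit, along which f turns d times, hits it in d points.

   If F is nonsingular, then df is nonzero on the zeros of f away from the
   origin (for d = 1 because f is then a nonzero linear form in the coordinates
   of weight 1); as Y is in the kernel of df there, df maps T S^3 onto C, and
   {f >= 0} is locally the half surface {Im f = 0, Re f >= 0}.  The gradient of
   Im f on S^3 orients it.

   Conversely, if df = 0 at a zero q of f on S^3, restrict f to a complex line
   through q transverse to Y: f = w^m Q(w) with m >= 2 and Q(0) <> 0.  Each o
   with o^m Q(0) = 1 is, modulo Y and X, tangent at q to the closure of {f > 0}.
   These directions must all lie on one and the same ray, because the section is
   {g = 0, h >= 0} near the boundary point q and (dg, dh) is an isomorphism on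
   T S^3 / X; but for m >= 2 two of them differ. *)

(** * Functions of class C^k *)

(** Membership in [half_tangent S p] must be witnessed by an actual curve in S, but the curve only
    needs a velocity at 0. Its points can therefore be found separately for each small t > 0: a
    first-order estimate gives a real function of an auxiliary parameter s opposite signs at s = e
    and s = -e, the intermediate value theorem yields a zero with |s| <= e, and [select_near0] picks
    zeros tending to 0. This device serves twice, to follow a level set in S^3 and to follow a ray
    on which a slice of f stays positive; the weighted radial projection brings the curves back to
    S^3.

    In the converse, q lies in S because S is closed and q is a limit of points with f > 0; it is a
    boundary point because f > 0 on the interior. Two directions suffice: o and exp(2 i pi / m) o.
    Both lie on the real line ker dg, which forces the root of unity to be -1; then dh >= 0 on o and
    on -o, so dh vanishes on ker dg, which contradicts the chart. *)

Lemma near_eq_continuous (T U : topologicalType) (f g : T -> U) (x : T) :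
  (\forall y \near x, f y = g y) -> {for x, continuous f} -> {for x, continuous g}.
Proof.
move=> fg cf; have cx : f @ x --> f x := cf.
rewrite (nbhs_singleton fg) in cx; apply: cvg_trans cx.
exact: near_eq_cvg.
Qed.

Section Diff.
Variables (R : realType) (V W : normedModType R).

Lemma is_diff_eps (f : V -> W) (x : V) (L : {linear V -> W}) :
  continuous L ->
  (forall e, 0 < e -> \forall h \near (0 : V),
     `|f (h + x) - f x - L h| <= e * `|h|) ->
  is_diff x f L.
Proof.
move=> cL H.
have dE : f \o shift x = cst (f x) + L +o_ (0 : V) id.
  apply/eqaddoP => e /H; apply: filterS => h.
  by rewrite !fctE /= opprD addrA.
have dL := diff_unique cL dE.
by apply: DiffDef => //; apply/diff_locallyP; rewrite dL.
Qed.

Lemma diff_eps (f : V -> W) (x : V) e : differentiable f x -> 0 < e ->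
  \forall h \near (0 : V), `|f (h + x) - f x - 'd f x h| <= e * `|h|.
Proof.
move=> /diff_locally /eqaddoP H /H; apply: filterS => h.
by rewrite !fctE /= opprD addrA.
Qed.

Lemma near_shift0 (P : set V) (x : V) :
  (\forall y \near x, P y) -> \forall h \near (0 : V), P (h + x).
Proof. by rewrite (near_shift (0 : V)) subr0. Qed.

Lemma near_eq_diff (f g : V -> W) (x : V) :
  (\forall y \near x, f y = g y) -> differentiable f x -> differentiable g x.
Proof.
move=> fg df; suff [] : is_diff x g ('d f x) by [].
apply: is_diff_eps; first exact: diff_continuous.
move=> e e0; near=> h.
rewrite -(nbhs_singleton fg) -(near (near_shift0 fg) h) //.
by near: h; exact: diff_eps.
Unshelve. all: by end_near. Qed.

End Diff.

Section Ck.
Variable R : realType.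
Local Notation E := 'rV[R]_4.
Implicit Types (U : set E) (f g : E -> R).

Lemma Ck_onS k U g : Ck_on k.+1 U g -> Ck_on k U g.
Proof.
elim: k g => [|k IH] g [dg Dg]; last by split=> // i; apply/IH/Dg.
by move=> x Ux; apply/differentiable_continuous/dg.
Qed.

Lemma Ck_on_sub k U1 U2 g : U1 `<=` U2 -> Ck_on k U2 g -> Ck_on k U1 g.
Proof.
move=> s; elim: k g => [|k IH] g /=; first by move=> h x /s; exact: h.
by move=> [d D]; split=> [x /s|i]; [exact: d|apply/IH/D].
Qed.

(** Openness of U is what carries the equality to all iterated derivatives: a derivative at x
    depends only on the germ at x. *)
Lemma Ck_on_eq k U f g : open U -> (forall x, U x -> f x = g x) ->
  Ck_on k U f -> Ck_on k U g.
Proof.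
move=> oU; elim: k f g => [|k IH] f g fg.
  move=> cf x Ux; apply: near_eq_continuous (cf x Ux).
  by apply: filterS (open_nbhs_nbhs (conj oU Ux)) => y /fg.
have nfg x : U x -> \forall y \near x, f y = g y.
  by move=> Ux; apply: filterS (open_nbhs_nbhs (conj oU Ux)) => y /fg.
move=> [df Df]; split=> [x Ux|i]; first by apply: near_eq_diff (df x Ux); exact: nfg.
by apply: IH (Df i) => x Ux; apply: near_eq_derive; exact: nfg.
Qed.

Lemma Ck_on_ext k U f g : f =1 g -> Ck_on k U f -> Ck_on k U g.
Proof. by move=> /funext ->. Qed.

Lemma Ck_on_cst k U (c : R) : Ck_on k U (fun=> c).
Proof.
elim: k c => [|k IH] c; first by move=> x _; exact: cst_continuous.
split=> [x _|i]; first exact: differentiable_cst.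
by apply: Ck_on_ext (IH 0) => x; rewrite derive_cst.
Qed.

Lemma Ck_onD k U f g : open U -> Ck_on k U f -> Ck_on k U g ->
  Ck_on k U (fun x => f x + g x).
Proof.
move=> oU; elim: k f g => [|k IH] f g; first by move=> cf cg x Ux; exact: continuousD (cf x Ux) (cg x Ux).
move=> [df Df] [dg Dg]; split=> [x Ux|i].
  by apply: differentiableD; [exact: df|exact: dg].
apply: Ck_on_eq (IH _ _ (Df i) (Dg i)) => // x Ux /=.
by rewrite [RHS]deriveD //; apply: diff_derivable; [exact: df|exact: dg].
Qed.

Lemma Ck_onM k U f g : open U -> Ck_on k U f -> Ck_on k U g ->
  Ck_on k U (fun x => f x * g x).
Proof.
move=> oU; elim: k f g => [|k IH] f g; first by move=> cf cg x Ux; exact: continuousM (cf x Ux) (cg x Ux).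
move=> fC gC; have [df Df] := fC; have [dg Dg] := gC; split=> [x Ux|i].
  by apply: differentiableM; [exact: df|exact: dg].
apply: Ck_on_eq (Ck_onD oU (IH _ _ (Ck_onS fC) (Dg i)) (IH _ _ (Ck_onS gC) (Df i))) => // x Ux /=.
by rewrite [RHS]deriveM //; apply: diff_derivable; [exact: df|exact: dg].
Qed.

Lemma Ck_onX k U f n : open U -> Ck_on k U f -> Ck_on k U (fun x => f x ^+ n).
Proof.
move=> oU Cf; elim: n => [|n IH]; first exact: Ck_on_cst.
by apply: Ck_on_ext (Ck_onM oU Cf IH) => x; rewrite exprS.
Qed.

(** The derivative of 1/f is -(1/f)(1/f)f', so the class of 1/f at stage k gives its class at stage
    k + 1. *)
Lemma Ck_onV k U f : open U -> (forall x, U x -> f x != 0) -> Ck_on k U f ->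
  Ck_on k U (fun x => (f x)^-1).
Proof.
move=> oU f0; elim: k => [|k IH] fC; first by move=> x Ux; exact: continuousV (f0 x Ux) (fC x Ux).
have [df Df] := fC; split=> [x Ux|i].
  by apply: differentiableV; [exact: df|exact: f0].
have IHf := IH (Ck_onS fC).
have := Ck_onM oU (Ck_on_cst k U (-1)) (Ck_onM oU (Ck_onM oU IHf IHf) (Df i)).
apply: Ck_on_eq => // x Ux /=.
rewrite [RHS]deriveV ?f0 //; last exact/diff_derivable/df.
by rewrite /GRing.scale /= expr2 invfM mulN1r mulNr.
Qed.

Lemma derive_coord (x v : E) i : 'D_v (fun y : E => y 0 i : R^o) x = v 0 i.
Proof.
by have := @derive_mx _ _ _ _ id x v (@derivable_id _ _ x v) => /matrixP/(_ 0 i); rewrite derive_id mxE.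
Qed.

Lemma Ck_on_coord k U i : Ck_on k U (fun x => x 0 i).
Proof.
case: k => [|k]; first by move=> x _; apply/differentiable_continuous/differentiable_coord.
split=> [x _|j]; first exact: differentiable_coord.
by apply: Ck_on_ext (Ck_on_cst k U ((delta_mx 0 j : E) 0 i)) => x; rewrite derive_coord.
Qed.
End Ck.

(** * Derivatives of polynomial functions *)

(** Constants and variables generate the algebra. Facts about evaluation, derivatives and
    smoothness, all compatible with sums and products, can thus be proved without handling
    monomials. *)
Lemma mpoly_alg_ind n (K : fieldType) (P : mpoly n K -> Prop) :
  (forall c, P (mpolyC n c)) -> (forall i, P (mpolyX K (mnm1 i))) ->
  (forall f g, P f -> P g -> P (f + g)) -> (forall f g, P f -> P g -> P (f * g)) ->
  forall f, P f.
Proof.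
move=> PC PX PD PM; elim/mpolyind => [|c m f _ _ Pf]; first by rewrite -mpolyC0; exact: PC.
apply: (PD) => //; rewrite -mul_mpolyC; apply: (PM) => //.
rewrite mpolyXE_id; apply: (big_ind P) => // [|i _]; first by rewrite -mpolyC1; exact: PC.
elim: (m i) => [|k IH]; first by rewrite expr0 -mpolyC1; exact: PC.
by rewrite exprS; exact: PM.
Qed.

Lemma mderiv_mpolyXU n (K : fieldType) (i j : 'I_n) :
  mderiv i (mpolyX K (mnm1 j)) = if i == j then 1 else 0.
Proof.
rewrite mderivX mnm1E; have [->|ne] := eqVneq i j; last by rewrite scale0r.
rewrite scale1r (_ : mnm_sub _ _ = mnm0) ?mpolyX0 //.
by apply/mnmP => k; rewrite mnmBE subnn mnm0E.
Qed.

Section Eval2.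
Variable K : fieldType.
Implicit Types (f g : mpoly 2 K) (x y : K).

Lemma eval2C c x y : eval2 (mpolyC 2 c) x y = c.
Proof. exact: mevalC. Qed.

Lemma eval2_X0 x y : eval2 (mpolyX K (mnm1 0)) x y = x.
Proof. exact: mevalXU. Qed.

Lemma eval2_X1 x y : eval2 (mpolyX K (mnm1 1)) x y = y.
Proof. exact: mevalXU. Qed.

Lemma eval2D f g x y : eval2 (f + g) x y = eval2 f x y + eval2 g x y.
Proof. exact: mevalD. Qed.

Lemma eval2M f g x y : eval2 (f * g) x y = eval2 f x y * eval2 g x y.
Proof. exact: mevalM. Qed.

Lemma eval2_mderivC i c x y : eval2 (mderiv i (mpolyC 2 c)) x y = 0.
Proof. by rewrite mderivC /eval2 meval0. Qed.

Lemma eval2_mderivX i j x y :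
  eval2 (mderiv i (mpolyX K (mnm1 j))) x y = (i == j)%:R.
Proof. by rewrite mderiv_mpolyXU /eval2; case: eqP => _; rewrite ?meval0 ?meval1. Qed.

Lemma eval2_mderivD i f g x y : eval2 (mderiv i (f + g)) x y
  = eval2 (mderiv i f) x y + eval2 (mderiv i g) x y.
Proof. by rewrite mderivD eval2D. Qed.

Lemma eval2_mderivM i f g x y : eval2 (mderiv i (f * g)) x y
  = eval2 (mderiv i f) x y * eval2 g x y + eval2 f x y * eval2 (mderiv i g) x y.
Proof. by rewrite mderivM eval2D !eval2M. Qed.

Lemma mpoly2_ind (P : mpoly 2 K -> Prop) :
  (forall c, P (mpolyC 2 c)) -> P (mpolyX K (mnm1 0)) -> P (mpolyX K (mnm1 1)) ->
  (forall f g, P f -> P g -> P (f + g)) -> (forall f g, P f -> P g -> P (f * g)) ->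
  forall f, P f.
Proof.
move=> PC P0 P1 PD PM; elim/mpoly_alg_ind => // i.
by case: (unliftP 0 i) => [j ->|-> //]; rewrite ord1 (_ : lift 0 0 = 1) //; exact: val_inj.
Qed.

Definition deval2 f x y u v :=
  eval2 (mderiv 0 f) x y * u + eval2 (mderiv 1 f) x y * v.

Lemma deval2C c x y u v : deval2 (mpolyC 2 c) x y u v = 0.
Proof. by rewrite /deval2 !eval2_mderivC !mul0r addr0. Qed.

Lemma deval2_X0 x y u v : deval2 (mpolyX K (mnm1 0)) x y u v = u.
Proof. by rewrite /deval2 !eval2_mderivX mul0r mul1r addr0. Qed.

Lemma deval2_X1 x y u v : deval2 (mpolyX K (mnm1 1)) x y u v = v.
Proof. by rewrite /deval2 !eval2_mderivX mul0r mul1r add0r. Qed.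

Lemma deval2D f g x y u v :
  deval2 (f + g) x y u v = deval2 f x y u v + deval2 g x y u v.
Proof. by rewrite /deval2 !eval2_mderivD; ring. Qed.

Lemma deval2M f g x y u v : deval2 (f * g) x y u v
  = eval2 f x y * deval2 g x y u v + deval2 f x y u v * eval2 g x y.
Proof. by rewrite /deval2 !eval2_mderivM; ring. Qed.

End Eval2.

Section HasDiff.
Variables (R : realType) (V : normedModType R).
Implicit Types (f g L M : V -> R) (p v : V).

(** Differentiability is bundled with an explicit formula for the differential. L is a bare
    function, so formulas combine by the usual rules and are adjusted pointwise with
    [has_diff_ext]. *)
Definition has_diff f p L : Prop :=
  differentiable (f : V -> R^o) p /\ forall v, 'd (f : V -> R^o) p v = L v.

Lemma has_diff_ext f g p L M : f =1 g -> L =1 M -> has_diff f p L -> has_diff g p M.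
Proof. by move=> /funext -> /funext ->. Qed.

Lemma has_diff_cst (c : R) p : has_diff (fun=> c) p (fun=> 0).
Proof.
split=> [|v]; first exact: differentiable_cst.
exact: (congr1 (fun h : V -> R^o => h v) (diff_cst _ p)).
Qed.

Lemma has_diffD f g p L M : has_diff f p L -> has_diff g p M ->
  has_diff (fun x => f x + g x) p (fun v => L v + M v).
Proof.
move=> [df Lf] [dg Mg]; split=> [|v]; first exact: differentiableD.
rewrite -Lf -Mg; exact: (congr1 (fun h : V -> R^o => h v) (diffD df dg)).
Qed.

Lemma has_diffB f g p L M : has_diff f p L -> has_diff g p M ->
  has_diff (fun x => f x - g x) p (fun v => L v - M v).
Proof.
move=> [df Lf] [dg Mg]; split=> [|v]; first exact: differentiableB.
rewrite -Lf -Mg; exact: (congr1 (fun h : V -> R^o => h v) (diffB df dg)).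
Qed.

Lemma has_diffM f g p L M : has_diff f p L -> has_diff g p M ->
  has_diff (fun x => f x * g x) p (fun v => f p * M v + g p * L v).
Proof.
move=> [df Lf] [dg Mg]; split=> [|v]; first exact: differentiableM.
rewrite -Lf -Mg; exact: (congr1 (fun h : V -> R^o => h v) (diffM df dg)).
Qed.

Lemma has_diffX f n p L : has_diff f p L ->
  has_diff (fun x => f x ^+ n) p (fun v => n%:R * f p ^+ n.-1 * L v).
Proof.
move=> Lf; elim: n => [|n IH].
  by apply: has_diff_ext (has_diff_cst 1 p) => v //; rewrite mul0r mul0r.
apply: has_diff_ext (has_diffM Lf IH) => v; first by rewrite exprS.
case: n {IH} => [|n]; first by rewrite !mul0r mulr0 add0r !mul1r.
by rewrite /= (exprS _ n) -[in RHS]natr1; ring.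
Qed.

Lemma has_diff_derive f p L v : has_diff f p L -> 'D_v (f : V -> R^o) p = L v.
Proof. by move=> [df <-]; exact: deriveE. Qed.

End HasDiff.

Lemma has_diff_coord (R : realType) (p : 'rV[R]_4) i :
  has_diff (fun x : 'rV[R]_4 => x 0 i) p (fun v => v 0 i).
Proof.
split=> [|v]; first exact: differentiable_coord.
by rewrite -deriveE ?derive_coord //; exact: differentiable_coord.
Qed.

Section Cx.
Variable R : realType.
Local Notation E := 'rV[R]_4.
Local Notation C := R[i].
Implicit Types (F G : E -> C) (p v : E).

Definition csmooth F : Prop := forall k,
  Ck_on k setT (fun x => complex.Re (F x)) /\ Ck_on k setT (fun x => complex.Im (F x)).

Definition has_cdiff F p (L : E -> C) : Prop :=
  has_diff (fun x => complex.Re (F x)) p (fun v => complex.Re (L v)) /\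
  has_diff (fun x => complex.Im (F x)) p (fun v => complex.Im (L v)).

Lemma csmooth_ext F G : F =1 G -> csmooth F -> csmooth G.
Proof. by move=> /funext ->. Qed.

Lemma csmooth_cst c : csmooth (fun=> c).
Proof. by move=> k; split; exact: Ck_on_cst. Qed.

Lemma ReD (a b : C) : complex.Re (a + b) = complex.Re a + complex.Re b.
Proof. by case: a b => [? ?] []. Qed.
Lemma ImD (a b : C) : complex.Im (a + b) = complex.Im a + complex.Im b.
Proof. by case: a b => [? ?] []. Qed.
Lemma ReM (a b : C) : complex.Re (a * b) =
  complex.Re a * complex.Re b - complex.Im a * complex.Im b.
Proof. by case: a b => [? ?] []. Qed.
Lemma ImM (a b : C) : complex.Im (a * b) =
  complex.Re a * complex.Im b + complex.Im a * complex.Re b.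
Proof. by case: a b => [? ?] []. Qed.

Lemma csmoothD F G : csmooth F -> csmooth G -> csmooth (fun x => F x + G x).
Proof.
move=> sF sG k; have [a b] := sF k; have [c d] := sG k; split.
  by apply: Ck_on_ext (Ck_onD openT a c) => x; rewrite ReD.
by apply: Ck_on_ext (Ck_onD openT b d) => x; rewrite ImD.
Qed.

Lemma csmoothM F G : csmooth F -> csmooth G -> csmooth (fun x => F x * G x).
Proof.
move=> sF sG k; have [a b] := sF k; have [c d] := sG k; split.
  apply: Ck_on_ext (Ck_onD openT (Ck_onM openT a c)
    (Ck_onM openT (Ck_on_cst _ _ (-1)) (Ck_onM openT b d))) => x.
  by rewrite ReM mulN1r.
by apply: Ck_on_ext (Ck_onD openT (Ck_onM openT a d) (Ck_onM openT b c)) => x;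
  rewrite ImM.
Qed.

Lemma csmooth_z1 : csmooth (@z1 R).
Proof. by move=> k; split; exact: Ck_on_coord. Qed.
Lemma csmooth_z2 : csmooth (@z2 R).
Proof. by move=> k; split; exact: Ck_on_coord. Qed.

Lemma csmooth_eval2 (f : mpoly 2 C) : csmooth (fun x => eval2 f (z1 x) (z2 x)).
Proof.
elim/mpoly2_ind: f => [c|||f g sf sg|f g sf sg].
- by apply: csmooth_ext (csmooth_cst c) => x; rewrite eval2C.
- by apply: csmooth_ext csmooth_z1 => x; rewrite eval2_X0.
- by apply: csmooth_ext csmooth_z2 => x; rewrite eval2_X1.
- by apply: csmooth_ext (csmoothD sf sg) => x; rewrite eval2D.
- by apply: csmooth_ext (csmoothM sf sg) => x; rewrite eval2M.
Qed.

Lemma csmooth_horner (P : {poly C}) F : csmooth F -> csmooth (fun x => P.[F x]).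
Proof.
move=> sF; elim/poly_ind: P => [|P c IH].
  by apply: csmooth_ext (csmooth_cst 0) => x; rewrite horner0.
apply: csmooth_ext (csmoothD (csmoothM IH sF) (csmooth_cst c)) => x.
by rewrite hornerMXaddC.
Qed.

Lemma has_cdiff_ext F G p L M : F =1 G -> L =1 M -> has_cdiff F p L -> has_cdiff G p M.
Proof. by move=> /funext -> /funext ->. Qed.

Lemma has_cdiff_cst c p : has_cdiff (fun=> c) p (fun=> 0).
Proof. by split; exact: has_diff_cst. Qed.

Lemma has_cdiffD F G p L M : has_cdiff F p L -> has_cdiff G p M ->
  has_cdiff (fun x => F x + G x) p (fun v => L v + M v).
Proof.
move=> [a b] [a' b']; split.
  by apply: has_diff_ext (has_diffD a a') => x; rewrite ReD.
by apply: has_diff_ext (has_diffD b b') => x; rewrite ImD.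
Qed.

Lemma has_cdiffM F G p L M : has_cdiff F p L -> has_cdiff G p M ->
  has_cdiff (fun x => F x * G x) p (fun v => F p * M v + L v * G p).
Proof.
move=> [a b] [a' b']; split.
  apply: has_diff_ext (has_diffB (has_diffM a a') (has_diffM b b')) => x;
    rewrite ?ReD !ReM //; ring.
apply: has_diff_ext (has_diffD (has_diffM a b') (has_diffM b a')) => x;
  rewrite ?ImD !ImM //; ring.
Qed.

Lemma has_cdiff_z1 p : has_cdiff (@z1 R) p (@z1 R).
Proof. by split; exact: has_diff_coord. Qed.
Lemma has_cdiff_z2 p : has_cdiff (@z2 R) p (@z2 R).
Proof. by split; exact: has_diff_coord. Qed.

(** Sum and product rules on generators are enough. The outcome matters later: the real differential
    on R^4 is given by formal partial derivatives, hence is complex linear, so df(iY) = i df(Y). *)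
Lemma has_cdiff_eval2 (f : mpoly 2 C) p :
  has_cdiff (fun x => eval2 f (z1 x) (z2 x)) p
    (fun v => deval2 f (z1 p) (z2 p) (z1 v) (z2 v)).
Proof.
elim/mpoly2_ind: f => [c|||f g sf sg|f g sf sg].
- by apply: has_cdiff_ext (has_cdiff_cst c p) => x; rewrite ?eval2C ?deval2C.
- by apply: has_cdiff_ext (has_cdiff_z1 p) => x; rewrite ?eval2_X0 ?deval2_X0.
- by apply: has_cdiff_ext (has_cdiff_z2 p) => x; rewrite ?eval2_X1 ?deval2_X1.
- by apply: has_cdiff_ext (has_cdiffD sf sg) => x; rewrite ?eval2D ?deval2D.
- by apply: has_cdiff_ext (has_cdiffM sf sg) => x; rewrite ?eval2M ?deval2M.
Qed.
End Cx.

(** * Weighted homogeneous polynomials *)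

Section Algebra.
Variable K : numFieldType.
Implicit Types (f : mpoly 2 K) (P Q : {poly K}).

Lemma restrict_eval2 f P1 P2 : exists P : {poly K},
  (forall w, P.[w] = eval2 f P1.[w] P2.[w]) /\
  (forall w, P^`().[w] = eval2 (mderiv 0 f) P1.[w] P2.[w] * P1^`().[w]
                       + eval2 (mderiv 1 f) P1.[w] P2.[w] * P2^`().[w]).
Proof.
elim/mpoly2_ind: f => [c|||f g [P [eP dP]] [Q [eQ dQ]]|f g [P [eP dP]] [Q [eQ dQ]]].
- exists c%:P; split=> w; first by rewrite eval2C hornerC.
  by rewrite !eval2_mderivC derivC horner0 !mul0r addr0.
- by exists P1; split=> w; rewrite ?eval2_X0 // !eval2_mderivX mul0r mul1r addr0.
- by exists P2; split=> w; rewrite ?eval2_X1 // !eval2_mderivX mul0r mul1r add0r.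
- exists (P + Q); split=> w; first by rewrite hornerD eval2D eP eQ.
  by rewrite derivD hornerD dP dQ !eval2_mderivD; ring.
- exists (P * Q); split=> w; first by rewrite hornerM eval2M eP eQ.
  by rewrite derivM hornerD !hornerM dP dQ eP eQ !eval2_mderivM; ring.
Qed.

(** Homogeneity is only known for nonzero scalars. In characteristic 0 the numbers 1, ..., size(P -
    Q) are already too many distinct roots for P - Q. *)
Lemma horner_ext_nz P Q : (forall w, w != 0 -> P.[w] = Q.[w]) -> P = Q.
Proof.
move=> PQ; apply/eqP; rewrite -subr_eq0; apply/negPn/negP => D0.
pose rs := [seq (i.+1)%:R : K | i <- iota 0 (size (P - Q))].
have := @max_poly_roots _ _ rs D0; rewrite size_map size_iota ltnn => H.
suff : false by []; apply: H.
  apply/allP => x /mapP [i _ ->].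
  by rewrite /root hornerD hornerN PQ ?subrr // pnatr_eq0.
by rewrite map_inj_uniq ?iota_uniq // => i j /eqP; rewrite eqr_nat => /eqP [].
Qed.

Lemma eval2_mderiv_eq0 f i : (forall x y, eval2 f x y = 0) ->
  forall x y, eval2 (mderiv i f) x y = 0.
Proof.
move=> f0 x y; case: (unliftP 0 i) => [j ->|->].
  have [P [eP dP]] := restrict_eval2 f x%:P 'X.
  have P0 : P = 0 by apply: horner_ext_nz => w _; rewrite eP f0 horner0.
  have := dP y; rewrite P0 !derivC derivX !hornerE => /esym.
  by rewrite ord1 (_ : lift 0 0 = 1) //; exact: val_inj.
have [P [eP dP]] := restrict_eval2 f 'X y%:P.
have P0 : P = 0 by apply: horner_ext_nz => w _; rewrite eP f0 horner0.
by have := dP x; rewrite P0 !derivC derivX !hornerE => /esym.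
Qed.

Lemma eval2_00 f : eval2 f 0 0 = mcoeff mnm0 f.
Proof.
have X0 i : mcoeff mnm0 (mpolyX K (mnm1 i)) = 0 :> K.
  rewrite mcoeffX; have -> // : (mnm1 i == mnm0) = false.
  by apply/eqP => /mnmP/(_ i); rewrite mnm1E eqxx mnm0E.
elim/mpoly2_ind: f => [c|||f g ef eg|f g ef eg].
- by rewrite eval2C mcoeffC eqxx mulr1.
- by rewrite eval2_X0 X0.
- by rewrite eval2_X1 X0.
- by rewrite eval2D mcoeffD ef eg.
- by rewrite eval2M rmorphM /= ef eg.
Qed.

(** Taylor at the origin: each coefficient is, up to a nonzero product of factorials, the value at 0
    of an iterated derivative, and these derivatives vanish identically with f. *)
Lemma eval2_eq0 f : (forall x y, eval2 f x y = 0) -> f = 0.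
Proof.
move=> f0; apply/mpolyP => m; rewrite mcoeff0.
have : mcoeff mnm0 (mderivm m f) = 0.
  rewrite -eval2_00 mderivm_foldr /=; move: (flatten _) => s.
  suff : forall x y, eval2 (foldr (@mderiv _ _) f s) x y = 0 by [].
  by elim: s => [|i s IH] //=; exact: eval2_mderiv_eq0.
rewrite mcoeff_mderivm addm0 => /eqP; rewrite mulrn_eq0 => /orP[|/eqP //].
by rewrite eqn0Ngt prodn_gt0 // => i; rewrite ffact_gt0.
Qed.

Section Homogeneous.
Variables (a1 a2 d : nat) (f : mpoly 2 K).
Hypothesis hf : forall l x y : K, l != 0 ->
  eval2 f (l ^+ a1 * x) (l ^+ a2 * y) = l ^+ d * eval2 f x y.

(** Euler's relation, by differentiating f(w^a1 x, w^a2 y) = w^d f(x, y) at w = 1. *)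
Lemma euler_eval2 x y : eval2 (mderiv 0 f) x y * (a1%:R * x)
  + eval2 (mderiv 1 f) x y * (a2%:R * y) = d%:R * eval2 f x y.
Proof.
have [P [eP dP]] := restrict_eval2 f (x *: 'X^a1) (y *: 'X^a2).
have PE : P = eval2 f x y *: 'X^d.
  apply: horner_ext_nz => w w0; rewrite eP !hornerZ !hornerXn.
  by rewrite ![_ * w ^+ _]mulrC hf.
have := dP 1; rewrite PE !derivZ !derivXn !hornerZ !hornerMn !hornerXn !expr1n !mulr1.
by move=> H; rewrite [RHS]mulrC H; ring.
Qed.

(** The derivative has weight d - a1, which can be negative; keeping l^a1 on the left avoids a
    truncated subtraction. *)
Lemma mderiv0_homogeneous l x y : l != 0 ->
  eval2 (mderiv 0 f) (l ^+ a1 * x) (l ^+ a2 * y) * l ^+ a1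
  = l ^+ d * eval2 (mderiv 0 f) x y.
Proof.
move=> l0.
have [P [eP dP]] := restrict_eval2 f (l ^+ a1 *: 'X) (l ^+ a2 * y)%:P.
have [Q [eQ dQ]] := restrict_eval2 f 'X y%:P.
have PE : P = l ^+ d *: Q.
  by apply: horner_ext_nz => w w0; rewrite hornerZ eP eQ !hornerE hf.
have := dP x; rewrite PE derivZ hornerZ dQ !derivZ !derivX !derivC !hornerE.
by rewrite /= !mulr1 => ->.
Qed.

Lemma mderiv1_homogeneous l x y : l != 0 ->
  eval2 (mderiv 1 f) (l ^+ a1 * x) (l ^+ a2 * y) * l ^+ a2
  = l ^+ d * eval2 (mderiv 1 f) x y.
Proof.
move=> l0.
have [P [eP dP]] := restrict_eval2 f (l ^+ a1 * x)%:P (l ^+ a2 *: 'X).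
have [Q [eQ dQ]] := restrict_eval2 f x%:P 'X.
have PE : P = l ^+ d *: Q.
  by apply: horner_ext_nz => w w0; rewrite hornerZ eP eQ !hornerE hf.
have := dP y; rewrite PE derivZ hornerZ dQ !derivZ !derivX !derivC !hornerE.
by rewrite /= !mulr1 => ->.
Qed.

Lemma mderiv0_homogeneous_eq0 l x y : l != 0 -> eval2 (mderiv 0 f) x y = 0 ->
  eval2 (mderiv 0 f) (l ^+ a1 * x) (l ^+ a2 * y) = 0.
Proof.
move=> l0 h; apply: (mulIf (expf_neq0 a1 l0)).
by rewrite mderiv0_homogeneous // h mulr0 mul0r.
Qed.

Lemma mderiv1_homogeneous_eq0 l x y : l != 0 -> eval2 (mderiv 1 f) x y = 0 ->
  eval2 (mderiv 1 f) (l ^+ a1 * x) (l ^+ a2 * y) = 0.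
Proof.
move=> l0 h; apply: (mulIf (expf_neq0 a2 l0)).
by rewrite mderiv1_homogeneous // h mulr0 mul0r.
Qed.

(** Here g has weight 1 - a <= 0. Along w -> (w^a1 x, w^a2 y) it is a polynomial whose product with
    w^(a-1) is the constant g(x, y); w = 0 gives the formula. So g is constant if a = 1 and zero
    otherwise. *)
Lemma homogeneous_grad_const (g : mpoly 2 K) a : (0 < a)%N ->
  (forall l x y, l != 0 -> eval2 g (l ^+ a1 * x) (l ^+ a2 * y) * l ^+ a
     = l * eval2 g x y) -> (0 < a1)%N -> (0 < a2)%N ->
  forall x y, eval2 g x y = 0 ^+ a.-1 * eval2 g 0 0.
Proof.
case: a => // a _ hg a10 a20 x y.
have [P [eP _]] := restrict_eval2 g (x *: 'X^a1) (y *: 'X^a2).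
have : P * 'X^a = (eval2 g x y)%:P.
  apply: horner_ext_nz => w w0; rewrite hornerM eP !hornerZ !hornerXn hornerC.
  apply: (mulfI w0); rewrite -hg // mulrCA -exprS.
  by rewrite ![_ * w ^+ _]mulrC.
move=> /(congr1 (fun Q => Q.[0])); rewrite hornerM eP !hornerZ !hornerXn hornerC.
have z n : (0 < n)%N -> 0 ^+ n = 0 :> K by case: n => // n; rewrite expr0n.
by rewrite (z _ a10) (z _ a20) !mulr0 => <-; rewrite mulrC.
Qed.

(** In degree 1 both partial derivatives have nonpositive weight and are therefore constant. If they
    vanish at one point they vanish everywhere, and Euler's relation kills f. *)
Lemma homogeneous1_nonsingular x y : d = 1%N -> (0 < a1)%N -> (0 < a2)%N ->
  eval2 (mderiv 0 f) x y = 0 -> eval2 (mderiv 1 f) x y = 0 -> f = 0.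
Proof.
move=> d1 a10 a20 f1 f2.
have h1 := homogeneous_grad_const a10 _ a10 a20.
have E1 u v : eval2 (mderiv 0 f) u v = 0.
  rewrite (h1 (mderiv 0 f)); last by move=> *; rewrite mderiv0_homogeneous // d1.
  by rewrite -(h1 (mderiv 0 f) _ x y) // => *; rewrite mderiv0_homogeneous // d1.
have h2 := homogeneous_grad_const a20 _ a10 a20.
have E2 u v : eval2 (mderiv 1 f) u v = 0.
  rewrite (h2 (mderiv 1 f)); last by move=> *; rewrite mderiv1_homogeneous // d1.
  by rewrite -(h2 (mderiv 1 f) _ x y) // => *; rewrite mderiv1_homogeneous // d1.
apply: eval2_eq0 => u v; have := euler_eval2 u v.
by rewrite E1 E2 !mul0r addr0 d1 mul1r.
Qed.
End Homogeneous.

(** * Singular points of F in terms of f *)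

Section Curve.
Variables (d : nat) (f : mpoly 2 K).

Lemma eval3_var3 (i : 'I_3) x0 x1 x2 : eval3 (var3 K i) x0 x1 x2 = vec3 x0 x1 x2 i.
Proof. exact: mevalXU. Qed.

Lemma eval3D (F G : mpoly 3 K) x0 x1 x2 :
  eval3 (F + G) x0 x1 x2 = eval3 F x0 x1 x2 + eval3 G x0 x1 x2.
Proof. exact: mevalD. Qed.

Lemma eval3B (F G : mpoly 3 K) x0 x1 x2 :
  eval3 (F - G) x0 x1 x2 = eval3 F x0 x1 x2 - eval3 G x0 x1 x2.
Proof. exact: mevalB. Qed.

Lemma eval3M (F G : mpoly 3 K) x0 x1 x2 :
  eval3 (F * G) x0 x1 x2 = eval3 F x0 x1 x2 * eval3 G x0 x1 x2.
Proof. exact: mevalM. Qed.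

Lemma eval3X (F : mpoly 3 K) n x0 x1 x2 : eval3 (F ^+ n) x0 x1 x2 = eval3 F x0 x1 x2 ^+ n.
Proof. exact: rmorphXn. Qed.

Lemma eval3_curve_map (g : mpoly 2 K) x0 x1 x2 :
  eval3 (comp_mpoly [tuple var3 K 1; var3 K 2] g) x0 x1 x2 = eval2 g x1 x2.
Proof.
elim/mpoly2_ind: g => [c|||g h eg eh|g h eg eh].
- by rewrite comp_mpolyC /eval3 mevalC eval2C.
- by rewrite comp_mpolyXU eval3_var3 eval2_X0.
- by rewrite comp_mpolyXU eval3_var3 eval2_X1.
- by rewrite comp_mpolyD eval3D eval2D eg eh.
- by rewrite (rmorphM (comp_mpoly _)) eval3M eval2M eg eh.
Qed.

Lemma eval3_curve_poly x0 x1 x2 :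
  eval3 (curve_poly f d) x0 x1 x2 = eval2 f x1 x2 - x0 ^+ d.
Proof. by rewrite eval3B eval3_curve_map eval3X eval3_var3. Qed.

Lemma eval3_mderiv_var3 (i j : 'I_3) x0 x1 x2 :
  eval3 (mderiv i (var3 K j)) x0 x1 x2 = (i == j)%:R.
Proof. by rewrite mderiv_mpolyXU /eval3; case: eqP => _; rewrite ?meval0 ?meval1. Qed.

Lemma eval3_mderiv_curve_map (g : mpoly 2 K) i x0 x1 x2 :
  eval3 (mderiv i (comp_mpoly [tuple var3 K 1; var3 K 2] g)) x0 x1 x2
  = eval2 (mderiv 0 g) x1 x2 * (i == 1)%:R + eval2 (mderiv 1 g) x1 x2 * (i == 2)%:R.
Proof.
elim/mpoly2_ind: g => [c|||g h eg eh|g h eg eh].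
- by rewrite comp_mpolyC mderivC /eval3 meval0 !eval2_mderivC !mul0r addr0.
- by rewrite comp_mpolyXU eval3_mderiv_var3 !eval2_mderivX mul0r mul1r addr0.
- by rewrite comp_mpolyXU eval3_mderiv_var3 !eval2_mderivX mul0r mul1r add0r.
- by rewrite comp_mpolyD mderivD eval3D eg eh !eval2_mderivD; ring.
- rewrite (rmorphM (comp_mpoly _)) mderivM eval3D !eval3M eg eh !eval3_curve_map.
  by rewrite !eval2_mderivM; ring.
Qed.

Lemma eval3_mderiv_curve_poly i x0 x1 x2 :
  eval3 (mderiv i (curve_poly f d)) x0 x1 x2
  = eval2 (mderiv 0 f) x1 x2 * (i == 1)%:R + eval2 (mderiv 1 f) x1 x2 * (i == 2)%:R
    - d%:R * x0 ^+ d.-1 * (i == 0)%:R.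
Proof.
rewrite /curve_poly mderivB eval3B eval3_mderiv_curve_map.
congr (_ - _); elim: d => [|n IH].
  by rewrite expr0 -mpolyC1 mderivC /eval3 meval0 !mul0r.
rewrite exprS mderivM eval3D !eval3M eval3X IH eval3_mderiv_var3 eval3_var3.
rewrite (_ : vec3 _ _ _ 0 = x0) //.
case: n {IH} => [|n]; first by rewrite !mul0r mulr0 addr0 expr0; ring.
by rewrite /= (exprS x0 n) -[in RHS]natr1; ring.
Qed.

End Curve.

Lemma weighted_homogeneous_eval2 a1 a2 d f : (0 < d)%N ->
  weighted_homogeneous a1 a2 d (curve_poly f d) ->
  forall l x y : K, l != 0 ->
    eval2 f (l ^+ a1 * x) (l ^+ a2 * y) = l ^+ d * eval2 f x y.
Proof.
move=> d_gt0 wh l x y l0; have := wh l 0 x y l0; rewrite !eval3_curve_poly.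
by rewrite mulr0 expr0n gtn_eqF // !subr0.
Qed.

(** The derivative of F in z0 is -d z0^(d-1): it never vanishes for d = 1, and for d >= 2 it forces
    z0 = 0, which leaves the conditions on f alone. *)
Lemma nonsingular_curve_poly d f : (0 < d)%N ->
  nonsingular (curve_poly f d) <->
  (d = 1%N \/ forall x y, eval2 f x y = 0 -> eval2 (mderiv 0 f) x y = 0 ->
     eval2 (mderiv 1 f) x y = 0 -> x = 0 /\ y = 0).
Proof.
case: d => // -[|n] _.
  split=> [_|_]; first by left.
  move=> [x0 [x1 [x2 [_ _ /(_ 0)]]]].
  rewrite eval3_mderiv_curve_poly !mulr0 expr0 !mulr1 addr0 sub0r.
  by move/eqP; rewrite oppr_eq0 oner_eq0.
split=> [ns|[//|ns]].
  right=> x y f0 f1 f2; case: (eqVneq (0 : K, x, y) (0, 0, 0)) => [[-> ->] //|nz].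
  exfalso; apply: ns; exists 0, x, y; split => //.
    by rewrite eval3_curve_poly f0 expr0n subr0.
  by move=> i; rewrite eval3_mderiv_curve_poly f1 f2 expr0n /= !(mul0r,mulr0) addr0 subr0.
move=> [x0 [x1 [x2 [nz F0 dF]]]].
have x00 : x0 = 0.
  have := dF 0; rewrite eval3_mderiv_curve_poly !mulr0 !mulr1 addr0 sub0r /=.
  by move/eqP; rewrite oppr_eq0 mulf_eq0 pnatr_eq0 /= expf_eq0 => /eqP.
move: F0; rewrite eval3_curve_poly x00 expr0n subr0 => f0.
have := dF 1; rewrite eval3_mderiv_curve_poly /= !mulr0 mulr1 addr0 subr0 => f1.
have := dF 2; rewrite eval3_mderiv_curve_poly /= !mulr0 mulr1 add0r subr0 => f2.
have [e1 e2] := ns _ _ f0 f1 f2.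
by move: nz; rewrite x00 e1 e2 eqxx.
Qed.
End Algebra.

(** * Velocities of curves *)

Section MoreDiff.
Variables (R : realType) (V : normedModType R).
Implicit Types (f g k L M : V -> R) (p v : V).

Lemma has_diff_near_eq f g p L : (\forall x \near p, f x = g x) ->
  has_diff f p L -> has_diff g p L.
Proof.
move=> fg [df Lf]; have dg := near_eq_diff fg df.
split=> [|v]; first exact: dg.
apply: etrans (esym (deriveE v dg)) _.
apply: etrans (esym (near_eq_derive v fg)) _.
exact: etrans (deriveE v df) (Lf v).
Qed.

Lemma has_diff_continuous f p L : has_diff f p L -> {for p, continuous f}.
Proof. by move=> [/differentiable_continuous]. Qed.

Lemma has_diff_lin f p L (a b : R) (v w : V) : has_diff f p L ->
  L (a *: v + b *: w) = a * L v + b * L w.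
Proof. by move=> [_ Lf]; rewrite -!Lf linearD !linearZ. Qed.

(** The increment of f is of first order, so an error o(1) in k only costs o(|h|). Continuity of k
    at p thus suffices, which is what allows [wscale] to be differentiated when only its continuity
    is known. *)
Lemma has_diff_vanishing f k p L : has_diff f p L -> f p = 0 ->
  {for p, continuous k} -> has_diff (fun x => k x * f x) p (fun v => k p * L v).
Proof.
move=> [df Lf] f0 ck.
suff [dm mE] : is_diff p ((fun x => k x * f x) : V -> R^o) (k p \*: 'd (f : V -> R^o) p).
  split=> [|v]; first exact: dm.
  exact: etrans (congr1 (fun h : V -> R^o => h v) mE) (congr1 ( *%R (k p)) (Lf v)).
apply: is_diff_eps; first by move=> x; apply: continuousZl_tmp; exact: diff_continuous.
have [M M0 HM] := linear_lipschitz (diff_continuous df).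
move=> e e0.
have K0 : 0 < `|k p| + 1 by rewrite ltr_wpDl.
have H1 := diff_eps df (divr_gt0 (divr_gt0 e0 (ltr0n _ 2)) K0).
have /cvgrPdist_le ck' := ck.
(* M is a Lipschitz constant of the differential. The minimum with 1 also gives |k (h + p)| <= |k p|
   + 1, the factor divided out of the other half of e. *)
have eM : 0 < Num.min 1 (e / 2 / M) by rewrite lt_min ltr01 !divr_gt0.
have H2 := near_shift0 (ck' _ eM).
near=> h.
have h1 : `|f (h + p) - f p - 'd (f : V -> R^o) p h| <= e / 2 / (`|k p| + 1) * `|h|.
  by near: h; exact: H1.
have h2 : `|k p - k (h + p)| <= Num.min 1 (e / 2 / M) by near: h; exact: H2.
have h3 := HM h.
rewrite /= f0 mulr0 subr0 /GRing.scale /=.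
have -> : k (h + p) * f (h + p) - k p * 'd (f : V -> R^o) p h =
  k (h + p) * (f (h + p) - f p - 'd (f : V -> R^o) p h)
  - (k p - k (h + p)) * 'd (f : V -> R^o) p h by rewrite f0; ring.
apply: le_trans (ler_normB _ _) _; rewrite !normrM (splitr e) mulrDl.
have k1 : `|k (h + p)| <= `|k p| + 1.
  rewrite -[X in `|X|](subrKC (k p)) (le_trans (ler_normD _ _)) // lerD2l distrC.
  by apply: le_trans h2 _; rewrite ge_min lexx.
apply: lerD.
  apply: le_trans (ler_pM (normr_ge0 _) (normr_ge0 _) k1 h1) _.
  by rewrite mulrCA mulrA divfK ?lt0r_neq0.
apply: le_trans (ler_pM (normr_ge0 _) (normr_ge0 _) h2 h3) _.
rewrite mulrA ler_wpM2r //.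
apply: le_trans (ler_wpM2r (ltW M0) (_ : _ <= e / 2 / M)) _; first by rewrite ge_min lexx orbT.
by rewrite divfK // lt0r_neq0.
Unshelve. all: by end_near. Qed.
End MoreDiff.

Section Velocity.
Variable R : realType.
Local Notation E := 'rV[R]_4.
Implicit Types (c : R -> E) (p v : E) (f L : E -> R).

(** The base point is p instead of [c 0]: only values for small t > 0 count. *)
Definition velocity c p v : Prop := (fun t => t^-1 *: (c t - p)) @ 0^'+ --> v.

Lemma velocity_coord c p v :
  (forall i, (fun t => t^-1 * (c t 0 i - p 0 i)) @ 0^'+ --> v 0 i) -> velocity c p v.
Proof.
move=> H; apply/cvgrPdist_le => e e0; near=> t.
rewrite [leLHS]/Num.Def.normr/= mx_normrE (bigmax_le _ (ltW e0)) //= => -[i j] _.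
rewrite !mxE /= ord1 {i}.
move: j; near: t; apply: filter_forall => j.
by have /cvgrPdist_le := H j; apply.
Unshelve. all: by end_near. Qed.

Lemma velocity_cvg c p v : velocity c p v -> c @ 0^'+ --> p.
Proof.
move=> cv.
have : (fun t => p + t *: (t^-1 *: (c t - p))) @ 0^'+ --> p + 0 *: v.
  apply: cvgD; first exact: cvg_cst.
  by apply: cvgZ => //; apply: cvg_at_right_filter; exact: cvg_id.
rewrite scale0r addr0; apply: cvg_trans; apply: near_eq_cvg; near=> t.
rewrite scalerA divff ?scale1r ?subrKC //.
Unshelve. all: by end_near. Qed.

(** A chain rule at an endpoint for a curve known only through its velocity: the remainder of f is
    o(|c t - p|), and |c t - p| <= (|v| + 1) t for small t. *)
Lemma has_diff_velocity f p L c v : has_diff f p L -> velocity c p v ->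
  (fun t => t^-1 * (f (c t) - f p)) @ 0^'+ --> L v.
Proof.
move=> [df Lf] cv.
have L1 : (fun t => L (t^-1 *: (c t - p))) @ 0^'+ --> L v.
  have -> : L = 'd (f : E -> R^o) p by apply: funext => w; rewrite Lf.
  by apply: (continuous_cvg _ _ cv); exact: diff_continuous.
have c0 : (fun t => c t - p) @ 0^'+ --> (0 : E).
  by rewrite -[X in _ --> X](subrr p); apply: cvgB; [exact: velocity_cvg cv|exact: cvg_cst].
have vb : \forall t \near 0^'+, `|t^-1 *: (c t - p)| <= `|v| + 1.
  have /cvgrPdist_le/(_ 1 ltr01) := cv; apply: filterS => t H.
  rewrite -[X in `|X|](subrKC v) (le_trans (ler_normD _ _)) // lerD2l.
  by rewrite distrC.
apply/cvgrPdist_le => e e0.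
have v1 : 0 < `|v| + 1 by rewrite ltr_wpDl.
have c0' : (fun t => c t - p) @ 0^'+ --> nbhs (0 : E) by exact: c0.
have H1 := c0' _ (diff_eps df (divr_gt0 (divr_gt0 e0 (ltr0n _ 2)) v1)).
have /cvgrPdist_le/(_ _ (divr_gt0 e0 (ltr0n _ 2))) H2 := L1.
near=> t.
have t0 : 0 < t by near: t; exact: nbhs_right_gt.
have h1 : `|f (c t - p + p) - f p - 'd (f : E -> R^o) p (c t - p)| <=
  e / 2 / (`|v| + 1) * `|c t - p| by near: t; exact: H1.
have h2 : `|L v - L (t^-1 *: (c t - p))| <= e / 2 by near: t; exact: H2.
have h3 : `|t^-1 *: (c t - p)| <= `|v| + 1 by near: t; exact: vb.
rewrite subrK in h1.
have dE : L (t^-1 *: (c t - p)) = t^-1 * 'd (f : E -> R^o) p (c t - p).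
  by rewrite -Lf linearZ.
have -> : L v - t^-1 * (f (c t) - f p) = (L v - L (t^-1 *: (c t - p))) -
   t^-1 * (f (c t) - f p - 'd (f : E -> R^o) p (c t - p)) by rewrite dE; ring.
rewrite (splitr e); apply: le_trans (ler_normB _ _) (lerD h2 _).
rewrite normrM gtr0_norm ?invr_gt0 //.
apply: le_trans (ler_wpM2l (ltW _) h1) _; first by rewrite invr_gt0.
rewrite normrZ gtr0_norm ?invr_gt0 // in h3.
rewrite mulrCA -[leRHS](divfK (lt0r_neq0 v1)) ler_wpM2l // !divr_ge0 // ltW //.
Unshelve. all: by end_near. Qed.
End Velocity.

(** * The weighted radial projection *)

Section Coord4.
Variable R : realType.
Local Notation E := 'rV[R]_4.
Implicit Types (p u v z : E).

Lemma ord4P (P : 'I_4 -> Prop) : P 0 -> P 1 -> P 2 -> P 3 -> forall i, P i.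
Proof.
move=> P0 P1 P2 P3 [[|[|[|[|//]]]] i].
- by rewrite (_ : Ordinal _ = 0) //; exact: val_inj.
- by rewrite (_ : Ordinal _ = 1) //; exact: val_inj.
- by rewrite (_ : Ordinal _ = 2) //; exact: val_inj.
- by rewrite (_ : Ordinal _ = 3) //; exact: val_inj.
Qed.

Lemma row4P u v : u 0 0 = v 0 0 -> u 0 1 = v 0 1 -> u 0 2 = v 0 2 -> u 0 3 = v 0 3 ->
  u = v.
Proof.
move=> e0 e1 e2 e3; apply/rowP => i; move: i.
exact: (@ord4P (fun i => u 0 i = v 0 i)).
Qed.

Lemma dotE u v : dot u v =
  u 0 0 * v 0 0 + u 0 1 * v 0 1 + u 0 2 * v 0 2 + u 0 3 * v 0 3.
Proof.
rewrite /dot !big_ord_recl big_ord0 addr0 !addrA.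
by congr (_ * _ + _ * _ + _ * _ + _ * _); congr (_ 0 _); exact: val_inj.
Qed.

Definition sq1 z : R := z 0 0 ^+ 2 + z 0 1 ^+ 2.
Definition sq2 z : R := z 0 2 ^+ 2 + z 0 3 ^+ 2.

Lemma sq1_ge0 z : 0 <= sq1 z. Proof. by rewrite addr_ge0 ?sqr_ge0. Qed.
Lemma sq2_ge0 z : 0 <= sq2 z. Proof. by rewrite addr_ge0 ?sqr_ge0. Qed.

Lemma dot_sq z : dot z z = sq1 z + sq2 z.
Proof. by rewrite dotE /sq1 /sq2 !expr2 !addrA. Qed.

Lemma sq_gt0 z : z != 0 -> 0 < sq1 z \/ 0 < sq2 z.
Proof.
move=> z0; have [s1|s1] := ltP 0 (sq1 z); [by left|have [s2|s2] := ltP 0 (sq2 z); [by right|]].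
have /eqP := @le_anti _ _ (sq1 z) 0 (introT andP (conj s1 (sq1_ge0 z))).
have /eqP := @le_anti _ _ (sq2 z) 0 (introT andP (conj s2 (sq2_ge0 z))).
rewrite !paddr_eq0 ?sqr_ge0 // !sqrf_eq0 => /andP[/eqP h2 /eqP h3] /andP[/eqP h0 /eqP h1].
by move/eqP: z0; case; apply: row4P; rewrite mxE.
Qed.

Lemma has_diff_sq1 z : has_diff sq1 z (fun v => 2 * (z 0 0 * v 0 0 + z 0 1 * v 0 1)).
Proof.
apply: has_diff_ext (has_diffD (has_diffX 2 (has_diff_coord z 0)) (has_diffX 2 (has_diff_coord z 1))) => v //=.
by rewrite !expr1; ring.
Qed.

Lemma has_diff_sq2 z : has_diff sq2 z (fun v => 2 * (z 0 2 * v 0 2 + z 0 3 * v 0 3)).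
Proof.
apply: has_diff_ext (has_diffD (has_diffX 2 (has_diff_coord z 2)) (has_diffX 2 (has_diff_coord z 3))) => v //=.
by rewrite !expr1; ring.
Qed.

Lemma open_neq0 : open [set z : E | z != 0].
Proof.
have -> : [set z : E | z != 0] = ~` [set 0].
  by apply/seteqP; split => z /= /eqP.
by rewrite openC; exact: accessible_closed_set1 (hausdorff_accessible (@norm_hausdorff _ _)) _.
Qed.
End Coord4.

Section WeightedProj.
Variables (R : realType) (a1 a2 : nat).
Hypotheses (a1_gt0 : (0 < a1)%N) (a2_gt0 : (0 < a2)%N).
Local Notation E := 'rV[R]_4.
Implicit Types (p u v z : E) (s t : R).

Definition weight (i : 'I_4) : nat := if (i < 2)%N then a1 else a2.
Definition rho s z : E := \row_i (s ^+ weight i * z 0 i).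
(** The squared norm of [rho s z] as a polynomial in s. Projecting z onto S^3 amounts to solving
    [wnorm z s = 1], where s is the inverse of the r in [weighted_proj]. *)
Definition wnorm z s : R := sq1 z * s ^+ (2 * a1) + sq2 z * s ^+ (2 * a2).

Lemma rhoM s t z : rho s (rho t z) = rho (s * t) z.
Proof. by apply/rowP => i; rewrite !mxE exprMn mulrA. Qed.

Lemma rho1 z : rho 1 z = z.
Proof. by apply/rowP => i; rewrite !mxE expr1n mul1r. Qed.

Lemma sq1_rho s z : sq1 (rho s z) = s ^+ (2 * a1) * sq1 z.
Proof. by rewrite /sq1 !mxE /= !exprMn -mulrDr mulnC exprM. Qed.

Lemma sq2_rho s z : sq2 (rho s z) = s ^+ (2 * a2) * sq2 z.
Proof. by rewrite /sq2 !mxE /= !exprMn -mulrDr mulnC exprM. Qed.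

Lemma S3_rho s z : S3 (rho s z) <-> wnorm z s = 1.
Proof. by rewrite /S3 /= dot_sq sq1_rho sq2_rho /wnorm ![_ ^+ _ * _]mulrC. Qed.

Lemma S3_neq0 p : S3 p -> p != 0.
Proof.
move=> Sp; apply/eqP => p0; move: Sp; rewrite p0 /S3 /= dotE !mxE !mulr0 !addr0.
by move/eqP; rewrite eq_sym oner_eq0.
Qed.

Lemma wnorm_lt z s t : z != 0 -> 0 <= s -> s < t -> wnorm z s < wnorm z t.
Proof.
move=> z0 s0 st; have X n : (0 < n)%N -> s ^+ (2 * n) < t ^+ (2 * n).
  by move=> n0; rewrite ltrXn2r // ?(lt_le_trans _ (ltW st)) // muln_eq0 -lt0n n0.
rewrite /wnorm; have [h|h] := sq_gt0 z0.
  by rewrite ltr_leD ?ltr_pM2l ?X // ler_wpM2l ?sq2_ge0 // ltW // X.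
by rewrite ler_ltD ?ltr_pM2l ?X // ler_wpM2l ?sq1_ge0 // ltW // X.
Qed.

Lemma wnorm_inj z s t : z != 0 -> 0 <= s -> 0 <= t -> wnorm z s = wnorm z t -> s = t.
Proof.
move=> z0 s0 t0 e; have [h|h|//] := ltgtP s t.
  by have := wnorm_lt z0 s0 h; rewrite e ltxx.
by have := wnorm_lt z0 t0 h; rewrite e ltxx.
Qed.

Lemma wnorm_continuous z : continuous (wnorm z).
Proof.
move=> s; apply: cvgD; apply: cvgM; first exact: cvg_cst.
- exact: exprn_continuous.
- exact: cvg_cst.
- exact: exprn_continuous.
Qed.

Lemma wnorm_solve z : z != 0 -> exists s, 0 < s /\ wnorm z s = 1.
Proof.
(* M >= 1 makes M^(2n) >= M, and [sq1 z * M >= 1] or [sq2 z * M >= 1] according to which of the two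
   is nonzero; the inverse of 0 being 0, the other summand does no harm. *)
move=> z0; pose M := 1 + (sq1 z)^-1 + (sq2 z)^-1.
have i1 : 0 <= (sq1 z)^-1 by rewrite invr_ge0 sq1_ge0.
have i2 : 0 <= (sq2 z)^-1 by rewrite invr_ge0 sq2_ge0.
have M1 : 1 <= M by rewrite /M; lra.
have M0 : 0 <= M by lra.
have XM n : (0 < n)%N -> M <= M ^+ (2 * n).
  by move=> n0; rewrite -[leLHS]expr1 ler_weXn2l // muln_gt0 n0.
have N0 : wnorm z 0 = 0.
  by rewrite /wnorm !expr0n !muln_eq0 !gtn_eqF //= !mulr0 addr0.
have NM : 1 <= wnorm z M.
  rewrite /wnorm; have [h|h] := sq_gt0 z0.
    apply: le_trans (_ : sq1 z * M ^+ (2 * a1) <= _); last first.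
      by rewrite lerDl mulr_ge0 ?sq2_ge0 ?exprn_ge0.
    apply: le_trans (ler_wpM2l (sq1_ge0 z) (XM _ a1_gt0)).
    rewrite -(divff (lt0r_neq0 h)) ler_wpM2l ?sq1_ge0 // /M; lra.
  apply: le_trans (_ : sq2 z * M ^+ (2 * a2) <= _); last first.
    by rewrite lerDr mulr_ge0 ?sq1_ge0 ?exprn_ge0.
  apply: le_trans (ler_wpM2l (sq2_ge0 z) (XM _ a2_gt0)).
  rewrite -(divff (lt0r_neq0 h)) ler_wpM2l ?sq2_ge0 // /M; lra.
have [|s] := @IVT R (wnorm z) 0 M 1 M0 (continuous_subspaceT (@wnorm_continuous z)).
  by rewrite N0 ge_min ler01 le_max NM orbT.
rewrite in_itv /= => /andP[s0 _] sE; exists s; split=> //.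
rewrite lt_neqAle s0 andbT; apply/eqP => s00; move: sE; rewrite -s00 N0.
by move/eqP; rewrite eq_sym oner_eq0.
Qed.

Definition wscale z : R := get [set s | 0 < s /\ wnorm z s = 1].

Lemma wscaleP z : z != 0 -> 0 < wscale z /\ wnorm z (wscale z) = 1.
Proof. by move=> /wnorm_solve [s Hs]; exact: (@getI _ [set s | 0 < s /\ wnorm z s = 1] s). Qed.

Lemma wscale_gt0 z : z != 0 -> 0 < wscale z.
Proof. by case/wscaleP. Qed.

Lemma wscale_eq z s : z != 0 -> 0 < s -> wnorm z s = 1 -> wscale z = s.
Proof.
move=> z0 s0 sE; have [u0 uE] := wscaleP z0.
by apply: (wnorm_inj z0); rewrite ?ltW // uE sE.
Qed.

Lemma wscale_S3 p : S3 p -> wscale p = 1.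
Proof.
move=> Sp; apply: wscale_eq => //; first exact: S3_neq0.
by apply/S3_rho; rewrite rho1.
Qed.

Lemma weighted_projE z : z != 0 -> weighted_proj a1 a2 z = rho (wscale z) z.
Proof.
move=> z0; rewrite /weighted_proj.
have divE r : 0 < r ->
    cpt (z1 z / (r ^+ a1)%:C) (z2 z / (r ^+ a2)%:C) = rho r^-1 z.
  move=> r0; have Cdiv (x y s : R) : (x +i* y) / s%:C = (s^-1 * x) +i* (s^-1 * y).
    have -> : (s%:C)^-1 = (s^-1)%:C by rewrite fmorphV.
    by apply/eqP; rewrite eq_complex /= !mulr0 subr0 add0r ![_ * s^-1]mulrC !eqxx.
  by apply: row4P; rewrite /cpt /z1 /z2 !Cdiv !mxE /= exprVn.
have [s0 sE] := wscaleP z0.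
have ex : exists r, 0 < r /\ rho (wscale z) z = cpt (z1 z / (r ^+ a1)%:C) (z2 z / (r ^+ a2)%:C).
  by exists (wscale z)^-1; rewrite divE ?invr_gt0 // invrK.
have := @getI _ [set p | S3 p /\ exists r : R, 0 < r /\
    p = cpt (z1 z / (r ^+ a1)%:C) (z2 z / (r ^+ a2)%:C)] (rho (wscale z) z) _.
case=> [|Sp [r [r0 pE]]]; first by split=> //; exact/S3_rho.
rewrite pE divE // in Sp *; move/S3_rho: Sp => Sp.
by rewrite (wscale_eq z0 _ Sp) // invr_gt0.
Qed.

Lemma rho_neq0 s z : s != 0 -> z != 0 -> rho s z != 0.
Proof.
move=> s0; apply: contra_neq => /rowP e; apply/rowP => i; have := e i; rewrite !mxE.
by move/eqP; rewrite mulf_eq0 expf_eq0 (negbTE s0) andbF /= => /eqP.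
Qed.

Lemma weighted_proj_S3 z : z != 0 -> S3 (weighted_proj a1 a2 z).
Proof. by move=> z0; rewrite weighted_projE //; apply/S3_rho; case: (wscaleP z0). Qed.

Lemma weighted_proj_id p : S3 p -> weighted_proj a1 a2 p = p.
Proof. by move=> Sp; rewrite weighted_projE ?S3_neq0 // wscale_S3 // rho1. Qed.

Lemma weighted_proj_rho s z : 0 < s -> z != 0 ->
  weighted_proj a1 a2 (rho s z) = weighted_proj a1 a2 z.
Proof.
move=> s0 z0; have rz0 := rho_neq0 (lt0r_neq0 s0) z0.
rewrite !weighted_projE // rhoM; congr (rho _ z).
have [u0 uE] := wscaleP rz0; have [w0 wE] := wscaleP z0.
apply: (wnorm_inj z0); rewrite ?mulr_ge0 ?ltW // wE; apply/S3_rho.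
by rewrite -rhoM; exact/S3_rho.
Qed.
End WeightedProj.

(** * Differentiability of the weighted radial projection *)

Lemma continuous_dist (R : realType) (T : topologicalType) (f : T -> R) (x : T) :
  (forall e, 0 < e -> \forall y \near x, `|f x - f y| < e) -> {for x, continuous f}.
Proof. by move=> H; apply/cvgrPdist_lt. Qed.

Lemma continuous_lt (R : realType) (T : topologicalType) (f : T -> R) (x : T) c :
  {for x, continuous f} -> f x < c -> \forall y \near x, f y < c.
Proof. by move=> cf; exact: (cvgr_lt (f x) cf). Qed.

Lemma continuous_gt (R : realType) (T : topologicalType) (f : T -> R) (x : T) c :
  {for x, continuous f} -> c < f x -> \forall y \near x, c < f y.
Proof. by move=> cf; exact: (cvgr_gt (f x) cf). Qed.

Lemma continuous_for_comp (R : realType) (T : topologicalType) (f : T -> R) (g : R -> R) x :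
  {for x, continuous f} -> continuous g -> {for x, continuous (fun y => g (f y))}.
Proof. by move=> cf cg; apply: continuous_comp; [exact: cf|exact: cg]. Qed.

(** The quotient (x^n - y^n) / (x - y) as a polynomial in x, defined on the diagonal as well. *)
Definition diff_quot (R : comNzRingType) (n : nat) (y : R) : {poly R} :=
  \sum_(i < n) y ^+ i *: 'X^(n.-1 - i).

Lemma diff_quotP (R : comNzRingType) n (x y : R) :
  x ^+ n - y ^+ n = (x - y) * (diff_quot n y).[x].
Proof.
rewrite subrXX /diff_quot horner_sum; congr (_ * _); apply: eq_bigr => i _.
by rewrite hornerZ hornerXn mulrC.
Qed.

Lemma diff_quot_diag (R : comNzRingType) n (y : R) :
  (diff_quot n y).[y] = n%:R * y ^+ n.-1.
Proof.
rewrite /diff_quot horner_sum (eq_bigr (fun=> y ^+ n.-1)) => [|i _].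
  by rewrite sumr_const card_ord mulr_natl.
by rewrite hornerZ hornerXn -exprD subnKC // -ltnS (ltn_predK (ltn_ord i)).
Qed.

Section WeightedProjSmooth.
Variables (R : realType) (a1 a2 : nat).
Hypotheses (a1_gt0 : (0 < a1)%N) (a2_gt0 : (0 < a2)%N).
Local Notation E := 'rV[R]_4.
Local Notation wscale := (@wscale R a1 a2).
Local Notation wnorm := (@wnorm R a1 a2).
Local Notation rho := (@rho R a1 a2).
Local Notation weight := (weight a1 a2).
Implicit Types (p u v z : E) (s t : R).

(** [wnorm z] is strictly increasing in s, and the strict inequalities at [wscale z0 - e'] and
    [wscale z0 + e'] persist for z near z0, so they trap the root. The bound e' <= [wscale z0] keeps
    the lower end nonnegative. *)
Lemma wscale_continuous z0 : z0 != 0 -> {for z0, continuous wscale}.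
Proof.
move=> z00; have [u0 uE] := wscaleP a1_gt0 a2_gt0 z00.
apply: continuous_dist => e e0.
pose e' := Num.min e (wscale z0).
have e'0 : 0 < e' by rewrite lt_min e0.
have cN s : {for z0, continuous (fun z : E => wnorm z s)}.
  apply: (@has_diff_continuous _ _ _ _ (fun v => s ^+ (2 * a1) * (2 * (z0 0 0 * v 0 0 + z0 0 1 * v 0 1))
    + s ^+ (2 * a2) * (2 * (z0 0 2 * v 0 2 + z0 0 3 * v 0 3)))).
  apply: has_diff_ext (has_diffD
     (has_diffM (has_diff_sq1 z0) (has_diff_cst (s ^+ (2 * a1)) z0))
     (has_diffM (has_diff_sq2 z0) (has_diff_cst (s ^+ (2 * a2)) z0))) => v //=.
  ring.
have lo0 : 0 <= wscale z0 - e' by rewrite subr_ge0 ge_min lexx orbT.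
have lo : wnorm z0 (wscale z0 - e') < 1.
  by rewrite -uE; apply: wnorm_lt => //; rewrite ltrBlDr ltrDl.
have hi : 1 < wnorm z0 (wscale z0 + e').
  by rewrite -uE; apply: wnorm_lt => //; [exact: ltW|rewrite ltrDl].
have n1 := continuous_lt (cN _) lo; have n2 := continuous_gt (cN _) hi.
have n3 := open_nbhs_nbhs (conj (@open_neq0 R) z00).
near=> z.
have znz : z != 0 by near: z; exact: n3.
have h1 : wnorm z (wscale z0 - e') < 1 by near: z; exact: n1.
have h2 : 1 < wnorm z (wscale z0 + e') by near: z; exact: n2.
have [w0 wE] := wscaleP a1_gt0 a2_gt0 znz.
have l1 : wscale z0 - e' < wscale z.
  rewrite ltNge; apply/negP; rewrite le_eqVlt => /orP[/eqP h|h].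
    by move: h1; rewrite -h wE ltxx.
  by have := wnorm_lt a1_gt0 a2_gt0 znz (ltW w0) h; rewrite wE ltNge (ltW h1).
have l2 : wscale z < wscale z0 + e'.
  rewrite ltNge; apply/negP; rewrite le_eqVlt => /orP[/eqP h|h].
    by move: h2; rewrite h wE ltxx.
  have := wnorm_lt a1_gt0 a2_gt0 znz (addr_ge0 (ltW u0) (ltW e'0)) h.
  by rewrite wE ltNge (ltW h2).
apply: lt_le_trans (_ : e' <= e); last by rewrite ge_min lexx.
by rewrite distrC ltr_distl l1 l2.
Unshelve. all: by end_near. Qed.

(** s times the derivative of [wnorm z] in s, taken at s = [wscale z]. *)
Definition wdenom z := (2 * a1)%:R * (sq1 z * wscale z ^+ (2 * a1))
  + (2 * a2)%:R * (sq2 z * wscale z ^+ (2 * a2)).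

Lemma wdenom_gt0 z : z != 0 -> 0 < wdenom z.
Proof.
move=> z0; have u0 := wscale_gt0 a1_gt0 a2_gt0 z0.
have n1 : 0 < (2 * a1)%:R :> R by rewrite ltr0n muln_gt0.
have n2 : 0 < (2 * a2)%:R :> R by rewrite ltr0n muln_gt0.
have ge1 : 0 <= sq1 z * wscale z ^+ (2 * a1) by rewrite mulr_ge0 ?sq1_ge0 ?exprn_ge0 ?ltW.
have ge2 : 0 <= sq2 z * wscale z ^+ (2 * a2) by rewrite mulr_ge0 ?sq2_ge0 ?exprn_ge0 ?ltW.
rewrite /wdenom; have [h|h] := sq_gt0 z0.
  apply: ltr_pwDl; last by rewrite mulr_ge0 // ltW.
  by apply: (mulr_gt0 n1); apply: (mulr_gt0 h); exact: exprn_gt0.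
apply: ltr_wpDl; first by rewrite mulr_ge0 // ltW.
by apply: (mulr_gt0 n2); apply: (mulr_gt0 h); exact: exprn_gt0.
Qed.

(** Implicit differentiation of [wnorm z (wscale z) = 1]. *)
Definition dwscale z v := - (wscale z) / wdenom z *
  (wscale z ^+ (2 * a1) * (2 * (z 0 0 * v 0 0 + z 0 1 * v 0 1))
   + wscale z ^+ (2 * a2) * (2 * (z 0 2 * v 0 2 + z 0 3 * v 0 3))).

(* Factoring s^n - u^n in wnorm z (wscale z) = wnorm z0 (wscale z0) writes
   wscale z - wscale z0 as a combination of differentiable functions vanishing
   at z0 with continuous coefficients, so continuity of wscale is enough. *)
Lemma has_diff_wscale z0 : z0 != 0 -> has_diff wscale z0 (dwscale z0).
Proof.
move=> z00; have [u0 uE] := wscaleP a1_gt0 a2_gt0 z00.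
(* K is the difference quotient of [wnorm z0] between s and [wscale z0]; on the diagonal it is the
   derivative, which is nonzero. *)
pose K : {poly R} := sq1 z0 *: diff_quot (2 * a1) (wscale z0) + sq2 z0 *: diff_quot (2 * a2) (wscale z0).
have KE : K.[wscale z0] * wscale z0 = wdenom z0.
  rewrite hornerD !hornerZ !diff_quot_diag mulrDl /wdenom.
  have X n : (0 < n)%N -> wscale z0 ^+ (2 * n) = wscale z0 ^+ (2 * n).-1 * wscale z0.
    by move=> n0; rewrite -exprSr prednK // muln_gt0 n0.
  by rewrite (X _ a1_gt0) (X _ a2_gt0); ring.
have K0 : K.[wscale z0] != 0.
  by have := lt0r_neq0 (wdenom_gt0 z00); rewrite -KE mulf_eq0 negb_or => /andP[].
have cu := wscale_continuous z00.
have cK : {for z0, continuous (fun z => K.[wscale z])}.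
  by apply: continuous_for_comp cu _; exact: continuous_horner.
have ck n : {for z0, continuous (fun z => - (wscale z ^+ n) / K.[wscale z])}.
  have cX : {for z0, continuous (fun z => wscale z ^+ n)}.
    exact: continuous_for_comp cu (@exprn_continuous R n).
  have cN' : {for z0, continuous (fun z => - wscale z ^+ n)} by exact: continuousN cX.
  have cV : {for z0, continuous (fun z => K.[wscale z]^-1)} by exact: (@continuousV _ _ (fun z => K.[wscale z]) z0 K0 cK).
  exact: continuousM cN' cV.
have d1 := has_diff_vanishing (has_diffB (has_diff_sq1 z0) (has_diff_cst (sq1 z0) z0)) (subrr _) (ck (2 * a1)%N).
have d2 := has_diff_vanishing (has_diffB (has_diff_sq2 z0) (has_diff_cst (sq2 z0) z0)) (subrr _) (ck (2 * a2)%N).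
have D := has_diffD (has_diffD d1 d2) (has_diff_cst (wscale z0) z0).
have nK : \forall z \near z0, K.[wscale z] != 0.
  have [h|h] := ltP 0 K.[wscale z0]; last first.
    have {}h : K.[wscale z0] < 0 by rewrite lt_neqAle K0.
    by apply: filterS (continuous_lt cK h) => z h'; rewrite lt_eqF.
  by apply: filterS (continuous_gt cK h) => z h'; rewrite gt_eqF.
apply: (has_diff_near_eq (f := fun z => - wscale z ^+ (2 * a1) / K.[wscale z] * (sq1 z - sq1 z0) +
  - wscale z ^+ (2 * a2) / K.[wscale z] * (sq2 z - sq2 z0) + wscale z0)).
  have n3 := open_nbhs_nbhs (conj (@open_neq0 R) z00).
  near=> z.
  have znz : z != 0 by near: z; exact: n3.
  have Kz : K.[wscale z] != 0 by near: z; exact: nK.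
  have [w0 wE] := wscaleP a1_gt0 a2_gt0 znz.
  suff : (wscale z - wscale z0) * K.[wscale z] =
     - (wscale z ^+ (2 * a1) * (sq1 z - sq1 z0) + wscale z ^+ (2 * a2) * (sq2 z - sq2 z0)).
    move=> H; apply: (mulIf Kz); rewrite !mulrDl -[RHS](subrK (wscale z0 * K.[wscale z])) -mulrBl H.
    by congr (_ + _); field.
  rewrite /K hornerD !hornerZ mulrDr mulrCA -diff_quotP mulrCA -diff_quotP.
  move: wE uE; rewrite /wnorm => wE uE.
  apply/eqP; rewrite -subr_eq0; apply/eqP; transitivity (1 - 1 : R); last exact: subrr.
  by rewrite -[X in _ = X - _]wE -[X in _ = _ - X]uE; ring.
apply: has_diff_ext D => // v.
rewrite !subr0 addr0 /dwscale -KE.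
by field; rewrite K0 lt0r_neq0.
Unshelve. all: by end_near. Qed.

(* The derivative of wscale is a rational function of wscale and the coordinates. *)
Lemma Ck_wscale k : Ck_on k [set z | z != 0] wscale.
Proof.
pose U := [set z : E | z != 0]; have oU : open U := @open_neq0 R.
elim: k => [|k IH]; first exact: wscale_continuous.
split=> [z z0|i]; first by case: (has_diff_wscale z0).
apply: (Ck_on_eq (f := fun z => dwscale z (delta_mx 0 i))) => //.
  by move=> z z0; rewrite (has_diff_derive _ (has_diff_wscale z0)).
have C0 j := Ck_on_coord k U j.
have Cs1 : Ck_on k U (@sq1 R) by apply: Ck_onD => //; exact: Ck_onX.
have Cs2 : Ck_on k U (@sq2 R) by apply: Ck_onD => //; exact: Ck_onX.
have Cw : Ck_on k U wdenom.
  by apply: Ck_onD => //; apply: Ck_onM => //; [exact: Ck_on_cst|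
    apply: Ck_onM => //; exact: Ck_onX|exact: Ck_on_cst|apply: Ck_onM => //; exact: Ck_onX].
have Cl j j' : Ck_on k U (fun z : E => 2 * (z 0 j * (delta_mx 0 i : E) 0 j + z 0 j' * (delta_mx 0 i : E) 0 j')).
  apply: Ck_onM => //; first exact: Ck_on_cst.
  by apply: Ck_onD => //; apply: Ck_onM => //; exact: Ck_on_cst.
apply: Ck_onM => //; last by apply: Ck_onD => //; apply: Ck_onM => //; exact: Ck_onX.
apply: Ck_onM => //.
  by apply: Ck_on_ext (Ck_onM oU (Ck_on_cst k U (-1)) IH) => z; rewrite mulN1r.
by apply: Ck_onV => // z /wdenom_gt0 /lt0r_neq0.
Qed.

Lemma Ck_weighted_proj k i : Ck_on k [set z | z != 0] (fun z => weighted_proj a1 a2 z 0 i).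
Proof.
have oU := @open_neq0 R.
apply: (Ck_on_eq (f := fun z => wscale z ^+ weight i * z 0 i)) => //.
  by move=> z z0; rewrite weighted_projE // mxE.
by apply: Ck_onM => //; [apply: Ck_onX => //; exact: Ck_wscale|exact: Ck_on_coord].
Qed.

Lemma has_diff_weighted_proj z i : z != 0 ->
  has_diff (fun x => weighted_proj a1 a2 x 0 i) z
   (fun v => wscale z ^+ weight i * v 0 i
     + z 0 i * ((weight i)%:R * wscale z ^+ (weight i).-1 * dwscale z v)).
Proof.
move=> z0; apply: (has_diff_near_eq (f := fun z => wscale z ^+ weight i * z 0 i)).
  apply: filterS (open_nbhs_nbhs (conj (@open_neq0 R) z0)) => x x0.
  by rewrite weighted_projE // mxE.
exact: has_diffM (has_diffX _ (has_diff_wscale z0)) (has_diff_coord z i).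
Qed.
End WeightedProjSmooth.

(** * Curves on the three-sphere *)

Section Selection.
Variable R : realType.
Implicit Types (P : R -> R -> Prop) (e t s : R).

(* s t is chosen so that |s t| is minimal up to an error t. *)
Lemma select_near0 P :
  (forall e, 0 < e -> \forall t \near 0^'+, exists s, `|s| <= e /\ P t s) ->
  exists s : R -> R, s @ 0^'+ --> (0 : R) /\ \forall t \near 0^'+, P t (s t).
Proof.
move=> H.
pose Q t s := P t s /\ forall s', P t s' -> `|s| <= `|s'| + t.
pose sel t := get (Q t).
have selP t s0 : 0 < t -> P t s0 -> Q t (sel t).
  move=> t0 Ps0; pose A := [set `|s| | s in P t].
  have hA : has_inf A by split; [exists `|s0|, s0|exists 0 => _ [s _ <-]].
  have [_ [s Ps <-] sA] := inf_adherent t0 hA.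
  apply: (@getI _ (Q t) s); split=> // s' Ps'.
  apply: (le_trans (ltW sA)); rewrite lerD2r.
  by apply: ge_inf; [exact: hA.2|exists s'].
exists sel; split; last first.
  have := H 1 ltr01; apply: filter_app; near=> t => -[s [_ Ps]].
  have t0 : 0 < t by near: t; exact: nbhs_right_gt.
  by case: (selP t s t0 Ps).
apply/cvgrPdist_le => e e0; have e2 : 0 < e / 2 by rewrite divr_gt0.
have := H _ e2; apply: filter_app; near=> t => -[s [se Ps]].
have t0 : 0 < t by near: t; exact: nbhs_right_gt.
have te : t <= e / 2 by near: t; exact: nbhs_right_le.
have [_ Qs] := selP t s t0 Ps.
rewrite sub0r normrN (splitr e); apply: le_trans (Qs _ Ps) _; exact: lerD.
Unshelve. all: by end_near. Qed.
End Selection.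

Lemma cvg_row (R : realType) (T : Type) (F : set_system T) {FF : Filter F}
    (f : T -> 'rV[R]_4) (l : 'rV[R]_4) :
  (forall i, (fun t => f t 0 i) @ F --> l 0 i) -> f @ F --> l.
Proof.
move=> H; apply/cvgrPdist_le => e e0; near=> t.
rewrite [leLHS]/Num.Def.normr/= mx_normrE (bigmax_le _ (ltW e0)) //= => -[i j] _.
rewrite !mxE /= ord1 {i}; move: j; near: t; apply: filter_forall => j.
by have /cvgrPdist_le := H j; apply.
Unshelve. all: by end_near. Qed.

Lemma continuous_row (R : realType) (T : topologicalType) (f : T -> 'rV[R]_4) (x : T) :
  (forall i, {for x, continuous (fun y => f y 0 i)}) -> {for x, continuous f}.
Proof. by move=> H; apply: cvg_row. Qed.

Section Tangents.
Variable R : realType.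
Local Notation E := 'rV[R]_4.
Implicit Types (S U : set E) (p u v w x : E) (f g h L M : E -> R) (c : R -> E).

Lemma dotC u v : dot u v = dot v u.
Proof. by rewrite !dotE; ring. Qed.
Lemma dotDr u v w : dot u (v + w) = dot u v + dot u w.
Proof. by rewrite !dotE !mxE; ring. Qed.
Lemma dotZr (a : R) u v : dot u (a *: v) = a * dot u v.
Proof. by rewrite !dotE !mxE; ring. Qed.
Lemma dotNr u v : dot u (- v) = - dot u v.
Proof. by rewrite !dotE !mxE; ring. Qed.

Lemma has_diff_dot p : has_diff (fun x => dot x x) p (fun v => 2 * dot p v).
Proof.
apply: has_diff_ext (has_diffD (has_diff_sq1 p) (has_diff_sq2 p)) => v.
  by rewrite dot_sq.
by rewrite dotE; ring.
Qed.

Lemma velocity_nbhs (P : E -> Prop) c p v : velocity c p v ->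
  (\forall x \near p, P x) -> \forall t \near 0^'+, P (c t).
Proof. by move=> /velocity_cvg cv Pp; have H : c @ 0^'+ --> nbhs p := cv; exact: H. Qed.

Lemma half_tangent_ge0 S f p L v : has_diff f p L -> half_tangent S p v ->
  (\forall x \near p, S x -> f p <= f x) -> 0 <= L v.
Proof.
move=> df [c [c0 Sc cv]] Sf.
have c1 := has_diff_velocity df cv.
have c2 : \forall t \near 0^'+, S (c t) -> f p <= f (c t) by exact: velocity_nbhs cv Sf.
rewrite leNgt; apply/negP => Lv.
have /(cvgr_lt (L v))/(_ 0 Lv) H := c1.
have : \forall t \near (0 : R)^'+, False.
  near=> t.
  have t0 : 0 < t by near: t; exact: nbhs_right_gt.
  have h1 : t^-1 * (f (c t) - f p) < 0 by near: t; exact: H.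
  have h2 : S (c t) -> f p <= f (c t) by near: t; exact: c2.
  have h3 : S (c t) by near: t; exact: Sc.
  by move: h1; rewrite pmulr_rlt0 ?invr_gt0 // subr_lt0 ltNge h2.
by move=> /filter_ex [].
Unshelve. all: by end_near. Qed.

Lemma has_diffN f p L : has_diff f p L -> has_diff (fun x => - f x) p (fun v => - L v).
Proof.
move=> df; apply: has_diff_ext (has_diffB (has_diff_cst 0 p) df) => x; exact: sub0r.
Qed.

Lemma half_tangent_eq0 S f p L v : has_diff f p L -> half_tangent S p v ->
  (\forall x \near p, S x -> f x = f p) -> L v = 0.
Proof.
move=> df Hv Sf; apply/le_anti/andP; split; last first.
  by apply: half_tangent_ge0 df Hv _; apply: filterS Sf => x /[apply] ->.
rewrite -oppr_ge0; apply: half_tangent_ge0 (has_diffN df) Hv _.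
by apply: filterS Sf => x /[apply] ->.
Qed.

Lemma half_tangent_S3 S p v : S `<=` @S3 R -> S p -> half_tangent S p v -> tangentS3 p v.
Proof.
move=> S3S Sp Hv; have := half_tangent_eq0 (has_diff_dot p) Hv.
move=> H; have : 2 * dot p v = 0.
  by apply: H; apply: filterE => x /S3S xS; rewrite xS; apply/esym; exact: S3S.
by move/eqP; rewrite mulf_eq0 pnatr_eq0 /= => /eqP.
Qed.

Lemma velocity_gt0 f p L c v : has_diff f p L -> velocity c p v -> 0 < L v ->
  \forall t \near 0^'+, f p < f (c t).
Proof.
move=> df cv Lv; have /(cvgr_gt (L v))/(_ 0 Lv) := has_diff_velocity df cv.
apply: filter_app; near=> t.
have t0 : 0 < t by near: t; exact: nbhs_right_gt.
by rewrite pmulr_rgt0 ?invr_gt0 // subr_gt0.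
Unshelve. all: by end_near. Qed.

Lemma velocity_near U c p v : open U -> U p -> velocity c p v ->
  \forall t \near 0^'+, U (c t).
Proof. by move=> oU Up cv; exact: velocity_nbhs cv (open_nbhs_nbhs (conj oU Up)). Qed.

Lemma velocity_line p v : velocity (fun t => p + t *: v) p v.
Proof.
apply: cvg_near_cst; near=> t.
rewrite addrAC subrr add0r scalerA mulVf ?scale1r //.
Unshelve. all: by end_near. Qed.

(** * Retraction of curves to the sphere and level curves *)

Section Weights.
Variables (a1 a2 : nat).
Hypotheses (a1_gt0 : (0 < a1)%N) (a2_gt0 : (0 < a2)%N).
Local Notation proj := (@weighted_proj R a1 a2).

Definition radial p : E := \row_i ((weight a1 a2 i)%:R * p 0 i).

Lemma dot_radialE p : dot p (radial p) = a1%:R * sq1 p + a2%:R * sq2 p.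
Proof. by rewrite dotE !mxE /weight /= /sq1 /sq2; ring. Qed.

Lemma dot_radial_gt0 p : p != 0 -> 0 < dot p (radial p).
Proof.
move=> p0; have n1 : 0 < a1%:R :> R by rewrite ltr0n.
have n2 : 0 < a2%:R :> R by rewrite ltr0n.
rewrite dot_radialE; have [h|h] := sq_gt0 p0.
  apply: ltr_pwDl; first exact: (mulr_gt0 n1 h).
  by rewrite mulr_ge0 ?sq2_ge0 // ltW.
apply: ltr_wpDl; last exact: (mulr_gt0 n2 h).
by rewrite mulr_ge0 ?sq1_ge0 // ltW.
Qed.

(** The differential of the weighted projection at a point of S^3: the projection onto the tangent
    space of S^3 along the weighted radial field. *)
Definition dproj p v : E := v - (dot p v / dot p (radial p)) *: radial p.

Lemma has_diff_proj_S3 p i : S3 p -> has_diff (fun x => proj x 0 i) p (fun v => dproj p v 0 i).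
Proof.
move=> Sp; have p0 := S3_neq0 Sp.
apply: has_diff_ext (has_diff_weighted_proj a1_gt0 a2_gt0 i p0) => v //.
have r0 := lt0r_neq0 (dot_radial_gt0 p0).
rewrite /dwscale /wdenom wscale_S3 // !expr1n !mxE !mul1r.
rewrite !mulr1 -[p 0 0 * v 0 0 + _]/(_ + _).
have -> : (2 * a1)%:R * sq1 p + (2 * a2)%:R * sq2 p = 2 * dot p (radial p).
  by rewrite dot_radialE !natrM; ring.
rewrite (dotE p v); field; exact: r0.
Qed.

Lemma dproj_tangent p v : tangentS3 p v -> dproj p v = v.
Proof. by move=> Tv; rewrite /dproj Tv mul0r scale0r subr0. Qed.

Lemma velocity_proj c p v : S3 p -> velocity c p v ->
  velocity (fun t => proj (c t)) p (dproj p v).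
Proof.
move=> Sp cv; apply: velocity_coord => i.
have := has_diff_velocity (has_diff_proj_S3 i Sp) cv.
by rewrite (weighted_proj_id a1_gt0 a2_gt0 Sp).
Qed.

Lemma velocity_proj_S3 c p v : S3 p -> velocity c p v ->
  \forall t \near 0^'+, S3 (proj (c t)).
Proof.
move=> Sp cv; have := velocity_near (@open_neq0 R) (S3_neq0 Sp) cv.
by apply: filterS => t; exact: weighted_proj_S3.
Qed.

Lemma half_tangent_of_S3 p v : S3 p -> tangentS3 p v -> half_tangent (@S3 R) p v.
Proof.
move=> Sp Tv; have lv := @velocity_line p v; exists (fun t => proj (p + t *: v)); split.
- by rewrite scale0r addr0 weighted_proj_id.
- exact: velocity_proj_S3 lv.
- by move: (velocity_proj Sp lv); rewrite dproj_tangent.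
Qed.

(** The line p + t(v + s w) is pushed back to S^3. To first order in t, g there is t s L(w), so it
    has opposite signs at s = e and s = -e and vanishes for some s in between; choosing such s
    tending to 0 leaves the velocity equal to v. *)
Lemma S3_level_curve U g p L v w : open U -> U p ->
  (forall x, U x -> {for x, continuous g}) -> has_diff g p L -> g p = 0 -> S3 p ->
  tangentS3 p v -> tangentS3 p w -> L v = 0 -> L w != 0 ->
  exists c, [/\ c 0 = p, velocity c p v &
    \forall t \near 0^'+, [/\ S3 (c t), U (c t) & g (c t) = 0]].
Proof.
move=> oU Up cg dg gp Sp Tv Tw Lv Lw.
pose b t s := p + t *: (v + s *: w).
have bE s : velocity (b^~ s) p (v + s *: w) by exact: (@velocity_line p).
have tan s : tangentS3 p (v + s *: w).
  by rewrite /tangentS3 dotDr dotZr Tv Tw mulr0 addr0.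
have projb s : velocity (fun t => proj (b t s)) p (v + s *: w).
  by move: (velocity_proj Sp (bE s)); rewrite dproj_tangent.
have LE s : L (v + s *: w) = s * L w.
  by rewrite -[X in L (X + _)]scale1r (has_diff_lin _ _ _ _ dg) Lv mulr0 add0r.
have proj_cont x : x != 0 -> {for x, continuous proj}.
  move=> x0; apply: continuous_row => i.
  exact: has_diff_continuous (has_diff_weighted_proj a1_gt0 a2_gt0 i x0).
have pU : \forall x \near p, x != 0 /\ U (proj x).
  apply: filterI; first exact: open_nbhs_nbhs (conj (@open_neq0 R) (S3_neq0 Sp)).
  have H : proj @ p --> nbhs (proj p) := proj_cont p (S3_neq0 Sp).
  by apply: H; apply: open_nbhs_nbhs; rewrite weighted_proj_id.
have [r /= r0 pr] : exists2 r, 0 < r & forall x, `|x - p| < r -> x != 0 /\ U (proj x).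
  have /nbhs_ballP [r r0 br] := pU; exists r => // x xr; apply: br.
  by rewrite -ball_normE /= distrC.
(* Uniform in s, so that g is continuous along the whole interval to which the intermediate value
   theorem is applied. *)
have small e : 0 < e -> \forall t \near 0^'+, forall s, `|s| <= e -> `|b t s - p| < r.
  move=> e0; have M0 : 0 < `|v| + e * `|w| + 1 by rewrite ltr_wpDl // addr_ge0 // mulr_ge0 // ltW.
  near=> t => s se; rewrite /b addrAC subrr add0r normrZ.
  have t0 : 0 < t by near: t; exact: nbhs_right_gt.
  have tr : t < r / (`|v| + e * `|w| + 1) by near: t; apply: nbhs_right_lt; rewrite divr_gt0.
  rewrite (gtr0_norm t0); move: tr; rewrite ltr_pdivlMr // => /(le_lt_trans _); apply.
  rewrite ler_wpM2l ?(ltW t0) //; apply: (le_trans (ler_normD _ _)).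
  by rewrite -addrA lerD2l normrZ ler_wpDr // ler_wpM2r.
(* For each e, a zero with |s| <= e exists once t is small, which is the input of [select_near0]. *)
have sel e : 0 < e -> \forall t \near 0^'+, exists s, `|s| <= e /\
    (`|b t s - p| < r /\ g (proj (b t s)) = 0).
  move=> e0.
  (* The sign of L w is unknown; after multiplication by it the slope in s is (L w)^2 > 0. *)
  have dgw : has_diff (fun x => g x * L w) p (fun u => L u * L w).
    by apply: has_diff_ext (has_diffM dg (has_diff_cst (L w) p)) => u //; rewrite mulr0 add0r mulrC.
  have Lw2 : 0 < L w * L w by rewrite -expr2 exprn_even_gt0.
  have h1 : \forall t \near 0^'+, 0 < g (proj (b t e)) * L w.
    have := velocity_gt0 dgw (projb e); rewrite gp mul0r; apply.
    by rewrite LE -mulrA mulr_gt0.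
  have h2 : \forall t \near 0^'+, 0 < - (g (proj (b t (- e))) * L w).
    have := velocity_gt0 (has_diffN dgw) (projb (- e)); rewrite gp mul0r oppr0; apply.
    by rewrite LE mulNr mulNr opprK -mulrA mulr_gt0.
  near=> t.
  have t1 : 0 < g (proj (b t e)) * L w.
    by near: t; exact: h1.
  have t2 : 0 < - (g (proj (b t (- e))) * L w) by near: t; exact: h2.
  have t3 : forall s, `|s| <= e -> `|b t s - p| < r by near: t; exact: small.
  have ne : - e <= e by rewrite -subr_ge0 opprK addr_ge0 ?ltW.
  have [||s] := @IVT R (fun s => g (proj (b t s)) * L w) (- e) e 0 ne.
  - apply: continuous_in_subspaceT => s; rewrite inE /= in_itv /= -ler_norml => se.
    have [bn0 bU] := pr _ (t3 _ se).
    have cb : {for s, continuous (b t)}.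
      apply: continuousD; first exact: cst_continuous.
      apply: continuousZl_tmp; apply: continuousD; first exact: cst_continuous.
      exact: scalel_continuous.
    have cpb : {for s, continuous (proj \o b t)}.
      by apply: continuous_comp; [exact: cb|exact: proj_cont].
    have cgb : {for s, continuous (g \o (proj \o b t))}.
      by apply: continuous_comp; [exact: cpb|exact: cg].
    by apply: continuousM; [exact: cgb|exact: cst_continuous].
  - rewrite ge_min le_max (ltW t1) orbT andbT -oppr_ge0 (ltW t2) //.
  rewrite in_itv /= -ler_norml => se /eqP; rewrite mulf_eq0 (negbTE Lw) orbF => /eqP gs.
  by exists s; split => //; split => //; exact: t3.
have [s [s0 Hs]] := select_near0 sel.
have vs : velocity (fun t => b t (s t)) p v.
  have H : (fun t => v + s t *: w) @ 0^'+ --> v + 0 *: w.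
    by apply: cvgD; [exact: cvg_cst|apply: cvgZr_tmp].
  rewrite scale0r addr0 in H.
  apply: cvg_trans H; apply: near_eq_cvg; near=> t.
  by rewrite /b addrAC subrr add0r scalerA mulVf ?scale1r //.
exists (fun t => proj (b t (s t))); split.
- by rewrite /b scale0r addr0 weighted_proj_id.
- by move: (velocity_proj Sp vs); rewrite dproj_tangent.
near=> t.
have [h1 h2] : `|b t (s t) - p| < r /\ g (proj (b t (s t))) = 0 by near: t; exact: Hs.
by have [h3 h4] := pr _ h1; split=> //; exact: weighted_proj_S3.
Unshelve. all: by end_near. Qed.

End Weights.
End Tangents.

(** * Interior and boundary points *)

Section InteriorBoundary.
Variable R : realType.
Local Notation E := 'rV[R]_4.
Implicit Types (S U : set E) (p u v w x : E) (f g h L M : E -> R) (c : R -> E).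

Lemma smooth_on_has_diff U g p : smooth_on U g -> U p ->
  has_diff g p (fun v => 'D_v (g : E -> R^o) p).
Proof.
move=> /(_ 1%N) [dg _] Up; split=> [|v]; first exact: dg.
by apply/esym; apply: deriveE; exact: dg.
Qed.

Lemma smooth_on_continuous U g x : smooth_on U g -> U x -> {for x, continuous g}.
Proof. by move=> /(_ 0%N) /=; exact. Qed.

(** The level curve of g with velocity v stays in S because h grows along it at first order, which
    is why dh(v) has to be strictly positive. *)
Lemma boundary_point_tangent S p : S p -> forall U g h,
  open U -> U p -> smooth_on U g -> smooth_on U h ->
  S `&` U = [set q | [/\ S3 q, U q, g q = 0 & 0 <= h q]] -> h p = 0 ->
  forall v w, tangentS3 p v -> tangentS3 p w ->
  'D_v (g : E -> R^o) p = 0 -> 'D_w (g : E -> R^o) p != 0 ->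
  0 < 'D_v (h : E -> R^o) p -> half_tangent S p v.
Proof.
move=> Sp U g h oU Up sg sh SU hp v w Tv Tw gv gw hv.
have : (S `&` U) p by [].
rewrite SU => -[S3p _ gp _].
have dg := smooth_on_has_diff sg Up; have dh := smooth_on_has_diff sh Up.
(* Any positive weights would do: the projection only serves as a retraction onto S^3. *)
have [c [c0 cv cS]] := S3_level_curve (a1 := 1) (a2 := 1) isT isT oU Up
  (fun x Ux => smooth_on_continuous sg Ux) dg gp S3p Tv Tw gv gw.
exists c; split=> //.
have := velocity_gt0 dh cv hv; rewrite hp => hc.
near=> t.
have [h1 h2 h3] : [/\ S3 (c t), U (c t) & g (c t) = 0] by near: t; exact: cS.
have h4 : 0 < h (c t) by near: t; exact: hc.
have : (S `&` U) (c t) by rewrite SU; split=> //; exact: ltW.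
by case.
Unshelve. all: by end_near. Qed.

Lemma interior_point_tangent S p U g : open U -> U p -> S p -> smooth_on U g ->
  S `&` U = [set q | [/\ S3 q, U q & g q = 0]] ->
  forall v w, tangentS3 p v -> tangentS3 p w ->
  'D_v (g : E -> R^o) p = 0 -> 'D_w (g : E -> R^o) p != 0 -> half_tangent S p v.
Proof.
move=> oU Up Sp sg SU v w Tv Tw gv gw.
have : (S `&` U) p by [].
rewrite SU => -[S3p _ gp].
have dg := smooth_on_has_diff sg Up.
have [c [c0 cv cS]] := S3_level_curve (a1 := 1) (a2 := 1) isT isT oU Up
  (fun x Ux => smooth_on_continuous sg Ux) dg gp S3p Tv Tw gv gw.
exists c; split=> //.
near=> t.
have [h1 h2 h3] : [/\ S3 (c t), U (c t) & g (c t) = 0] by near: t; exact: cS.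
have : (S `&` U) (c t) by rewrite SU.
by case.
Unshelve. all: by end_near. Qed.

(* Half-tangents at an interior point form a linear space, while those at a
   boundary point all lie on one side. *)
Lemma interior_boundary_disjoint S p : interior_point S p -> boundary_point S p -> False.
Proof.
move=> [Sp [U [g [oU Up sg SU [w [Tw gw]]]]]] bp.
have [_ [U' [g' [h' [[oU' U'p h'p] sg' sh' SU' surj]]]]] := bp.
have [v [Tv g'v h'v]] := surj 0 1; have [w' [Tw' g'w' _]] := surj 1 0.
have Hv : half_tangent S p v.
  apply: (boundary_point_tangent Sp oU' U'p sg' sh' SU' h'p Tv Tw' g'v).
    by rewrite g'w' oner_eq0.
  by rewrite h'v.
have dg := smooth_on_has_diff sg Up.
have : (S `&` U) p by [].
rewrite SU => -[S3p _ gp].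
have Lv : 'D_v (g : E -> R^o) p = 0.
  apply: (half_tangent_eq0 dg Hv); apply: filterS (open_nbhs_nbhs (conj oU Up)) => x Ux Sx.
  have : (S `&` U) x by [].
  by rewrite SU gp => -[].
have Hv' : half_tangent S p (- v).
  apply: (interior_point_tangent oU Up Sp sg SU _ Tw _ gw).
    by rewrite /tangentS3 dotNr Tv oppr0.
  have := has_diff_lin (-1) 0 v v dg.
  by rewrite scaleN1r scale0r addr0 => ->; rewrite Lv mulr0 mul0r addr0.
have dh := smooth_on_has_diff sh' U'p.
have : 0 <= 'D_(- v) (h' : E -> R^o) p.
  apply: (half_tangent_ge0 dh Hv'); rewrite h'p.
  apply: filterS (open_nbhs_nbhs (conj oU' U'p)) => x Ux Sx.
  have : (S `&` U') x by [].
  by rewrite SU' => -[].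
have := has_diff_lin (-1) 0 v v dh.
rewrite scaleN1r scale0r addr0 => ->; rewrite h'v mul0r addr0 mulr1.
by rewrite oppr_ge0 leNgt ltr01.
Qed.

(** If S contained S^3, every tangent vector of S^3 at p would be a half-tangent of S, including one
    along which h decreases. This rules out f = 0 in the converse. *)
Lemma S3_not_boundary S p : S3 p -> boundary_point S p -> ~ (@S3 R `<=` S).
Proof.
move=> S3p [Sp [U [g [h [[oU Up hp] sg sh SU surj]]]]] S3S.
have [v [Tv gv hv]] := surj 0 (-1).
have := half_tangent_ge0 (smooth_on_has_diff sh Up) (half_tangent_of_S3 (a1 := 1) (a2 := 1) isT isT S3p Tv).
rewrite hp hv oppr_ge0 => H; have : (1 : R) <= 0.
  apply: H; apply: filterS (open_nbhs_nbhs (conj oU Up)) => x Ux Sx.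
  have : (S `&` U) x by split=> //; exact: S3S.
  by rewrite SU => -[].
by rewrite leNgt ltr01.
Qed.
End InteriorBoundary.

(** * The exponential *)

Section Expi.
Variable R : realType.
Implicit Types (s t x y : R) (w : R[i]).

Lemma expiD s t : expi (s + t) = expi s * expi t :> R[i].
Proof. by apply/eqP; rewrite eq_complex /= cosD sinD addrC [sin s * _ + _]addrC !eqxx. Qed.

Lemma expi0 : expi (0 : R) = 1.
Proof. by rewrite /expi cos0 sin0. Qed.

Lemma expi_neq0 t : expi t != 0 :> R[i].
Proof.
apply/eqP => e0; have := expiD t (- t); rewrite e0 mul0r subrr expi0.
by move/eqP; rewrite oner_eq0.
Qed.

Lemma expiX n t : expi (n%:R * t) = expi t ^+ n :> R[i].
Proof.
elim: n => [|n IH]; first by rewrite mul0r expi0 expr0.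
by rewrite -natr1 mulrDl mul1r expiD IH -exprSr.
Qed.

Lemma expi_surj x y : x ^+ 2 + y ^+ 2 = 1 -> exists t, expi t = x +i* y.
Proof.
move=> xy; have x1 : -1 <= x <= 1.
  by rewrite -ler_norml -sqrtr_sqr -[leRHS]sqrtr1 ler_wsqrtr // -xy lerDl sqr_ge0.
have xi : x \in `[(-1), 1] by rewrite in_itv.
have e : 1 - x ^+ 2 = y ^+ 2 by rewrite -xy; ring.
have [y0|y0] := leP 0 y.
  by exists (acos x); rewrite /expi acosK // sin_acos // e sqrtr_sqr ger0_norm.
exists (- acos x); rewrite /expi cosN sinN acosK // sin_acos // e sqrtr_sqr ltr0_norm //.
by rewrite opprK.
Qed.

Lemma expi_rotate w : w != 0 -> exists t r, 0 < r /\ expi t * w = r%:C.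
Proof.
case: w => x y w0; have n0 : 0 < x ^+ 2 + y ^+ 2.
  rewrite lt_neqAle addr_ge0 ?sqr_ge0 // andbT eq_sym paddr_eq0 ?sqr_ge0 //.
  by rewrite !sqrf_eq0; move: w0; rewrite eq_complex.
pose r := Num.sqrt (x ^+ 2 + y ^+ 2).
have r0 : 0 < r by rewrite sqrtr_gt0.
have rE : r ^+ 2 = x ^+ 2 + y ^+ 2 by rewrite sqr_sqrtr // ltW.
have [|t tE] := @expi_surj (x / r) (- y / r).
  by rewrite !expr_div_n sqrrN -mulrDl -rE divff // expf_eq0 /= gt_eqF.
exists t, r; split=> //; rewrite tE; apply/eqP; rewrite eq_complex /=.
apply/andP; split; apply/eqP; last by ring.
have -> : x / r * x - - y / r * y = (x ^+ 2 + y ^+ 2) / r by ring.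
by rewrite -rE expr2 mulfK // gt_eqF.
Qed.

Lemma expi_eq1_small t : 0 <= t < 2 * pi -> expi t = 1 -> t = 0.
Proof.
move=> /andP[t0 t2] /eqP; rewrite eq_complex /= => /andP[/eqP ct /eqP st].
have pi0 := pi_gt0 R.
have [tp|tp] := leP t pi.
  by apply: cos_inj; rewrite ?in_itv /= ?t0 ?lexx ?tp ?ltW // ct cos0.
(* For t > pi, reflect to 2 pi - t, where cos is again injective; this would give t = 2 pi. *)
have : cos (2 * pi - t) = cos 0.
  by rewrite cosB mulr_natl cos2pi sin2pi ct st cos0 mulr0 addr0 mulr1.
move/(@cos_inj R (2 * pi - t) 0); rewrite !in_itv /= lexx (ltW pi0) => H.
have : 2 * pi - t = 0 by apply: H => //; apply/andP; split; lra.
lra.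
Qed.

Lemma expi_int (k : nat) : expi (k%:R * (2 * pi)) = 1 :> R[i].
Proof. by rewrite expiX /expi mulr_natl cos2pi sin2pi expr1n. Qed.

Lemma expi_reduce_ge0 t : 0 <= t ->
  exists k : nat, 0 <= t - k%:R * (2 * pi) < 2 * pi /\ expi (t - k%:R * (2 * pi)) = expi t :> R[i].
Proof.
move=> t0; have p0 : 0 < 2 * pi :> R by rewrite mulr_gt0 // pi_gt0.
exists (Num.truncn (t / (2 * pi))).
have /andP[h1 h2] : (Num.truncn (t / (2 * pi)))%:R <= t / (2 * pi) < (Num.truncn (t / (2 * pi))).+1%:R.
  by apply: truncn_itv; rewrite divr_ge0 // ltW.
split.
  move: h1 h2; rewrite ler_pdivlMr // ltr_pdivrMr // -natr1 mulrDl mul1r => h1 h2.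
  by apply/andP; split; lra.
rewrite -[in RHS](subrK ((Num.truncn (t / (2 * pi)))%:R * (2 * pi)) t).
by rewrite [in RHS]expiD expi_int mulr1.
Qed.

Lemma expi_reduce t : exists s, 0 <= s < 2 * pi /\ expi s = expi t :> R[i].
Proof.
have p0 : 0 < 2 * pi :> R by rewrite mulr_gt0 // pi_gt0.
pose k := Num.bound (`|t| / (2 * pi)).
have t0 : 0 <= t + k%:R * (2 * pi).
  have : `|t| / (2 * pi) < k%:R by apply: archi_boundP; rewrite divr_ge0 // ltW.
  rewrite ltr_pdivrMr // => h; rewrite -lerBlDl sub0r (le_trans _ (ltW h)) //.
  by rewrite -normrN ler_norm.
have [j [h1 h2]] := expi_reduce_ge0 t0.
by exists (t + k%:R * (2 * pi) - j%:R * (2 * pi)); split=> //; rewrite h2 expiD expi_int mulr1.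
Qed.

Lemma expi_real_gt0 t c : expi t = c%:C :> R[i] -> 0 < c -> c = 1.
Proof.
move=> /eqP; rewrite eq_complex /= => /andP[/eqP <- /eqP st] c0.
have := cos2Dsin2 t; rewrite st expr0n addr0 => /eqP.
by rewrite sqrf_eq1 => /orP[/eqP //|/eqP e]; move: c0; rewrite e ltr0N1.
Qed.

Lemma expi_root (d : nat) t : (0 < d)%N -> expi (d%:R * t) = 1 :> R[i] ->
  exists2 k : nat, (k < d)%N & expi (k%:R * (2 * pi / d%:R)) = expi t :> R[i].
Proof.
move=> d0 dt; have [s [/andP[s0 s2] sE]] := expi_reduce t.
have dR : 0 < d%:R :> R by rewrite ltr0n.
have p0 : 0 < 2 * pi :> R by rewrite mulr_gt0 // pi_gt0.
have ds0 : 0 <= d%:R * s by rewrite mulr_ge0 // ltW.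
have [k [h1 h2]] := expi_reduce_ge0 ds0.
have ds1 : expi (d%:R * s) = 1 :> R[i] by rewrite expiX sE -expiX.
have := expi_eq1_small h1; rewrite h2 => /(_ ds1) /eqP; rewrite subr_eq0 => /eqP e.
exists k.
  rewrite -(ltr_nat R) -(ltr_pM2r p0) -e ltr_pM2l //.
rewrite -sE; congr expi; rewrite mulrA -e mulrAC divff ?mul1r // gt_eqF //.
Qed.

Lemma expi_coprime (m n : nat) t : (0 < m)%N -> coprime m n ->
  expi t ^+ m = 1 :> R[i] -> expi t ^+ n = 1 :> R[i] -> expi t = 1 :> R[i].
Proof.
move=> m0 cop hm hn; have [km kn e _] := egcdnP n m0.
rewrite -[LHS]expr1 -(eqP cop).
have : expi t ^+ (km * m) = expi t ^+ (kn * n + gcdn m n) :> R[i] by rewrite e.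
by rewrite mulnC exprM hm expr1n exprD mulnC exprM hn expr1n mul1r => <-.
Qed.
End Expi.

(** * The flow *)

Section ComplexCoord.
Variable R : realType.
Local Notation E := 'rV[R]_4.
Implicit Types (p u v : E) (a b : R[i]).

Lemma z1_cpt a b : z1 (cpt a b) = a.
Proof. by apply/eqP; rewrite eq_complex /= !mxE !eqxx. Qed.
Lemma z2_cpt a b : z2 (cpt a b) = b.
Proof. by apply/eqP; rewrite eq_complex /= !mxE !eqxx. Qed.
Lemma cptK p : cpt (z1 p) (z2 p) = p.
Proof. by apply: row4P; rewrite mxE. Qed.
Lemma z1D u v : z1 (u + v) = z1 u + z1 v.
Proof. by apply/eqP; rewrite eq_complex /= !mxE !eqxx. Qed.
Lemma z2D u v : z2 (u + v) = z2 u + z2 v.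
Proof. by apply/eqP; rewrite eq_complex /= !mxE !eqxx. Qed.
Lemma z1Z (c : R) v : z1 (c *: v) = c%:C * z1 v.
Proof. by apply/eqP; rewrite eq_complex /= !mxE !mul0r subr0 addr0 !eqxx. Qed.
Lemma z2Z (c : R) v : z2 (c *: v) = c%:C * z2 v.
Proof. by apply/eqP; rewrite eq_complex /= !mxE !mul0r subr0 addr0 !eqxx. Qed.
Lemma z12_inj u v : z1 u = z1 v -> z2 u = z2 v -> u = v.
Proof. by move=> e1 e2; rewrite -[u]cptK -[v]cptK e1 e2. Qed.

End ComplexCoord.

Section DerivEval2.
Variable K : fieldType.
Lemma deval2Z (f : mpoly 2 K) (x y u v c : K) :
  deval2 f x y (c * u) (c * v) = c * deval2 f x y u v.
Proof. by rewrite /deval2; ring. Qed.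
Lemma deval2_add (f : mpoly 2 K) (x y u v u' v' : K) :
  deval2 f x y (u + u') (v + v') = deval2 f x y u v + deval2 f x y u' v'.
Proof. by rewrite /deval2; ring. Qed.
Lemma deval2_surj (f : mpoly 2 K) (x y w : K) :
  eval2 (mderiv 0 f) x y != 0 \/ eval2 (mderiv 1 f) x y != 0 ->
  exists u v, deval2 f x y u v = w.
Proof.
rewrite /deval2; case=> h.
  by exists (w / eval2 (mderiv 0 f) x y), 0; rewrite mulr0 addr0 mulrC divfK.
by exists 0, (w / eval2 (mderiv 1 f) x y); rewrite mulr0 add0r mulrC divfK.
Qed.
End DerivEval2.

Section Flow.
Variables (R : realType) (a1 a2 : nat).
Local Notation E := 'rV[R]_4.
Implicit Types (p u v : E) (s t k : R).
Local Notation flow := (@flow R a1 a2).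
Local Notation rho := (@rho R a1 a2).
Local Notation radial := (@radial R a1 a2).

Lemma flowE t p : flow t p = cpt (expi t ^+ a1 * z1 p) (expi t ^+ a2 * z2 p).
Proof. by rewrite /Defs.flow !expiX. Qed.

Lemma z1_flow t p : z1 (flow t p) = expi t ^+ a1 * z1 p.
Proof. by rewrite flowE z1_cpt. Qed.
Lemma z2_flow t p : z2 (flow t p) = expi t ^+ a2 * z2 p.
Proof. by rewrite flowE z2_cpt. Qed.

Lemma flow0 p : flow 0 p = p.
Proof. by rewrite flowE expi0 !expr1n !mul1r cptK. Qed.

Lemma flowD s t p : flow (s + t) p = flow s (flow t p).
Proof. by rewrite !flowE z1_cpt z2_cpt expiD !exprMn !mulrA. Qed.

Lemma flow_expi s t p : expi s = expi t :> R[i] -> flow s p = flow t p.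
Proof. by move=> e; rewrite !flowE e. Qed.

Lemma S3_flow t p : S3 p -> S3 (flow t p).
Proof.
rewrite /S3 /= !dot_sq => <-.
have sq n (x y : R) : (cos n * x - sin n * y) ^+ 2 + (cos n * y + sin n * x) ^+ 2 = x ^+ 2 + y ^+ 2.
  have := cos2Dsin2 n => c2.
  by rewrite -[RHS]mul1r -c2; ring.
by rewrite /sq1 /sq2 !mxE /= !sq.
Qed.

Definition field_vec p : E := cpt ('i%C * (a1%:R * z1 p)) ('i%C * (a2%:R * z2 p)).

Lemma field_vecE p : [/\ field_vec p 0 0 = - (a1%:R * p 0 1), field_vec p 0 1 = a1%:R * p 0 0,
  field_vec p 0 2 = - (a2%:R * p 0 3) & field_vec p 0 3 = a2%:R * p 0 2].
Proof.
have iM n (x y : R) : 'i%C * (n%:R * (x +i* y)) = (- (n%:R * y)) +i* (n%:R * x).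
  rewrite -[n%:R]/(_ : R[i]) -(rmorph_nat (real_complex R)).
  by apply/eqP; rewrite eq_complex /=; apply/andP; split; apply/eqP; ring.
by rewrite /field_vec /z1 /z2 !iM; split; rewrite mxE.
Qed.

Lemma flow_coord t p : [/\ flow t p 0 0 = cos (a1%:R * t) * p 0 0 - sin (a1%:R * t) * p 0 1,
  flow t p 0 1 = cos (a1%:R * t) * p 0 1 + sin (a1%:R * t) * p 0 0,
  flow t p 0 2 = cos (a2%:R * t) * p 0 2 - sin (a2%:R * t) * p 0 3 &
  flow t p 0 3 = cos (a2%:R * t) * p 0 3 + sin (a2%:R * t) * p 0 2].
Proof. by split; rewrite mxE. Qed.

(** A speed k of either sign is carried along so that every real multiple of the flow field is the
    velocity of a curve inside an orbit. *)
Lemma is_derive_flow k p :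
  derivable (fun t : R^o => flow (k * t) p) 0 1 /\
  'D_1 (fun t : R^o => flow (k * t) p) 0 = k *: field_vec p.
Proof.
have trig (c x y : R) :
  is_derive (0 : R) (1 : R) (fun t : R => cos (c * (k * t)) * x - sin (c * (k * t)) * y) (k * (- (c * y))).
  apply: is_derive_eq; rewrite !mulr0 cos0 sin0 /GRing.scale /=; ring.
have trig' (c x y : R) :
  is_derive (0 : R) (1 : R) (fun t : R => cos (c * (k * t)) * y + sin (c * (k * t)) * x) (k * (c * x)).
  apply: is_derive_eq; rewrite !mulr0 cos0 sin0 /GRing.scale /=; ring.
have dF i : is_derive (0 : R) (1 : R) (fun t : R => flow (k * t) p 0 i) ((k *: field_vec p) 0 i).
  have [e0 e1 e2 e3] := field_vecE p.
  have fieldk j : (k *: field_vec p) 0 j = k * field_vec p 0 j by rewrite mxE.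
  have ext (f g : R -> R) df : f =1 g -> is_derive (0 : R) (1 : R) f df ->
     is_derive (0 : R) (1 : R) g df by move=> /funext ->.
  have fl t := flow_coord (k * t) p.
  move: i; apply: ord4P; rewrite fieldk.
  - by rewrite e0; apply: ext (trig a1%:R (p 0 0) (p 0 1)) => t; case: (fl t) => ->.
  - by rewrite e1; apply: ext (trig' a1%:R (p 0 0) (p 0 1)) => t; case: (fl t) => _ ->.
  - by rewrite e2; apply: ext (trig a2%:R (p 0 2) (p 0 3)) => t; case: (fl t) => _ _ ->.
  - by rewrite e3; apply: ext (trig' a2%:R (p 0 2) (p 0 3)) => t; case: (fl t) => _ _ _ ->.
have D : derivable (fun t : R^o => flow (k * t) p) 0 1.
  by apply/derivable_mxP => i j; rewrite ord1; case: (dF j).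
split=> //; rewrite derive_mx //; apply/rowP => i.
by rewrite mxE; case: (dF i).
Qed.

Lemma flow_fieldE p : flow_field a1 a2 p = field_vec p.
Proof.
have e : (fun t : R^o => flow t p) = fun t : R^o => flow (1 * t) p.
  by apply: funext => t; rewrite mul1r.
have [_ D] := is_derive_flow 1 p.
rewrite -[RHS]scale1r; apply: etrans D.
exact: (congr1 (fun F : R^o -> E => 'D_1 F 0) e).
Qed.

Lemma velocity_flow k p : velocity (fun t => flow (k * t) p) p (k *: field_vec p).
Proof.
have [D <-] := is_derive_flow k p.
have D' := cvg_dnbhs_at_right D.
apply: cvg_trans D'; apply: near_eq_cvg; near=> t.
by rewrite /= mulr0 flow0 addr0 /GRing.scale /= mulr1.
Unshelve. all: by end_near. Qed.
End Flow.

(** * The surface where f is nonnegative *)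

Section SectionSet.
Variables (R : realType) (a1 a2 d : nat) (f : mpoly 2 R[i]).
Hypotheses (a1_gt0 : (0 < a1)%N) (a2_gt0 : (0 < a2)%N) (d_gt0 : (0 < d)%N).
Hypothesis hf : forall l x y : R[i], l != 0 ->
  eval2 f (l ^+ a1 * x) (l ^+ a2 * y) = l ^+ d * eval2 f x y.
Local Notation E := 'rV[R]_4.
Implicit Types (p q u v : E) (s t k : R).
Local Notation flow := (@flow R a1 a2).
Local Notation rho := (@rho R a1 a2).
Local Notation radial := (@radial R a1 a2).
Local Notation field_vec := (@field_vec R a1 a2).

Definition pval p : R[i] := eval2 f (z1 p) (z2 p).
Definition dpval p v : R[i] := deval2 f (z1 p) (z2 p) (z1 v) (z2 v).

Lemma pval_flow t p : pval (flow t p) = expi t ^+ d * pval p.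
Proof. by rewrite /pval z1_flow z2_flow hf // expi_neq0. Qed.

Lemma z1_rho s p : z1 (rho s p) = (s%:C) ^+ a1 * z1 p.
Proof. by rewrite -rmorphXn; apply/eqP; rewrite eq_complex /= !mxE !mul0r subr0 addr0 !eqxx. Qed.
Lemma z2_rho s p : z2 (rho s p) = (s%:C) ^+ a2 * z2 p.
Proof. by rewrite -rmorphXn; apply/eqP; rewrite eq_complex /= !mxE !mul0r subr0 addr0 !eqxx. Qed.

Lemma pval_rho s p : 0 < s -> pval (rho s p) = (s ^+ d)%:C * pval p.
Proof.
move=> s0; rewrite /pval z1_rho z2_rho hf ?rmorphXn //.
by rewrite eq_complex /= negb_and gt_eqF.
Qed.

Lemma z1_radial p : z1 (radial p) = a1%:R * z1 p.
Proof.
rewrite -(rmorph_nat (real_complex R)).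
by apply/eqP; rewrite eq_complex /= !mxE !mul0r subr0 addr0 !eqxx.
Qed.
Lemma z2_radial p : z2 (radial p) = a2%:R * z2 p.
Proof.
rewrite -(rmorph_nat (real_complex R)).
by apply/eqP; rewrite eq_complex /= !mxE !mul0r subr0 addr0 !eqxx.
Qed.

Lemma dpval_radial p : dpval p (radial p) = d%:R * pval p.
Proof. by rewrite /dpval z1_radial z2_radial /deval2 (euler_eval2 hf). Qed.

Lemma dpval_field p : dpval p (field_vec p) = 'i%C * (d%:R * pval p).
Proof. by rewrite /dpval z1_cpt z2_cpt deval2Z /deval2 (euler_eval2 hf). Qed.

Lemma dpvalD p u v : dpval p (u + v) = dpval p u + dpval p v.
Proof. by rewrite /dpval z1D z2D deval2_add. Qed.

Lemma dpvalZ p k v : dpval p (k *: v) = k%:C * dpval p v.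
Proof. by rewrite /dpval z1Z z2Z deval2Z. Qed.

Lemma dpval0 p : dpval p 0 = 0.
Proof. by have := dpvalZ p 0 0; rewrite scale0r rmorph0 mul0r. Qed.

Lemma dpvalN p v : dpval p (- v) = - dpval p v.
Proof. by rewrite -scaleN1r dpvalZ rmorphN rmorph1 mulN1r. Qed.

Definition reval p : R := complex.Re (pval p).
Definition imval p : R := complex.Im (pval p).

Lemma has_diff_reval p : has_diff reval p (fun v => complex.Re (dpval p v)).
Proof. by case: (has_cdiff_eval2 f p). Qed.
Lemma has_diff_imval p : has_diff imval p (fun v => complex.Im (dpval p v)).
Proof. by case: (has_cdiff_eval2 f p). Qed.

Lemma smooth_reval U : smooth_on U reval.
Proof. by move=> k; apply: (@Ck_on_sub _ _ _ setT) => //; case: (csmooth_eval2 f k). Qed.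
Lemma smooth_imval U : smooth_on U imval.
Proof. by move=> k; apply: (@Ck_on_sub _ _ _ setT) => //; case: (csmooth_eval2 f k). Qed.

Lemma pvalE p : pval p = reval p +i* imval p.
Proof. by rewrite /reval /imval; case: (pval p). Qed.

Lemma natC n : n%:R = (n%:R)%:C :> R[i].
Proof. by rewrite rmorph_nat. Qed.

Lemma im_dpval_field p : complex.Im (dpval p (field_vec p)) = d%:R * reval p.
Proof. by rewrite dpval_field natC pvalE /=; ring. Qed.

Definition section_set : set E := [set p | [/\ S3 p, imval p = 0 & 0 <= reval p]].

Lemma continuous_reval : continuous reval.
Proof. by move=> x; exact: has_diff_continuous (has_diff_reval x). Qed.
Lemma continuous_imval : continuous imval.
Proof. by move=> x; exact: has_diff_continuous (has_diff_imval x). Qed.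

Lemma open_reval_gt0 : open [set p | 0 < reval p].
Proof. by rewrite openE => x /= x0; apply: continuous_gt x0; exact: continuous_reval. Qed.

Lemma tangent_field p : tangentS3 p (field_vec p).
Proof.
have [e0 e1 e2 e3] := field_vecE a1 a2 p.
by rewrite /tangentS3 dotE e0 e1 e2 e3; ring.
Qed.

Lemma pval_pos_interior p : section_set p -> 0 < reval p ->
  interior_point section_set p.
Proof.
move=> Sp p0; split=> //; exists [set p | 0 < reval p], imval; split=> //.
- exact: open_reval_gt0.
- exact: smooth_imval.
- apply/seteqP; split=> q /=; first by case=> -[].
  by case=> h1 h2 h3; split; [split=> [||]; [exact: h1|exact: h3|exact: ltW]|exact: h2].
exists (field_vec p); split; first exact: tangent_field.
rewrite (has_diff_derive _ (has_diff_imval p)) im_dpval_field mulf_neq0 ?gt_eqF //.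
by rewrite ltr0n.
Qed.

Definition regular_at p : Prop :=
  eval2 (mderiv 0 f) (z1 p) (z2 p) != 0 \/ eval2 (mderiv 1 f) (z1 p) (z2 p) != 0.

Lemma dot_dproj p v : p != 0 -> dot p (dproj a1 a2 p v) = 0.
Proof.
move=> p0; rewrite /dproj dotDr dotNr dotZr divfK ?subrr //.
by apply: lt0r_neq0; exact: dot_radial_gt0.
Qed.

Lemma dpval_surj p (w : R[i]) : S3 p -> pval p = 0 -> regular_at p ->
  exists v, tangentS3 p v /\ dpval p v = w.
Proof.
move=> Sp p0 reg.
suff [v vw] : exists v, dpval p v = w.
  exists (dproj a1 a2 p v); split; first exact/dot_dproj/S3_neq0.
  by rewrite /dproj dpvalD dpvalN dpvalZ dpval_radial p0 !mulr0 oppr0 addr0.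
have [x [y xy]] := deval2_surj w reg.
by exists (cpt x y); rewrite /dpval z1_cpt z2_cpt.
Qed.

Lemma pval_zero_boundary p : S3 p -> pval p = 0 -> regular_at p ->
  boundary_point section_set p.
Proof.
move=> Sp p0 reg.
have re0 : reval p = 0 by rewrite /reval p0.
have im0 : imval p = 0 by rewrite /imval p0.
split; first by split=> //; rewrite re0.
exists setT, imval, reval; split=> //.
- by split=> //; exact: openT.
- exact: smooth_imval.
- exact: smooth_reval.
- by rewrite setIT; apply/seteqP; split=> q /= [].
move=> a b; have [v [Tv vE]] := dpval_surj (b +i* a) Sp p0 reg.
exists v; split=> //.
  by rewrite (has_diff_derive _ (has_diff_imval p)) vE.
by rewrite (has_diff_derive _ (has_diff_reval p)) vE.
Qed.

Lemma section_set_closed : closed section_set.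
Proof.
have -> : section_set = [set p | dot p p = 1] `&` ([set p | imval p = 0] `&` [set p | 0 <= reval p]).
  by apply/seteqP; split=> q /=; [case|case=> ? []].
have cd : continuous (fun p : E => dot p p).
  by move=> x; exact: has_diff_continuous (has_diff_dot x).
apply: closedI; [|apply: closedI].
- by apply: (@closed_comp _ _ (fun p : E => dot p p) [set 1]); [move=> x _; exact: cd|exact: closed_eq].
- by apply: (@closed_comp _ _ imval [set 0]); [move=> x _; exact: continuous_imval|exact: closed_eq].
- by apply: (@closed_comp _ _ reval [set x | 0 <= x]); [move=> x _; exact: continuous_reval|exact: closed_ge].
Qed.

Lemma S3_bounded p i : S3 p -> `|p 0 i| <= 1.
Proof.
rewrite /S3 /= dot_sq /sq1 /sq2 => Sp.
have sq0 j : 0 <= p 0 j ^+ 2 by rewrite sqr_ge0.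
have h : p 0 i ^+ 2 <= 1.
  move: (sq0 0) (sq0 1) (sq0 2) (sq0 3) Sp; move: i; apply: ord4P; lra.
by rewrite -(@expr_le1 _ 2) // real_normK ?num_real.
Qed.

Lemma section_set_compact : compact section_set.
Proof.
apply: bounded_closed_compact; last exact: section_set_closed.
exists 1; split=> // M M1 p [Sp _ _] /=; apply: le_trans (ltW M1).
rewrite [leLHS]/Num.Def.normr/= mx_normrE; apply: bigmax_le => // -[i j] _ /=.
by rewrite ord1; exact: S3_bounded.
Qed.

Hypothesis reg : forall p, p != 0 -> pval p = 0 -> regular_at p.

Lemma section_setP p : section_set p -> pval p = 0 \/ 0 < reval p.
Proof.
case=> Sp i0; rewrite le_eqVlt => /orP[/eqP r0|]; last by right.
by left; rewrite pvalE i0 -r0.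
Qed.

(** The zeros of f have to be kept out of the interior: by regularity they are boundary points, and
    no point is both. *)
Lemma surface_interior_section : surface_interior section_set =
  [set p | [/\ S3 p, imval p = 0 & 0 < reval p]].
Proof.
apply/seteqP; split=> p /=; last first.
  by case=> Sp i0 r0; apply: pval_pos_interior => //; split=> //; exact: ltW.
move=> ip; have Sp := ip.1; have [S3p i0 _] := Sp.
split=> //; have [p0|//] := section_setP Sp.
case: (interior_boundary_disjoint ip).
by apply: pval_zero_boundary => //; apply: reg => //; exact: S3_neq0.
Qed.

Lemma surface_boundary_section : surface_boundary section_set =
  [set p | S3 p /\ pval p = 0].
Proof.
apply/seteqP; split=> p /=; last first.
  by case=> Sp p0; apply: pval_zero_boundary => //; apply: reg => //; exact: S3_neq0.
move=> bp; have Sp := bp.1; have [S3p _ _] := Sp; split=> //.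
have [//|p0] := section_setP Sp.
by case: (interior_boundary_disjoint (pval_pos_interior Sp p0) bp).
Qed.

Lemma section_compact_surface : compact_surface section_set.
Proof.
split; [exact: section_set_compact|by move=> p []|].
move=> p Sp; rewrite surface_interior_section surface_boundary_section.
by have [S3p i0 _] := Sp; have [p0|p0] := section_setP Sp; [right|left].
Qed.
End SectionSet.

(** * Intersections of orbits with the section *)

Section DSection.
Variables (R : realType) (a1 a2 d : nat) (f : mpoly 2 R[i]).
Hypotheses (a1_gt0 : (0 < a1)%N) (a2_gt0 : (0 < a2)%N) (d_gt0 : (0 < d)%N).
Hypothesis cop : coprime a1 a2.
Hypothesis hf : forall l x y : R[i], l != 0 ->
  eval2 f (l ^+ a1 * x) (l ^+ a2 * y) = l ^+ d * eval2 f x y.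
Hypothesis reg : forall p, p != 0 -> pval f p = 0 -> regular_at f p.
Local Notation E := 'rV[R]_4.
Implicit Types (p q u v : E) (s t k : R).
Local Notation flow := (@flow R a1 a2).
Local Notation field_vec := (@field_vec R a1 a2).
Local Notation S := (section_set f).

Let interiorE := surface_interior_section a1_gt0 a2_gt0 d_gt0 hf reg.
Let boundaryE := surface_boundary_section a1_gt0 a2_gt0 d_gt0 hf reg.

Lemma dneq0 : d%:R != 0 :> R.
Proof. by rewrite pnatr_eq0 -lt0n. Qed.

Lemma pval_rotate p : pval f p != 0 ->
  exists t r, 0 < r /\ pval f (flow t p) = r%:C.
Proof.
move=> /expi_rotate [t [r [r0 tr]]]; exists (t / d%:R), r; split=> //.
by rewrite (pval_flow hf) -expiX [d%:R * _]mulrC divfK ?dneq0.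
Qed.

Lemma interior_pval p r : S3 p -> 0 < r -> pval f p = r%:C -> surface_interior S p.
Proof. by move=> Sp r0 pE; rewrite interiorE /= /imval /reval pE. Qed.

Lemma boundary_orbit p : S3 p ->
  (Defs.orbit a1 a2 p `<=` surface_boundary S) <-> pval f p = 0.
Proof.
move=> Sp; split=> [/(_ p)|p0 q [t _ <-]].
  rewrite boundaryE => -[|//]; exists 0 => //; exact: flow0.
by rewrite boundaryE; split; [exact: S3_flow|rewrite (pval_flow hf) p0 mulr0].
Qed.

Lemma section_surface_of_section : surface_of_section a1 a2 S.
Proof.
split; first exact: section_compact_surface hf reg.
  by move=> p; rewrite {1}boundaryE => -[Sp p0]; apply/boundary_orbit.
move=> p Sp nb; have p0 : pval f p != 0 by apply/eqP => /(boundary_orbit Sp).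
split.
  have [t [r [r0 tr]]] := pval_rotate p0.
  exists (flow t p); split; last by exists t.
  by apply: interior_pval r0 tr; exact: S3_flow.
move=> q [+ _] Hq; rewrite interiorE => -[Sq iq rq].
have : complex.Im (dpval f q (flow_field a1 a2 q)) = 0.
  apply: (half_tangent_eq0 (has_diff_imval f q) Hq).
  by apply: filterE => x [_ -> _]; rewrite iq.
rewrite flow_fieldE (im_dpval_field hf) => /eqP.
by rewrite mulf_eq0 (negbTE dneq0) gt_eqF.
Qed.

Lemma section_d_section : d_section a1 a2 d S.
Proof.
split; first exact: section_surface_of_section.
move=> p Sp regp nb; have p0 : pval f p != 0 by apply/eqP => /(boundary_orbit Sp).
have [t0 [r [r0 tr]]] := pval_rotate p0.
pose q (k : nat) := flow (t0 + k%:R * (2 * pi / d%:R)) p.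
have root (k : nat) : expi (k%:R * (2 * pi / d%:R)) ^+ d = 1 :> R[i].
  rewrite -expiX mulrCA [d%:R * _]mulrC divfK ?dneq0 //; exact: expi_int.
have qE (k : nat) : pval f (q k) = r%:C.
  by rewrite (pval_flow hf) expiD exprMn root mulr1 -(pval_flow hf).
have -> : surface_interior S `&` Defs.orbit a1 a2 p = q @` `I_d.
  apply/seteqP; split=> x; last first.
    case=> k _ <-; split; last by exists (t0 + k%:R * (2 * pi / d%:R)).
    by apply: (interior_pval _ r0 (qE k)); exact: S3_flow.
  case; rewrite interiorE => -[_ ix rx] [t _ xE].
  have fx : pval f x = (reval f x)%:C by rewrite pvalE ix.
  (* Both values of f are positive, so their ratio is a positive real number on the unit circle,
     hence 1; thus t - t0 is the angle of a d-th root of unity. *)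
  have e1 : expi (d%:R * (t - t0)) = (reval f x / r)%:C :> R[i].
    have rC : r%:C != 0 :> R[i] by rewrite eq_complex /= negb_and gt_eqF.
    have rr : (reval f x / r)%:C * r%:C = (reval f x)%:C.
      by rewrite -rmorphM divfK ?gt_eqF.
    apply: (mulIf rC); rewrite rr -fx -tr -xE !(pval_flow hf).
    by rewrite mulrA -expiX -expiX -expiD -mulrDr subrK.
  have e2 := expi_real_gt0 e1 (divr_gt0 rx r0).
  rewrite e2 in e1.
  have [k kd ke] := expi_root d_gt0 e1.
  exists k => //; rewrite -xE; apply: flow_expi.
  by rewrite expiD ke -expiD subrKC.
apply: inj_card_eq => k j; rewrite !inE /= => kd jd.
wlog jk : k j kd jd / (j <= k)%N.
  by move=> H qq; have [h|h] := leqP j k; [exact: H|apply/esym; apply: H => //; exact: ltnW].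
move=> qq; have e : expi ((k - j)%:R * (2 * pi / d%:R)) = 1 :> R[i].
  set w := expi _.
  have qk : q k = flow ((k - j)%:R * (2 * pi / d%:R)) (q j).
    by rewrite /q -flowD; congr flow; rewrite natrB //; ring.
  have h1 : w ^+ a1 * z1 (q j) = z1 (q j) by rewrite -[RHS](congr1 (@z1 R) qq) qk z1_flow.
  have h2 : w ^+ a2 * z2 (q j) = z2 (q j) by rewrite -[RHS](congr1 (@z2 R) qq) qk z2_flow.
  have c1 : z1 p != 0 -> w ^+ a1 = 1.
    move=> z; have zq : z1 (q j) != 0 by rewrite z1_flow mulf_neq0 // expf_neq0 // expi_neq0.
    by apply: (mulIf zq); rewrite h1 mul1r.
  have c2 : z2 p != 0 -> w ^+ a2 = 1.
    move=> z; have zq : z2 (q j) != 0 by rewrite z2_flow mulf_neq0 // expf_neq0 // expi_neq0.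
    by apply: (mulIf zq); rewrite h2 mul1r.
  (* w fixes a point of the orbit. On an axis, multiplicity 1 means that the relevant weight is 1,
     so w = 1; off the axes w^a1 = w^a2 = 1 and coprimality gives w = 1. *)
  move: regp; rewrite /regular_orbit /multiplicity.
  have [z20|z20] := eqVneq (z2 p) 0.
    move=> a11; have z10 : z1 p != 0.
      apply/eqP => z10; have := S3_neq0 Sp; apply/negP; rewrite negbK; apply/eqP.
      by apply: z12_inj; rewrite ?z10 ?z20; apply/eqP; rewrite eq_complex /= !mxE eqxx.
    by move: (c1 z10); rewrite a11 expr1.
  have [z10|z10] := eqVneq (z1 p) 0.
    by move=> a21; move: (c2 z20); rewrite a21 expr1.
  by move=> _; exact: expi_coprime a1_gt0 cop (c1 z10) (c2 z20).
have pi0 := pi_gt0 R.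
have dR : 0 < d%:R :> R by rewrite ltr0n.
have c0 : 0 < 2 * pi / d%:R :> R by rewrite divr_gt0 // mulr_gt0.
have : (k - j)%:R * (2 * pi / d%:R) = 0 :> R.
  apply: (expi_eq1_small _ e); apply/andP; split; first by rewrite mulr_ge0 // ltW.
  rewrite -[ltRHS](divfK dneq0) [ltRHS]mulrC ltr_pM2r // ltr_nat.
  by rewrite (leq_ltn_trans (leq_subr _ _) kd).
move/eqP; rewrite mulf_eq0 (gt_eqF c0) orbF pnatr_eq0 subn_eq0 => kj.
by apply/eqP; rewrite eqn_leq kj.
Qed.
End DSection.

(** * Orientations *)

Section Det4.
Variable R : realType.
Local Notation E := 'rV[R]_4.
Implicit Types (p u v w : E).

(** Entries are indexed by natural numbers so that minors of minors have the same form and the row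
    expansion can be iterated. *)
Definition detn n (g : nat -> nat -> R) : R := \det (\matrix_(i < n, j < n) g i j).

Lemma detn_expand n (g : nat -> nat -> R) : detn n.+1 g =
  \sum_(j < n.+1) g 0%N j * ((-1) ^+ j * detn n (fun i k => g i.+1 (bump j k))).
Proof.
rewrite /detn (expand_det_row _ ord0); apply: eq_bigr => j _; rewrite mxE /cofactor add0n.
by congr (_ * (_ * \det _)); apply/matrixP => i k; rewrite !mxE.
Qed.

Definition det3 (a b c a' b' c' a'' b'' c'' : R) : R :=
  a * (b' * c'' - c' * b'') - b * (a' * c'' - c' * a'') + c * (a' * b'' - b' * a'').

Lemma detn3E (g : nat -> nat -> R) : detn 3 g =
  det3 (g 0 0) (g 0 1) (g 0 2) (g 1 0) (g 1 1) (g 1 2) (g 2 0) (g 2 1) (g 2 2).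
Proof.
rewrite detn_expand !big_ord_recl big_ord0 /= !detn_expand !big_ord_recl !big_ord0 /=.
by rewrite /detn !det_mx11 !mxE /= /bump /= /det3; ring.
Qed.

Lemma det4E p u v w : det4 p u v w =
    p 0 0 * det3 (u 0 1) (u 0 2) (u 0 3) (v 0 1) (v 0 2) (v 0 3) (w 0 1) (w 0 2) (w 0 3)
  - p 0 1 * det3 (u 0 0) (u 0 2) (u 0 3) (v 0 0) (v 0 2) (v 0 3) (w 0 0) (w 0 2) (w 0 3)
  + p 0 2 * det3 (u 0 0) (u 0 1) (u 0 3) (v 0 0) (v 0 1) (v 0 3) (w 0 0) (w 0 1) (w 0 3)
  - p 0 3 * det3 (u 0 0) (u 0 1) (u 0 2) (v 0 0) (v 0 1) (v 0 2) (w 0 0) (w 0 1) (w 0 2).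
Proof.
pose g i j := (nth 0 [:: p; u; v; w] i) 0 (inord j : 'I_4).
have -> : det4 p u v w = detn 4 g.
  rewrite /det4; congr (\det _); apply/matrixP => i j; rewrite !mxE /g inord_val.
  by rewrite (tnth_nth 0).
have [i0 i1 i2 i3] : [/\ inord 0 = 0 :> 'I_4, inord 1 = 1 :> 'I_4,
    inord 2 = 2 :> 'I_4 & inord 3 = 3 :> 'I_4].
  by split; apply: val_inj; rewrite /= inordK.
rewrite detn_expand !big_ord_recl big_ord0 /= !detn3E /bump /=.
rewrite /g /= i0 i1 i2 i3; rewrite !expr0 !(add1n, addn0) -?exprS; ring.
Qed.

Lemma det4_add u1 u2 v w k p : det4 (u1 + k *: u2) v w p = det4 u1 v w p + k * det4 u2 v w p.
Proof. by rewrite !det4E !mxE; ring. Qed.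

(** Four vectors in the hyperplane orthogonal to p are dependent. *)
Lemma det4_orthogonal p u1 u2 u3 u4 : p != 0 -> dot p u1 = 0 -> dot p u2 = 0 ->
  dot p u3 = 0 -> dot p u4 = 0 -> det4 u1 u2 u3 u4 = 0.
Proof.
move=> p0 h1 h2 h3 h4; apply/eqP; rewrite /det4 -det_tr; apply/det0P; exists p => //.
apply/rowP => i; rewrite !mxE.
transitivity (dot p (tnth [tuple u1; u2; u3; u4] i)).
  by apply: eq_bigr => j _; rewrite !mxE.
by move: i; apply: ord4P; rewrite /tnth /=.
Qed.

(** The area form of the real plane underlying the complex numbers. *)
Definition cross (a b : R[i]) : R :=
  complex.Re a * complex.Im b - complex.Im a * complex.Re b.

Lemma crossM (k a b : R[i]) :
  cross (k * a) (k * b) = (complex.Re k ^+ 2 + complex.Im k ^+ 2) * cross a b.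
Proof. by rewrite /cross !ReM !ImM; ring. Qed.

(** The vectors p and v = ip span a complex line, and u -> y1 z2(u) - y2 z1(u) identifies the
    quotient by it with the complex numbers. The determinant is the area form there; the sign comes
    from exchanging u and v. *)
Lemma det4_cross p u v w (y1 y2 : R[i]) :
  z1 p = y1 -> z2 p = y2 -> z1 v = 'i%C * y1 -> z2 v = 'i%C * y2 ->
  det4 p u v w = - cross (y1 * z2 u - y2 * z1 u) (y1 * z2 w - y2 * z1 w).
Proof.
move=> <- <- e1 e2.
have /eqP := e1; rewrite eq_complex /= => /andP[/eqP v0 /eqP v1].
have /eqP := e2; rewrite eq_complex /= => /andP[/eqP v2 /eqP v3].
rewrite det4E /cross v0 v1 v2 v3 /det3 /=; ring.
Qed.
End Det4.

(** Two linear forms killing the same vector y are proportional: v -> f1 v1 + f2 v2 and v -> y1 v2 -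
    y2 v1. With c the conjugate of y the factor on the right is |y|^2. *)
Lemma wedge_orthogonal (K : fieldType) (y1 y2 c1 c2 f1 f2 v1 v2 : K) :
  f1 * y1 + f2 * y2 = 0 ->
  (f2 * c1 - f1 * c2) * (y1 * v2 - y2 * v1) = (y1 * c1 + y2 * c2) * (f1 * v1 + f2 * v2).
Proof.
move=> e.
have -> : (f2 * c1 - f1 * c2) * (y1 * v2 - y2 * v1) =
  (y1 * c1 + y2 * c2) * (f1 * v1 + f2 * v2) - (f1 * y1 + f2 * y2) * (c1 * v1 + c2 * v2) by ring.
by rewrite e mul0r subr0.
Qed.

Lemma im_linear2 (R : realType) (a b u v : R[i]) : complex.Im (a * u + b * v) =
  complex.Im a * complex.Re u + complex.Re a * complex.Im u
  + (complex.Im b * complex.Re v + complex.Re b * complex.Im v).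
Proof. by rewrite ImD !ImM; ring. Qed.

Lemma proportional (K : fieldType) (f1 f2 y1 y2 v1 v2 : K) :
  f1 != 0 \/ f2 != 0 -> y1 != 0 \/ y2 != 0 ->
  f1 * y1 + f2 * y2 = 0 -> f1 * v1 + f2 * v2 = 0 ->
  exists c, v1 = c * y1 /\ v2 = c * y2.
Proof.
move=> f0 y0 fy fv.
have w : y1 * v2 = y2 * v1.
  apply/eqP; rewrite -subr_eq0; apply/eqP; case: f0 => h; apply: (mulfI h); rewrite mulr0.
    transitivity ((f1 * y1 + f2 * y2) * v2 - y2 * (f1 * v1 + f2 * v2)); first by ring.
    by rewrite fy fv mul0r mulr0 subr0.
  transitivity (y1 * (f1 * v1 + f2 * v2) - (f1 * y1 + f2 * y2) * v1); first by ring.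
  by rewrite fy fv mul0r mulr0 subr0.
case: y0 => h.
  exists (v1 / y1); split; first by rewrite divfK.
  by apply: (mulfI h); rewrite w; field.
exists (v2 / y2); split; last by rewrite divfK.
by apply: (mulfI h); rewrite -w; field.
Qed.

Section Orientation.
Variables (R : realType) (a1 a2 d : nat) (f : mpoly 2 R[i]).
Hypotheses (a1_gt0 : (0 < a1)%N) (a2_gt0 : (0 < a2)%N) (d_gt0 : (0 < d)%N).
Hypothesis hf : forall l x y : R[i], l != 0 ->
  eval2 f (l ^+ a1 * x) (l ^+ a2 * y) = l ^+ d * eval2 f x y.
Hypothesis reg : forall p, p != 0 -> pval f p = 0 -> regular_at f p.
Local Notation E := 'rV[R]_4.
Implicit Types (p q u v n : E) (s t k : R).
Local Notation radial := (@radial R a1 a2).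
Local Notation field_vec := (@field_vec R a1 a2).
Local Notation S := (section_set f).

Let interiorE := surface_interior_section a1_gt0 a2_gt0 d_gt0 hf reg.
Let boundaryE := surface_boundary_section a1_gt0 a2_gt0 d_gt0 hf reg.

Definition pd1 p : R[i] := eval2 (mderiv 0 f) (z1 p) (z2 p).
Definition pd2 p : R[i] := eval2 (mderiv 1 f) (z1 p) (z2 p).

(** The Euclidean gradient of Im f: each coordinate is i times the conjugate of the complex partial
    derivative. *)
Definition grad_im p : E :=
  cpt (complex.Im (pd1 p) +i* complex.Re (pd1 p)) (complex.Im (pd2 p) +i* complex.Re (pd2 p)).

Lemma dot_grad_im p v : dot (grad_im p) v = complex.Im (dpval f p v).
Proof.
rewrite /dpval /deval2 -/(pd1 p) -/(pd2 p) im_linear2 dotE !mxE /=.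
case: (pd1 p) (pd2 p) => [x y] [x1 y1] /=.
by rewrite /tnth /=; ring.
Qed.

Definition normal_field p : E := grad_im p - dot p (grad_im p) *: p.

Lemma dot_normal_field p v : dot p v = 0 -> dot (normal_field p) v = complex.Im (dpval f p v).
Proof.
by move=> pv; rewrite dotC /normal_field dotDr dotNr dotZr [dot v p]dotC pv mulr0 subr0 dotC dot_grad_im.
Qed.

Lemma normal_field_tangent p : S3 p -> dot p (normal_field p) = 0.
Proof. by move=> Sp; rewrite /normal_field dotDr dotNr dotZr Sp mulr1 subrr. Qed.

Lemma continuous_normal_field : continuous normal_field.
Proof.
have cg i : Ck_on 0 setT (fun p => grad_im p 0 i).
  have [r1 j1] := csmooth_eval2 (mderiv 0 f) 0; have [r2 j2] := csmooth_eval2 (mderiv 1 f) 0.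
  move: i; apply: ord4P.
  - by apply: Ck_on_ext j1 => p; rewrite mxE.
  - by apply: Ck_on_ext r1 => p; rewrite mxE.
  - by apply: Ck_on_ext j2 => p; rewrite mxE.
  - by apply: Ck_on_ext r2 => p; rewrite mxE.
have cx i := Ck_on_coord 0 (@setT E) i.
have cdot : Ck_on 0 setT (fun p => dot p (grad_im p)).
  have oT := @openT E.
  apply: Ck_on_ext (Ck_onD oT (Ck_onD oT (Ck_onD oT
   (Ck_onM oT (cx 0) (cg 0)) (Ck_onM oT (cx 1) (cg 1))) (Ck_onM oT (cx 2) (cg 2)))
   (Ck_onM oT (cx 3) (cg 3))) => p.
  by rewrite dotE.
move=> p; apply: continuous_row => i.
have H : Ck_on 0 setT (fun p => normal_field p 0 i).
  apply: Ck_on_ext (Ck_onD openT (cg i) (Ck_onM openT (Ck_on_cst _ _ (-1)) (Ck_onM openT cdot (cx i)))) => x.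
  by rewrite mulN1r !mxE.
exact: H.
Qed.

Lemma section_flow_orientation : flow_orientation a1 a2 S normal_field.
Proof.
have pos q : S3 q -> 0 < reval f q -> 0 < dot (normal_field q) (flow_field a1 a2 q).
  move=> Sq q0; rewrite flow_fieldE dot_normal_field ?tangent_field //.
  by rewrite (im_dpval_field hf) mulr_gt0 // ltr0n.
split.
- by apply: continuous_subspaceT; exact: continuous_normal_field.
- move=> q Sq; have [S3q iq rq] := Sq; split.
  (* Where f > 0 the flow field pairs positively with the normal; at a zero of f some tangent vector
     has df = i. *)
  + apply/eqP => N0; have [q0|q0] := section_setP Sq; last first.
      by have := pos q S3q q0; rewrite N0 dotE !mxE !mul0r !addr0 ltxx.
    have [v [Tv vE]] := dpval_surj a1_gt0 a2_gt0 hf 'i%C S3q q0 (reg (S3_neq0 S3q) q0).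
    have := dot_normal_field Tv; rewrite N0 vE dotE !mxE !mul0r !addr0 /= => /eqP.
    by rewrite eq_sym oner_eq0.
  + exact: normal_field_tangent.
  move=> v Hv; have S3S : S `<=` @S3 R by move=> ? [].
  rewrite dot_normal_field; last exact: half_tangent_S3 S3S Sq Hv.
  apply: (half_tangent_eq0 (has_diff_imval f q) Hv).
  by apply: filterE => x [_ -> _]; rewrite iq.
- by move=> q; rewrite interiorE => -[]; move=> Sq _; exact: pos.
Qed.

(** Replacing p by Y scales the determinant by a positive factor. Modulo the complex line spanned by
    Y and X, df is an orientation-preserving identification with the complex plane, so the sign is
    opposite to that of the area of (df n, df N), which is Re df(n) Im df(N) < 0 because Im df(N) =
    |N|^2. *)
Lemma boundary_orientation p n : S3 p -> pval f p = 0 -> tangentS3 p n ->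
  complex.Im (dpval f p n) = 0 -> complex.Re (dpval f p n) < 0 ->
  0 < det4 p n (field_vec p) (normal_field p).
Proof.
move=> Sp p0 Tn in0 rn0.
have TN := normal_field_tangent Sp.
set N := normal_field p in TN *.
have c0 : 0 < dot p (radial p) by apply: dot_radial_gt0 => //; exact: S3_neq0.
have N0 : 0 < complex.Im (dpval f p N).
  have [v [Tv vE]] := dpval_surj a1_gt0 a2_gt0 hf 'i%C Sp p0 (reg (S3_neq0 Sp) p0).
  have NN : N != 0.
    apply/eqP => NN; have := dot_normal_field Tv; rewrite -/N NN vE dotE !mxE !mul0r !addr0 /= => /eqP.
    by rewrite eq_sym oner_eq0.
  rewrite -(dot_normal_field TN) dot_sq.
  by have [h|h] := sq_gt0 NN; [rewrite ltr_pwDl ?sq2_ge0|rewrite ltr_wpDl ?sq1_ge0].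
(* The component of Y tangent to S^3 contributes nothing: together with n, X and N it makes four
   vectors orthogonal to p. *)
have dE : det4 (radial p) n (field_vec p) N = dot p (radial p) * det4 p n (field_vec p) N.
  rewrite -[radial p in LHS](subrK (dot p (radial p) *: p)) det4_add.
  rewrite (@det4_orthogonal _ p) ?add0r ?S3_neq0 //; last exact: tangent_field.
  by rewrite dotDr dotNr dotZr Sp mulr1 subrr.
suff : 0 < det4 (radial p) n (field_vec p) N by rewrite dE pmulr_rgt0.
set y1 := z1 (radial p); set y2 := z2 (radial p).
have e1 : z1 (field_vec p) = 'i%C * y1 by rewrite z1_cpt /y1 z1_radial.
have e2 : z2 (field_vec p) = 'i%C * y2 by rewrite z2_cpt /y2 z2_radial.
rewrite (det4_cross n N (erefl y1) (erefl y2) e1 e2).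
have orth : pd1 p * y1 + pd2 p * y2 = 0.
  by have := dpval_radial hf p; rewrite p0 mulr0.
pose r := complex.Re y1 ^+ 2 + complex.Im y1 ^+ 2 + (complex.Re y2 ^+ 2 + complex.Im y2 ^+ 2).
have rE : y1 * y1^*%C + y2 * y2^*%C = r%:C.
  by apply/eqP; rewrite eq_complex /r; case: (y1) (y2) => [b1 b2] [b3 b4] /=;
    apply/andP; split; apply/eqP; ring.
have r0 : 0 < r.
  have rad0 : radial p != 0.
    apply/eqP => rad0; move: c0; rewrite rad0 dotE !mxE !mulr0 !addr0 ltxx //.
  rewrite /r; have := sq_gt0 rad0; rewrite /sq1 /sq2 /y1 /y2 /=.
  by case=> h; [rewrite ltr_pwDl // addr_ge0 ?sqr_ge0|rewrite ltr_wpDl // addr_ge0 ?sqr_ge0].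
(* [kappa] is the complex factor between |Y|^2 df and the quotient coordinate of [det4_cross]. *)
pose kappa := pd2 p * y1^*%C - pd1 p * y2^*%C.
have wE v : kappa * (y1 * z2 v - y2 * z1 v) = r%:C * dpval f p v.
  by rewrite -rE /kappa (wedge_orthogonal _ _ _ _ orth).
have := crossM kappa (y1 * z2 n - y2 * z1 n) (y1 * z2 N - y2 * z1 N).
have cE : cross (dpval f p n) (dpval f p N) = complex.Re (dpval f p n) * complex.Im (dpval f p N).
  by rewrite /cross in0 mul0r subr0.
rewrite !wE crossM cE /= expr0n addr0 => H.
rewrite oppr_gt0 ltNge; apply/negP => H2.
have : 0 <= r ^+ 2 * (complex.Re (dpval f p n) * complex.Im (dpval f p N)).
  by rewrite H mulr_ge0 // addr_ge0 ?sqr_ge0.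
by rewrite pmulr_rge0 ?exprn_gt0 // nmulr_rge0 // leNgt N0.
Qed.

Lemma section_positive : coprime a1 a2 -> positive_d_section a1 a2 d S.
Proof.
move=> cop; split; first exact: section_d_section cop hf reg.
exists normal_field; split; first exact: section_flow_orientation.
move=> p n; rewrite boundaryE => -[Sp p0] [Hn nHn].
have Spp : S p by split; rewrite // /imval /reval p0.
have S3S : S `<=` @S3 R by move=> ? [].
have Tn : tangentS3 p n.
  have := half_tangent_S3 S3S Spp Hn; rewrite /tangentS3 dotNr => /eqP.
  by rewrite oppr_eq0 => /eqP.
have im0 : complex.Im (dpval f p n) = 0.
  have : complex.Im (dpval f p (- n)) = 0.
    apply: (half_tangent_eq0 (has_diff_imval f p) Hn).
    by apply: filterE => x [_ -> _]; rewrite /imval p0.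
  by rewrite dpvalN; case: (dpval f p n) => x y /= /eqP; rewrite oppr_eq0 => /eqP.
rewrite flow_fieldE; apply: boundary_orientation => //.
rewrite lt_neqAle; apply/andP; split; last first.
  have : 0 <= complex.Re (dpval f p (- n)).
    apply: (half_tangent_ge0 (has_diff_reval f p) Hn).
    by apply: filterE => x [_ _ h]; rewrite {1}/reval p0.
  by rewrite dpvalN; case: (dpval f p n) => x y /=; rewrite oppr_ge0.
(* If df(n) = 0, then n lies in the complex line spanned by Y; being tangent to S^3 it is a real
   multiple of X, hence the velocity of a flow curve in S, so n is not outward. *)
apply/eqP => re0; apply: nHn.
have dn0 : dpval f p n = 0 by apply/eqP; rewrite eq_complex re0 im0 /= eqxx.
have rad0 : radial p != 0.
  apply/eqP => rad0; have := dot_radial_gt0 a1_gt0 a2_gt0 (S3_neq0 Sp).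
  by rewrite rad0 dotE !mxE !mulr0 !addr0 ltxx.
have y0 : z1 (radial p) != 0 \/ z2 (radial p) != 0.
  have [e1|] := eqVneq (z1 (radial p)) 0; [right|by left].
  apply/eqP => e2; move/eqP: rad0; apply.
  by apply: z12_inj; rewrite ?e1 ?e2; apply/eqP; rewrite eq_complex /= !mxE eqxx.
have orth : pd1 p * z1 (radial p) + pd2 p * z2 (radial p) = 0.
  by have := dpval_radial hf p; rewrite p0 mulr0.
have [c [c1 c2]] := proportional (reg (S3_neq0 Sp) p0) y0 orth dn0.
have nE : n = complex.Re c *: radial p + complex.Im c *: field_vec p.
  have zE (w z : R[i]) : w = c * z -> w = (complex.Re c)%:C * z + (complex.Im c)%:C * ('i%C * z).
    move=> ->; rewrite mulrA -mulrDl; congr (_ * _).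
    by apply/eqP; rewrite eq_complex /=; case: (c) => x y /=; apply/andP; split; apply/eqP; ring.
  have e1 : z1 (field_vec p) = 'i%C * z1 (radial p) by rewrite z1_cpt z1_radial.
  have e2 : z2 (field_vec p) = 'i%C * z2 (radial p) by rewrite z2_cpt z2_radial.
  apply: z12_inj; first by rewrite z1D !z1Z e1; exact: zE c1.
  by rewrite z2D !z2Z e2; exact: zE c2.
have Rc : complex.Re c = 0.
  have := Tn; rewrite /tangentS3 nE dotDr !dotZr (tangent_field a1 a2 p) mulr0 addr0 => /eqP.
  by rewrite mulf_eq0 [dot p _ == 0]gt_eqF ?orbF => [/eqP //|]; exact/dot_radial_gt0/S3_neq0.
rewrite nE Rc scale0r add0r.
exists (fun t => Defs.flow a1 a2 (complex.Im c * t) p); split.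
- by rewrite mulr0 flow0.
- apply: nearW => t; split; first exact: S3_flow.
    by rewrite /imval (pval_flow hf) p0 mulr0.
  by rewrite /reval (pval_flow hf) p0 mulr0.
- exact: velocity_flow.
Qed.
End Orientation.

(** * The embedding of the affine part *)

Section Embedding.
Variables (R : realType) (a1 a2 d : nat) (f : mpoly 2 R[i]).
Hypotheses (a1_gt0 : (0 < a1)%N) (a2_gt0 : (0 < a2)%N) (d_gt0 : (0 < d)%N).
Hypothesis hf : forall l x y : R[i], l != 0 ->
  eval2 f (l ^+ a1 * x) (l ^+ a2 * y) = l ^+ d * eval2 f x y.
Local Notation E := 'rV[R]_4.
Implicit Types (p q u v x : E) (s t k : R).
Local Notation radial := (@radial R a1 a2).
Local Notation rho := (@rho R a1 a2).
Local Notation wscale := (@wscale R a1 a2).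
Local Notation weight := (weight a1 a2).
Local Notation proj := (@weighted_proj R a1 a2).

Lemma pval0 : pval f 0 = 0.
Proof.
have := dpval_radial hf (0 : E).
rewrite (_ : radial 0 = 0) ?dpval0; last by apply/rowP => i; rewrite !mxE mulr0.
move=> /esym /eqP.
by rewrite mulf_eq0 pnatr_eq0 -[d == 0%N]negbK -lt0n d_gt0 /= => /eqP.
Qed.

Lemma affine_neq0 x : affine_part f x -> x != 0.
Proof.
move=> xA; apply/eqP => x0; move: xA; rewrite x0 /affine_part /=.
by rewrite -/(pval f 0) pval0 => /eqP; rewrite eq_sym oner_eq0.
Qed.

Lemma pval_proj x : affine_part f x -> pval f (proj x) = (wscale x ^+ d)%:C.
Proof.
move=> xA; have x0 := affine_neq0 xA.
rewrite weighted_projE // (pval_rho hf) ?wscale_gt0 //.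
by rewrite (_ : pval f x = 1) // mulr1.
Qed.

(** The real power s^(-1/d), for s > 0. *)
Definition dth_root_inv s : R := expR (- ln s / d%:R).

Lemma dth_root_invX s : 0 < s -> dth_root_inv (s ^+ d) = s^-1.
Proof.
move=> s0; rewrite /dth_root_inv lnXn // -[ln s *+ d]mulr_natr -mulNr mulfK ?pnatr_eq0 -?lt0n //.
by rewrite expRN lnK.
Qed.

Lemma dth_root_invK s : 0 < s -> dth_root_inv s ^+ d * s = 1.
Proof.
move=> s0; rewrite /dth_root_inv -expRM_natl [d%:R * _]mulrC divfK ?pnatr_eq0 -?lt0n //.
by rewrite expRN lnK // mulVf // gt_eqF.
Qed.

Lemma dth_root_inv_gt0 s : 0 < dth_root_inv s.
Proof. exact: expR_gt0. Qed.

Lemma positive_value_affine p r : 0 < r -> pval f p = r%:C ->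
  affine_part f (rho (dth_root_inv r) p).
Proof.
move=> r0 pr; rewrite /affine_part /= -/(pval f _) (pval_rho hf) ?dth_root_inv_gt0 //.
by rewrite pr -rmorphM /= dth_root_invK.
Qed.

(** Rescaling p by f(p)^(-1/d) makes the value of f equal to 1; this inverts the projection on the
    affine part. *)
Definition unproj p : E := rho (dth_root_inv (reval f p)) p.

Lemma projK x : affine_part f x -> unproj (proj x) = x.
Proof.
move=> xA; have x0 := affine_neq0 xA; have u0 := wscale_gt0 a1_gt0 a2_gt0 x0.
rewrite /unproj /reval pval_proj //= dth_root_invX // weighted_projE // rhoM.
by rewrite mulVf ?rho1 // gt_eqF.
Qed.

Lemma continuous_unproj p : 0 < reval f p -> {for p, continuous unproj}.
Proof.
move=> r0; apply: continuous_row => i.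
have c1 : {for p, continuous (fun x => dth_root_inv (reval f x))}.
  have cl : {for p, continuous (@ln R \o reval f)}.
    by apply: continuous_comp; [exact: continuous_reval|exact: continuous_ln].
  have ce : continuous (fun s : R => expR (- s / d%:R)).
    move=> s; apply: (@continuous_comp _ _ _ (fun s : R => - s / d%:R) (@expR R)).
      by apply: continuousM; [apply: continuousN; exact: cvg_id|exact: cst_continuous].
    exact: continuous_expR.
  exact: continuous_for_comp cl ce.
have c2 : {for p, continuous (fun x => dth_root_inv (reval f x) ^+ weight i)}.
  exact: continuous_for_comp c1 (@exprn_continuous R _).
have c3 : {for p, continuous (fun x : E => x 0 i)}.
  exact: has_diff_continuous (has_diff_coord p i).
have -> : (fun x => unproj x 0 i) = fun x => dth_root_inv (reval f x) ^+ weight i * x 0 i.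
  by apply: funext => x; rewrite mxE.
exact: continuousM c2 c3.
Qed.

Lemma affine_half_tangent x v : affine_part f x -> half_tangent (affine_part f) x v ->
  dpval f x v = 0.
Proof.
move=> xA Hv; apply/eqP; rewrite eq_complex /=; apply/andP; split; apply/eqP.
  apply: (half_tangent_eq0 (has_diff_reval f x) Hv); apply: filterE => y yA.
  by rewrite /reval /pval xA yA.
apply: (half_tangent_eq0 (has_diff_imval f x) Hv); apply: filterE => y yA.
by rewrite /imval /pval xA yA.
Qed.

Lemma derive_proj x v i : x != 0 -> 'D_v proj x 0 i =
  wscale x ^+ weight i * v 0 i
     + x 0 i * ((weight i)%:R * wscale x ^+ (weight i).-1 * dwscale a1 a2 x v).
Proof.
move=> x0; have H j := has_diff_weighted_proj a1_gt0 a2_gt0 j x0.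
have D : derivable proj x v.
  by apply/derivable_mxP => k j; rewrite ord1; apply: diff_derivable; case: (H j).
by rewrite derive_mx // mxE; exact: (has_diff_derive v (H i)).
Qed.

(** The projection only collapses the direction Y, and Y is transverse to {f = 1} because df(Y) = d
    there. *)
Lemma proj_immersion x v : affine_part f x -> half_tangent (affine_part f) x v ->
  v != 0 -> 'D_v proj x != 0.
Proof.
move=> xA Hv; apply: contra_neq => D0; have x0 := affine_neq0 xA.
have u0 := wscale_gt0 a1_gt0 a2_gt0 x0.
pose c := dwscale a1 a2 x v / wscale x.
have vE : v = - c *: radial x.
  apply/rowP => i; have := derive_proj v i x0; rewrite D0 !mxE => /esym/eqP.
  rewrite addr_eq0 => /eqP e.
  have un0 : wscale x ^+ weight i != 0 by rewrite expf_neq0 // gt_eqF.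
  apply: (mulfI un0); rewrite e /c.
  have w0 : (0 < weight i)%N by rewrite /weight; case: ifP.
  have uw : wscale x ^+ weight i = wscale x * wscale x ^+ (weight i).-1.
    by rewrite -exprS prednK.
  by rewrite uw; field; rewrite gt_eqF.
have := affine_half_tangent xA Hv.
rewrite vE dpvalZ (dpval_radial hf) (_ : pval f x = 1) // mulr1 => /eqP.
rewrite mulf_eq0 pnatr_eq0 -[d == 0%N]negbK -lt0n d_gt0 /= orbF eq_complex /= => /andP[/eqP -> _].
by rewrite scale0r.
Qed.

Lemma proj_affine : proj @` affine_part f =
  [set p | [/\ S3 p, imval f p = 0 & 0 < reval f p]].
Proof.
apply/seteqP; split=> p /=.
  case=> x xA <-; have x0 := affine_neq0 xA.
  rewrite /imval /reval pval_proj //; split=> //; first exact: weighted_proj_S3.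
  by rewrite /= exprn_gt0 // wscale_gt0.
case=> Sp ip rp; have pE : pval f p = (reval f p)%:C by rewrite pvalE ip.
exists (unproj p); first exact: positive_value_affine rp pE.
by rewrite weighted_proj_rho ?dth_root_inv_gt0 ?S3_neq0 // weighted_proj_id.
Qed.

Lemma proj_smooth_embedding : smooth_embedding (affine_part f) proj.
Proof.
split.
- exists [set x | x != 0]; split; [exact: open_neq0|exact: affine_neq0|].
  by move=> i k; exact: Ck_weighted_proj.
- exact: proj_immersion.
exists unproj; split; first exact: projK.
apply: continuous_in_subspaceT => p; rewrite inE proj_affine => -[_ _].
exact: continuous_unproj.
Qed.

Lemma nonsingular_defines : coprime a1 a2 ->
  (forall p, p != 0 -> pval f p = 0 -> regular_at f p) ->
  defines_positive_d_section a1 a2 d f.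
Proof.
move=> cop reg; exists (section_set f); split.
- exact: section_positive hf reg cop.
- exact: proj_smooth_embedding.
by rewrite proj_affine (surface_interior_section a1_gt0 a2_gt0 d_gt0 hf reg).
Qed.
End Embedding.

(** * Singular points *)

Section Slice.
Variable K : numFieldType.
Implicit Types (f : mpoly 2 K) (P Q : {poly K}).

Lemma line_poly f q1 q2 e1 e2 : exists P,
  (forall w, P.[w] = eval2 f (q1 + w * e1) (q2 + w * e2)) /\
  P^`().[0] = eval2 (mderiv 0 f) q1 q2 * e1 + eval2 (mderiv 1 f) q1 q2 * e2.
Proof.
have [P [eP dP]] := restrict_eval2 f (q1%:P + e1 *: 'X) (q2%:P + e2 *: 'X).
have lE (q e w : K) : (q%:P + e *: 'X).[w] = q + w * e.
  by rewrite hornerD hornerC hornerZ hornerX mulrC.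
have dlE (q e w : K) : (q%:P + e *: 'X)^`().[w] = e.
  by rewrite derivD derivC derivZ derivX add0r hornerZ hornerC mulr1.
exists P; split=> [w|]; first by rewrite eP !lE.
by rewrite dP !lE !dlE !mul0r !addr0.
Qed.

(** If the step from q to a point z with f(z) nonzero is parallel to y, moving z in a direction k
    not parallel to y repairs this, and f remains nonzero for some nonzero t, since it is a nonzero
    polynomial in t. *)
Lemma transverse_direction f q1 q2 y1 y2 z1 z2 : y1 != 0 \/ y2 != 0 ->
  eval2 f z1 z2 != 0 ->
  exists e1 e2, y1 * e2 - y2 * e1 != 0 /\ eval2 f (q1 + e1) (q2 + e2) != 0.
Proof.
move=> y0 fz.
have [k1 [k2 kW]] : exists k1 k2, y1 * k2 - y2 * k1 != 0.
  by case: y0 => h; [exists 0, 1; rewrite mulr1 mulr0 subr0|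
    exists (-1), 0; rewrite mulr0 sub0r mulrN1 opprK].
have [W0|W0] := eqVneq (y1 * (z2 - q2) - y2 * (z1 - q1)) 0; last first.
  by exists (z1 - q1), (z2 - q2); split=> //; rewrite !subrKC.
have [P [eP _]] := line_poly f z1 z2 k1 k2.
have [t t0 Pt] : exists2 t, t != 0 & P.[t] != 0.
  apply: contrapT => H; have P0 : P = 0.
    apply: horner_ext_nz => w w0; rewrite horner0; apply/eqP/negPn/negP => h.
    by apply: H; exists w.
  by move/eqP: fz; apply; have := eP 0; rewrite P0 horner0 !mul0r !addr0.
exists (z1 - q1 + t * k1), (z2 - q2 + t * k2); split; last first.
  by move: Pt; rewrite eP; congr (eval2 f _ _ != 0); ring.
have -> : y1 * (z2 - q2 + t * k2) - y2 * (z1 - q1 + t * k1) =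
  y1 * (z2 - q2) - y2 * (z1 - q1) + t * (y1 * k2 - y2 * k1) by ring.
by rewrite W0 add0r mulf_neq0.
Qed.

(** On the line f is a nonzero polynomial that vanishes at w = 0 together with its derivative, so 0
    is a root of multiplicity m >= 2. *)
Lemma singular_slice f q1 q2 e1 e2 : eval2 f q1 q2 = 0 ->
  eval2 (mderiv 0 f) q1 q2 = 0 -> eval2 (mderiv 1 f) q1 q2 = 0 ->
  eval2 f (q1 + e1) (q2 + e2) != 0 ->
  exists (m : nat) Q, [/\ (1 < m)%N, Q.[0] != 0 &
    forall w, eval2 f (q1 + w * e1) (q2 + w * e2) = w ^+ m * Q.[w]].
Proof.
move=> f0 d1 d2 fe; have [P [eP dP]] := line_poly f q1 q2 e1 e2.
have P0 : P != 0.
  by apply/eqP => P0; move/eqP: fe; apply; have := eP 1; rewrite P0 horner0 !mul1r.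
have [m [Q]] := multiplicity_XsubC P 0.
rewrite P0 /= => Q0; rewrite subr0 => PE.
exists m, Q; split; last by move=> w; rewrite -eP PE hornerM hornerXn mulrC.
- case: m PE => [|[|//]] PE.
    have := eP 0; rewrite PE expr0 mulr1 !mul0r !addr0 f0 => q0.
    by move: Q0; rewrite /root q0 eqxx.
  have := dP; rewrite PE expr1 derivM derivX hornerD !hornerM hornerX hornerC d1 d2.
  by rewrite mulr0 mulr1 add0r !mul0r addr0 => q0; move: Q0; rewrite /root q0 eqxx.
- exact: Q0.
Qed.

Lemma cramer2 (y1 y2 e1 e2 u1 u2 : K) : y1 * e2 - y2 * e1 != 0 ->
  exists c w, u1 = c * y1 + w * e1 /\ u2 = c * y2 + w * e2.
Proof.
move=> W0; exists ((u1 * e2 - u2 * e1) / (y1 * e2 - y2 * e1)),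
  ((y1 * u2 - y2 * u1) / (y1 * e2 - y2 * e1)).
by split; field.
Qed.
End Slice.

(** * Real lines in the complex plane *)

Section RealPlane.
Variable R : realType.
Implicit Types (y w o : R[i]) (A : R[i] -> R).

(** Apply A to the identity cross(o, w) y = cross(y, w) o - cross(y, o) w. In other words, the
    kernel of a nonzero real functional on the complex plane is at most a line. *)
Lemma cross_kernel A y o w :
  (forall (a b : R) u v, A (a%:C * u + b%:C * v) = a * A u + b * A v) ->
  A y = 1 -> A o = 0 -> A w = 0 -> cross o w = 0.
Proof.
move=> lin Ay Ao Aw.
have e : (cross o w)%:C * y + 0%:C * y = (cross y w)%:C * o + (- cross y o)%:C * w.
  apply/eqP; rewrite eq_complex /cross; case: y {Ay} => a b; case: o {Ao} => a' b'.
  by case: w {Aw} => a'' b'' /=; apply/andP; split; apply/eqP; ring.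
have := congr1 A e; by rewrite !lin Ay Ao Aw !mulr0 !mulr1 !addr0.
Qed.

Lemma cross_eq0 o w : w != 0 -> cross o w = 0 -> exists l : R, o = l%:C * w.
Proof.
case: o w => [a b] [a' b'] w0; rewrite /cross /= => h.
have n0 : a' ^+ 2 + b' ^+ 2 != 0.
  rewrite paddr_eq0 ?sqr_ge0 // !sqrf_eq0; move: w0; by rewrite eq_complex.
exists ((a * a' + b * b') / (a' ^+ 2 + b' ^+ 2)).
apply/eqP; rewrite eq_complex /= !mul0r subr0 addr0; apply/andP; split; apply/eqP.
  apply: (mulIf n0); rewrite mulrAC divfK //.
  transitivity ((a * a' + b * b') * a' + (a * b' - b * a') * b'); first by ring.
  by rewrite h mul0r addr0.
apply: (mulIf n0); rewrite mulrAC divfK //.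
transitivity ((a * a' + b * b') * b' - (a * b' - b * a') * a'); first by ring.
by rewrite h mul0r subr0.
Qed.

(** Dependence over the reals makes the root of unity real, hence 1 or -1, and m > 1 excludes 1. *)
Lemma root_of_unity_cross (m : nat) w : (1 < m)%N -> w != 0 ->
  cross (expi (2 * pi / m%:R) * w) w = 0 -> expi (2 * pi / m%:R) = -1 :> R[i].
Proof.
move=> m1 w0 /(cross_eq0 w0) [l lE].
have {}lE := mulIf w0 lE.
have mR : 1 < m%:R :> R by rewrite (ltr_nat _ 1).
have m0 : 0 < m%:R :> R by apply: lt_trans mR.
have p0 : 0 < 2 * pi :> R by rewrite mulr_gt0 // pi_gt0.
have := cos2Dsin2 (2 * pi / m%:R : R).
have /eqP := lE; rewrite eq_complex /= => /andP[/eqP -> /eqP ->].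
rewrite expr0n addr0 => /eqP; rewrite sqrf_eq1 => /orP[/eqP l1|/eqP l1]; last first.
  by rewrite lE l1 rmorphN rmorph1.
have e1 : expi (2 * pi / m%:R) = 1 :> R[i] by rewrite lE l1.
have : 2 * pi / m%:R = 0 :> R.
  apply: (expi_eq1_small _ e1); rewrite divr_ge0 ?ltW //= ltr_pdivrMr //.
  by rewrite ltr_pMr.
by move/eqP; rewrite mulf_eq0 invr_eq0 !gt_eqF.
Qed.
End RealPlane.

Lemma cvg_near_gt (R : realType) (T : Type) (F : set_system T) {FF : Filter F}
    (f : T -> R) (l c : R) : f @ F --> l -> c < l -> \forall t \near F, c < f t.
Proof. by move=> H; exact: (cvgr_gt l H). Qed.

Lemma cvg_near_lt (R : realType) (T : Type) (F : set_system T) {FF : Filter F}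
    (f : T -> R) (l c : R) : f @ F --> l -> l < c -> \forall t \near F, f t < c.
Proof. by move=> H; exact: (cvgr_lt l H). Qed.

Lemma cvg_for_comp (T : Type) (F : set_system T) {FF : Filter F} (X Y : topologicalType)
    (f : T -> X) (g : X -> Y) (x : X) :
  f @ F --> x -> {for x, continuous g} -> (fun t => g (f t)) @ F --> g x.
Proof. by move=> cf cg; exact: cvg_comp cf cg. Qed.

Section Rotation.
Variables (R : realType) (T : Type) (F : set_system T).
Context {FF : Filter F}.
Implicit Types (s : T -> R) (w : R[i]).

Lemma Re_rotation_cvg w s (s0 : R) : s @ F --> s0 ->
  (fun x => complex.Re (w * expi (s x))) @ F --> complex.Re (w * expi s0).
Proof.
move=> cs.
have cc : (fun x => cos (s x)) @ F --> cos s0 by apply: cvg_comp cs _; exact: continuous_cos.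
have ss : (fun x => sin (s x)) @ F --> sin s0 by apply: cvg_comp cs _; exact: continuous_sin.
by case: w => x y /=; apply: cvgB; apply: cvgM => //; exact: cvg_cst.
Qed.

Lemma Im_rotation_cvg w s (s0 : R) : s @ F --> s0 ->
  (fun x => complex.Im (w * expi (s x))) @ F --> complex.Im (w * expi s0).
Proof.
move=> cs.
have cc : (fun x => cos (s x)) @ F --> cos s0 by apply: cvg_comp cs _; exact: continuous_cos.
have ss : (fun x => sin (s x)) @ F --> sin s0 by apply: cvg_comp cs _; exact: continuous_sin.
by case: w => x y /=; apply: cvgD; apply: cvgM => //; exact: cvg_cst.
Qed.
End Rotation.

(** * Curves on which a slice of f is positive *)

Section SliceCurve.
Variables (R : realType) (m : nat) (Q : {poly R[i]}) (o : R[i]).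
Local Notation E := 'rV[R]_4.
Hypotheses (m_gt0 : (0 < m)%N) (oQ : o ^+ m * Q.[0] = 1).

(** The pair of w = t o exp(is) and (w / t)^m, written so as to make sense at t = 0. It makes
    [slice_val], the slice w^m Q(w) divided by t^m, a smooth function on R^4 composed with a
    continuous map. *)
Definition slice_pt (t s : R) : E :=
  cpt (t%:C * (o * expi s)) (o ^+ m * expi (m%:R * s)).

Definition slice_val (x : E) : R[i] := z2 x * Q.[z1 x].

Lemma slice_valE t s :
  slice_val (slice_pt t s) = (o * expi s) ^+ m * Q.[t%:C * (o * expi s)].
Proof. by rewrite /slice_val z1_cpt z2_cpt expiX exprMn. Qed.

Lemma slice_pt_cvg (T : Type) (F : set_system T) {FF : Filter F} (a s : T -> R) a0 s0 :
  a @ F --> (a0 : R) -> s @ F --> (s0 : R) ->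
  (fun x => slice_pt (a x) (s x)) @ F --> slice_pt a0 s0.
Proof.
move=> ca cs.
have cm : (fun x => m%:R * s x) @ F --> m%:R * s0.
  by apply: cvgM => //; exact: cvg_cst.
have ReZ (t : R) (w : R[i]) : complex.Re (t%:C * w) = t * complex.Re w.
  by case: w => x y /=; rewrite mul0r subr0.
have ImZ (t : R) (w : R[i]) : complex.Im (t%:C * w) = t * complex.Im w.
  by case: w => x y /=; rewrite mul0r addr0.
have [E0 E1 E2 E3] : [/\
    forall t u, slice_pt t u 0 0 = t * complex.Re (o * expi u),
    forall t u, slice_pt t u 0 1 = t * complex.Im (o * expi u),
    forall t u, slice_pt t u 0 2 = complex.Re (o ^+ m * expi (m%:R * u)) &
    forall t u, slice_pt t u 0 3 = complex.Im (o ^+ m * expi (m%:R * u))].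
  by split=> t u; rewrite mxE /tnth /= -?ReZ -?ImZ.
apply: cvg_row; apply: ord4P.
- rewrite E0; under eq_fun do rewrite E0; apply: cvgM ca _; exact: Re_rotation_cvg.
- rewrite E1; under eq_fun do rewrite E1; apply: cvgM ca _; exact: Im_rotation_cvg.
- rewrite E2; under eq_fun do rewrite E2; exact: Re_rotation_cvg.
- rewrite E3; under eq_fun do rewrite E3; exact: Im_rotation_cvg.
Qed.

Lemma slice_val_smooth : csmooth slice_val.
Proof. exact: csmoothM (@csmooth_z2 R) (csmooth_horner Q (@csmooth_z1 R)). Qed.

Lemma Re_slice_cvg (T : Type) (F : set_system T) {FF : Filter F} (a s : T -> R) a0 s0 :
  a @ F --> (a0 : R) -> s @ F --> (s0 : R) ->
  (fun x => complex.Re (slice_val (slice_pt (a x) (s x)))) @ F -->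
    complex.Re (slice_val (slice_pt a0 s0)).
Proof.
move=> ca cs; have [c0 _] := slice_val_smooth 0.
exact: cvg_for_comp (slice_pt_cvg ca cs) (c0 (slice_pt a0 s0) I).
Qed.

Lemma Im_slice_cvg (T : Type) (F : set_system T) {FF : Filter F} (a s : T -> R) a0 s0 :
  a @ F --> (a0 : R) -> s @ F --> (s0 : R) ->
  (fun x => complex.Im (slice_val (slice_pt (a x) (s x)))) @ F -->
    complex.Im (slice_val (slice_pt a0 s0)).
Proof.
move=> ca cs; have [_ c0] := slice_val_smooth 0.
exact: cvg_for_comp (slice_pt_cvg ca cs) (c0 (slice_pt a0 s0) I).
Qed.

Lemma slice_val0 s : slice_val (slice_pt 0 s) = expi (m%:R * s).
Proof. by rewrite slice_valE mul0r exprMn mulrAC oQ mul1r -expiX. Qed.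

(** At t = 0 the rescaled value is exp(ims), whose imaginary part changes sign at s = 0. For small t
    > 0 a zero of the imaginary part persists near s = 0, and there the real part is close to 1. *)
Lemma slice_angle : exists s : R -> R, s @ 0^'+ --> (0 : R) /\
  \forall t \near 0^'+, exists r, 0 < r /\ slice_val (slice_pt t (s t)) = r%:C.
Proof.
have id0 : (fun t : R => t) @ 0^'+ --> (0 : R).
  by apply: cvg_at_right_filter; exact: cvg_id.
have sel e : 0 < e -> \forall t \near 0^'+, exists s, `|s| <= e /\
    complex.Im (slice_val (slice_pt t s)) = 0.
  move=> e0; have mR : 0 < m%:R :> R by rewrite ltr0n.
  (* This bound puts m e' in the interval from 0 to pi, where sin is positive. *)
  pose e' := Num.min e (pi / 2 / m%:R).
  have pi0 := pi_gt0 R.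
  have e'0 : 0 < e' by rewrite lt_min e0 !divr_gt0.
  have me' : 0 < m%:R * e' < pi.
    rewrite mulr_gt0 //=; apply: (@le_lt_trans _ _ (pi / 2)); last by rewrite ltr_pdivrMr //; lra.
    by rewrite mulrC -ler_pdivlMr // ge_min lexx orbT.
  have s0 := sin_gt0_pi me'.
  have n1 : \forall t \near 0^'+, 0 < complex.Im (slice_val (slice_pt t e')).
    have cs : (fun _ : R => e') @ 0^'+ --> (e' : R) by exact: cvg_cst.
    have H0 : 0 < complex.Im (slice_val (slice_pt 0 e')) by rewrite slice_val0.
    exact: cvg_near_gt (Im_slice_cvg id0 cs) H0.
  have n2 : \forall t \near 0^'+, complex.Im (slice_val (slice_pt t (- e'))) < 0.
    have cs : (fun _ : R => - e') @ 0^'+ --> (- e' : R) by exact: cvg_cst.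
    have H0 : complex.Im (slice_val (slice_pt 0 (- e'))) < 0.
      by rewrite slice_val0 /= mulrN sinN oppr_lt0.
    exact: cvg_near_lt (Im_slice_cvg id0 cs) H0.
  near=> t.
  have t1 : 0 < complex.Im (slice_val (slice_pt t e')) by near: t; exact: n1.
  have t2 : complex.Im (slice_val (slice_pt t (- e'))) < 0 by near: t; exact: n2.
  have ne : - e' <= e' by rewrite -subr_ge0 opprK addr_ge0 ?ltW.
  have [||s] := @IVT R (fun s => complex.Im (slice_val (slice_pt t s))) (- e') e' 0 ne.
  - apply: continuous_subspaceT => s.
    by apply: Im_slice_cvg; [exact: cvg_cst|exact: cvg_id].
  - by rewrite ge_min le_max (ltW t1) (ltW t2) orbT.
  rewrite in_itv /= -ler_norml => se sE; exists s; split=> //.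
  by apply: le_trans se _; rewrite ge_min lexx.
have [s [s0 Hs]] := select_near0 sel; exists s; split=> //.
have n1 : \forall t \near 0^'+, 0 < complex.Re (slice_val (slice_pt t (s t))).
  have H0 : 0 < complex.Re (slice_val (slice_pt 0 0)).
    by rewrite slice_val0 mulr0 expi0 /= ltr01.
  exact: cvg_near_gt (Re_slice_cvg id0 s0) H0.
near=> t.
have t1 : complex.Im (slice_val (slice_pt t (s t))) = 0 by near: t; exact: Hs.
have t2 : 0 < complex.Re (slice_val (slice_pt t (s t))) by near: t; exact: n1.
exists (complex.Re (slice_val (slice_pt t (s t)))); split=> //.
by move: t1; case: (slice_val _) => x y /= ->.
Unshelve. all: by end_near. Qed.
End SliceCurve.

(** * Regularity of f forced by the section *)

Section Converse.
Variables (R : realType) (a1 a2 d : nat) (f : mpoly 2 R[i]).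
Hypotheses (a1_gt0 : (0 < a1)%N) (a2_gt0 : (0 < a2)%N) (d_gt0 : (0 < d)%N).
Hypothesis hf : forall l x y : R[i], l != 0 ->
  eval2 f (l ^+ a1 * x) (l ^+ a2 * y) = l ^+ d * eval2 f x y.
Local Notation E := 'rV[R]_4.
Implicit Types (p q u v x : E) (s t k : R) (w o : R[i]).
Local Notation radial := (@radial R a1 a2).
Local Notation field_vec := (@field_vec R a1 a2).
Local Notation rho := (@rho R a1 a2).
Local Notation proj := (@weighted_proj R a1 a2).
Variable S : set E.
Hypothesis HS : surface_of_section a1 a2 S.
Hypothesis HA : proj @` affine_part f = surface_interior S.

Lemma section_interiorE : surface_interior S =
  [set p | [/\ S3 p, imval f p = 0 & 0 < reval f p]].
Proof. by rewrite -HA; exact: (proj_affine a1_gt0 a2_gt0 d_gt0 hf). Qed.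

(** If f vanished identically, the interior of S would be empty, so every orbit would lie in the
    boundary and S would contain all of S^3. *)
Lemma section_pval_neq0 q : S3 q -> exists x, pval f x != 0.
Proof.
move=> Sq; apply: contrapT => H.
have f0 x : pval f x = 0 by apply/eqP/negPn/negP => h; apply: H; exists x.
have [_ _ HS3] := HS.
have bd p : S3 p -> surface_boundary S p.
  move=> Sp; have ob : Defs.orbit a1 a2 p `<=` surface_boundary S.
    apply: contrapT => nb; have [[x [+ _]] _] := HS3 p Sp nb.
    by rewrite section_interiorE => -[_ _]; rewrite /reval f0 ltxx.
  by apply: ob; exists 0 => //; exact: flow0.
by apply: (S3_not_boundary Sq (bd q Sq)) => p /bd [].
Qed.

Lemma positive_proj_section x r : x != 0 -> 0 < r -> pval f x = r%:C -> S (proj x).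
Proof.
move=> x0 r0 xr.
have : surface_interior S (proj x).
  rewrite -HA -(weighted_proj_rho a1_gt0 a2_gt0 (dth_root_inv_gt0 d r) x0).
  by exists (rho (dth_root_inv d r) x) => //; exact: positive_value_affine r0 xr.
by case.
Qed.

Lemma dproj_linear q (k k' : R) u v :
  dproj a1 a2 q (k *: u + k' *: v) = k *: dproj a1 a2 q u + k' *: dproj a1 a2 q v.
Proof.
by apply/rowP => i; rewrite /dproj dotDr !dotZr !mxE; ring.
Qed.

Lemma dproj_radial q : q != 0 -> dproj a1 a2 q (radial q) = 0.
Proof.
move=> q0; rewrite /dproj divff ?scale1r ?subrr //.
by apply: lt0r_neq0; exact: dot_radial_gt0.
Qed.

Section Singular.
Variables (q : E) (e1 e2 : R[i]) (m : nat) (Q : {poly R[i]}).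
Hypotheses (Sq : S3 q) (m_gt0 : (0 < m)%N).
Hypothesis slice : forall w, eval2 f (z1 q + w * e1) (z2 q + w * e2) = w ^+ m * Q.[w].

Definition cdir w : E := cpt (w * e1) (w * e2).

Lemma cdir_linear (k k' : R) w o :
  cdir (k%:C * w + k'%:C * o) = k *: cdir w + k' *: cdir o.
Proof.
by apply: z12_inj; rewrite ?z1D ?z2D ?z1Z ?z2Z !(z1_cpt, z2_cpt) mulrDl !mulrA.
Qed.

Lemma pval_cdir w : pval f (q + cdir w) = w ^+ m * Q.[w].
Proof. by rewrite /pval z1D z2D z1_cpt z2_cpt. Qed.

(** On q + t o exp(is) e the value of f is t^m times [slice_val]. The angles of [slice_angle] make
    it positive and tend to 0, so the initial direction remains o. *)
Lemma slice_half_tangent o : o ^+ m * Q.[0] = 1 ->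
  half_tangent S q (dproj a1 a2 q (cdir o)).
Proof.
move=> oQ; have [s [s0 Hs]] := slice_angle m_gt0 oQ.
pose b t := q + cdir (t%:C * (o * expi (s t))).
have bE t : b t = q + t *: cdir (o * expi (s t)).
  have := cdir_linear t 0 (o * expi (s t)) 0.
  by rewrite mul0r addr0 scale0r addr0 /b => ->.
have cd : (fun t => cdir (o * expi (s t))) @ 0^'+ --> cdir (o * expi 0).
  have ac e t : o * expi t * e = (o * e) * expi t by rewrite mulrAC.
  have [E0 E1 E2 E3] : [/\
    forall t, cdir (o * expi t) 0 0 = complex.Re ((o * e1) * expi t),
    forall t, cdir (o * expi t) 0 1 = complex.Im ((o * e1) * expi t),
    forall t, cdir (o * expi t) 0 2 = complex.Re ((o * e2) * expi t) &
    forall t, cdir (o * expi t) 0 3 = complex.Im ((o * e2) * expi t)].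
    by split=> t; rewrite mxE /tnth /= ac.
  apply: cvg_row; apply: ord4P.
  - rewrite E0; under eq_fun do rewrite E0; exact: Re_rotation_cvg.
  - rewrite E1; under eq_fun do rewrite E1; exact: Im_rotation_cvg.
  - rewrite E2; under eq_fun do rewrite E2; exact: Re_rotation_cvg.
  - rewrite E3; under eq_fun do rewrite E3; exact: Im_rotation_cvg.
rewrite expi0 mulr1 in cd.
have vb : velocity b q (cdir o).
  apply: cvg_trans cd; apply: near_eq_cvg; near=> t.
  by rewrite bE addrAC subrr add0r scalerA mulVf ?scale1r.
have bn0 := velocity_near (@open_neq0 R) (S3_neq0 Sq) vb.
exists (fun t => proj (b t)); split.
- by rewrite bE scale0r addr0 weighted_proj_id.
- near=> t.
  have t0 : 0 < t by near: t; exact: nbhs_right_gt.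
  have [r [r0 rE]] : exists r, 0 < r /\ slice_val Q (slice_pt m o t (s t)) = r%:C.
    by near: t; exact: Hs.
  have bt : b t != 0 by near: t; exact: bn0.
  apply: (@positive_proj_section _ (t ^+ m * r)) => //.
    by rewrite mulr_gt0 // exprn_gt0.
  rewrite /b pval_cdir rmorphM /= -rE slice_valE rmorphXn exprMn -mulrA.
  by congr (_ * _); rewrite exprMn.
- exact: velocity_proj.
Unshelve. all: by end_near. Qed.

(** A half-tangent makes q a limit of points of S, and S is closed. This is how a zero of f is shown
    to lie in S. *)
Lemma half_tangent_mem v : half_tangent S q v -> S q.
Proof.
move=> [c [_ Sc cv]]; have [[cS _ _] _ _] := HS.
have clS : closed S by exact: (compact_closed (@norm_hausdorff _ _) cS).
have cq : c @ 0^'+ --> q by exact: velocity_cvg cv.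
exact: (closed_cvg S clS Sc q cq).
Qed.

Lemma multiple_slice_absurd : pval f q = 0 -> (1 < m)%N -> Q.[0] != 0 ->
  z1 (radial q) * e2 - z2 (radial q) * e1 != 0 -> False.
Proof.
move=> q0 m1 Q0 W0; have qn0 := S3_neq0 Sq.
(* Any m-th root serves; with z below, o and z o are two distinct solutions of w^m Q(0) = 1. *)
pose o : R[i] := m.-root (Q.[0])^-1.
have om : o ^+ m = (Q.[0])^-1 by exact: rootCK.
have oQ : o ^+ m * Q.[0] = 1 by rewrite om mulVf.
have o0 : o != 0.
  by apply: contra_neq Q0 => oz; move: oQ; rewrite oz expr0n gtn_eqF // mul0r => /eqP; rewrite eq_sym oner_eq0.
pose z : R[i] := expi (2 * pi / m%:R).
have mR : m%:R != 0 :> R by rewrite pnatr_eq0 -lt0n.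
have zm : z ^+ m = 1.
  by rewrite /z -expiX mulrC divfK //; have := expi_int R 1; rewrite mul1r.
have o'Q : (z * o) ^+ m * Q.[0] = 1 by rewrite exprMn zm mul1r.
have H1 := slice_half_tangent oQ; have H2 := slice_half_tangent o'Q.
have Sq' := half_tangent_mem H1.
have [[cS S3S Sib] Sorb _] := HS.
have bq : boundary_point S q.
  case: (Sib q Sq') => //; rewrite section_interiorE => -[_ _].
  by rewrite /reval q0 ltxx.
have [_ [U [g [h [[oU Uq hq] sg sh SU surj]]]]] := bq.
have dg := smooth_on_has_diff sg Uq; have dh := smooth_on_has_diff sh Uq.
have gq : g q = 0 by have : (S `&` U) q by []; rewrite SU => -[].
have nearU : \forall x \near q, S x -> g x = 0 /\ 0 <= h x.
  apply: filterS (open_nbhs_nbhs (conj oU Uq)) => x Ux Sx.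
  by have : (S `&` U) x by []; rewrite SU => -[].
have tg v : half_tangent S q v -> 'D_v (g : E -> R^o) q = 0.
  move=> Hv; apply: (half_tangent_eq0 dg Hv); apply: filterS nearU => x H /H [-> _].
  by rewrite gq.
have th v : half_tangent S q v -> 0 <= 'D_v (h : E -> R^o) q.
  move=> Hv; apply: (half_tangent_ge0 dh Hv); apply: filterS nearU => x H /H [_].
  by rewrite hq.
(* The orbit of a boundary point stays in the boundary. With both signs of k available, dh(X) is not
   only nonnegative but zero. *)
have HX k : half_tangent S q (k *: field_vec q).
  exists (fun t => Defs.flow a1 a2 (k * t) q); split.
  - by rewrite mulr0 flow0.
  - by apply: nearW => t; have [] := Sorb q bq (Defs.flow a1 a2 (k * t) q) (ex_intro2 _ _ (k * t) I erefl).
  - exact: velocity_flow.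
(* A and B are dg and dh read on the slice direction: tangent vectors of S^3 modulo X are
   parametrized by w, since Y is killed by the projection and X by dg and dh. *)
pose A w : R := 'D_(dproj a1 a2 q (cdir w)) (g : E -> R^o) q.
pose B w : R := 'D_(dproj a1 a2 q (cdir w)) (h : E -> R^o) q.
have linA (a b : R) (u v : R[i]) : A (a%:C * u + b%:C * v) = a * A u + b * A v.
  by rewrite /A cdir_linear dproj_linear (has_diff_lin _ _ _ _ dg).
have linB (a b : R) (u v : R[i]) : B (a%:C * u + b%:C * v) = a * B u + b * B v.
  by rewrite /B cdir_linear dproj_linear (has_diff_lin _ _ _ _ dh).
have gX : 'D_(field_vec q) (g : E -> R^o) q = 0.
  by apply: tg; have := HX 1; rewrite scale1r.
have hX : 'D_(field_vec q) (h : E -> R^o) q = 0.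
  apply/le_anti/andP; split; last by apply: th; have := HX 1; rewrite scale1r.
  have := th _ (HX (-1)); have := has_diff_lin (-1) 0 (field_vec q) 0 dh.
  by rewrite scaler0 addr0 mul0r addr0 mulN1r => ->; rewrite oppr_ge0.
have surjAB a b : exists w, A w = a /\ B w = b.
  have [v [Tv gv hv]] := surj a b.
  have [c [w [c1 c2]]] := cramer2 (z1 v) (z2 v) W0.
  exists w.
  have vE : v = complex.Re c *: radial q + complex.Im c *: field_vec q + cdir w.
    have e1' : z1 (field_vec q) = 'i%C * z1 (radial q) by rewrite z1_cpt z1_radial.
    have e2' : z2 (field_vec q) = 'i%C * z2 (radial q) by rewrite z2_cpt z2_radial.
    have cE y : c * y = (complex.Re c)%:C * y + (complex.Im c)%:C * ('i%C * y).
      rewrite [in RHS]mulrA -mulrDl; congr (_ * _).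
      by apply/eqP; rewrite eq_complex /=; case: (c) => x x' /=; apply/andP; split; apply/eqP; ring.
    apply: z12_inj.
      by rewrite !z1D !z1Z e1' z1_cpt c1 cE.
    by rewrite !z2D !z2Z e2' z2_cpt c2 cE.
  have vE' : v = complex.Im c *: field_vec q + 1 *: dproj a1 a2 q (cdir w).
    rewrite -[LHS](dproj_tangent a1 a2 Tv) [in LHS]vE.
    rewrite -[X in X + cdir w]scale1r -[X in _ + X]scale1r !dproj_linear.
    by rewrite dproj_radial // scaler0 add0r !scale1r dproj_tangent //; exact: tangent_field.
  by split; [rewrite -gv|rewrite -hv]; rewrite vE';
    rewrite ?(has_diff_lin _ _ _ _ dg) ?(has_diff_lin _ _ _ _ dh) ?gX ?hX mulr0 add0r mul1r.
have Ao : A o = 0 by exact: tg.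
have Azo : A (z * o) = 0 by exact: tg.
have [y [Ay _]] := surjAB 1 0; have [y' [Ay' By']] := surjAB 0 1.
(* o and z o both lie on the real line ker A. *)
have zN1 : z = -1 by apply: root_of_unity_cross m1 o0 (cross_kernel linA Ay Azo Ao).
have Bo : B o = 0.
  apply/le_anti/andP; split; last exact: th.
  have := th _ H2; rewrite -/(B _) zN1.
  have -> : -1 * o = (-1)%:C * o + 0%:C * o by rewrite rmorphN rmorph1 rmorph0 mul0r addr0.
  by rewrite linB mul0r addr0 mulN1r oppr_ge0.
(* ker A is spanned by o, where B vanishes; but y' lies in ker A and has B(y') = 1. *)
have [l y'E] := cross_eq0 o0 (cross_kernel linA Ay Ay' Ao).
have := linB l 0 o o; rewrite rmorph0 mul0r addr0 -y'E By' Bo !mulr0 addr0 => /eqP.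
by rewrite oner_eq0.
Qed.

End Singular.

Lemma converse_regular q : S3 q -> pval f q = 0 -> regular_at f q.
Proof.
move=> Sq q0; apply: contrapT => nreg.
have d1 : eval2 (mderiv 0 f) (z1 q) (z2 q) = 0.
  by apply/eqP/negPn/negP => h; apply: nreg; left.
have d2 : eval2 (mderiv 1 f) (z1 q) (z2 q) = 0.
  by apply/eqP/negPn/negP => h; apply: nreg; right.
have [x fx] := section_pval_neq0 Sq.
have y0 : z1 (radial q) != 0 \/ z2 (radial q) != 0.
  have [e1|] := eqVneq (z1 (radial q)) 0; [right|by left].
  apply/eqP => e2; have := dot_radial_gt0 a1_gt0 a2_gt0 (S3_neq0 Sq).
  rewrite (_ : radial q = 0) ?dotE ?mxE ?mulr0 ?addr0 ?ltxx //.
  by apply: z12_inj; rewrite ?e1 ?e2; apply/eqP; rewrite eq_complex /= !mxE eqxx.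
have [e1 [e2 [W0 fe]]] := transverse_direction (z1 q) (z2 q) y0 fx.
have [m [Q [m1 Q0 slice]]] := singular_slice q0 d1 d2 fe.
exact: (multiple_slice_absurd Sq (ltnW m1) slice q0 m1 Q0 W0).
Qed.

End Converse.

(* The hypothesis [d = 1 -> f <> 0] excludes only F = - z0, which is nonsingular
   although the affine part of its zero set is empty. *)
Theorem proposition8p2 (R : realType) (a1 a2 d : nat)
    (f : mpoly 2 R[i]) :
  (0 < a1)%N -> (0 < a2)%N -> coprime a1 a2 -> (0 < d)%N ->
  weighted_homogeneous a1 a2 d (curve_poly f d) ->
  (d = 1%N -> f <> 0) ->
  defines_positive_d_section a1 a2 d f <-> nonsingular (curve_poly f d).
Proof.
move=> a1_gt0 a2_gt0 cop d_gt0 wh fd1.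
have hf := weighted_homogeneous_eval2 d_gt0 wh.
rewrite nonsingular_curve_poly //; split.
  move=> [S [[[HS _] _] _ HA]].
  right=> x y f0 d1 d2; have [p0|p0] := eqVneq (cpt x y) 0.
    have z0 : z1 (0 : 'rV[R]_4) = 0 /\ z2 (0 : 'rV[R]_4) = 0.
      by split; apply/eqP; rewrite eq_complex /= !mxE eqxx.
    by split; [rewrite -(z1_cpt x y) p0; case: z0|rewrite -(z2_cpt x y) p0; case: z0].
  have u0 := wscale_gt0 a1_gt0 a2_gt0 p0.
  have uC : (wscale a1 a2 (cpt x y))%:C != 0 :> R[i] by rewrite eq_complex /= negb_and gt_eqF.
  (* A singular zero of f may lie anywhere in the plane; weighted scaling moves it to S^3 and
     preserves the vanishing of f and of its derivatives. *)
  have Sq := weighted_proj_S3 a1_gt0 a2_gt0 p0.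
  have := converse_regular a1_gt0 a2_gt0 d_gt0 hf HS HA Sq.
  rewrite /regular_at weighted_projE // (pval_rho hf) // /pval z1_rho z2_rho z1_cpt z2_cpt f0 mulr0.
  rewrite (mderiv0_homogeneous_eq0 hf uC d1) (mderiv1_homogeneous_eq0 hf uC d2).
  by move=> /(_ erefl) [] /eqP.
move=> ns; apply: nonsingular_defines => // p p0 pv.
apply: contrapT => nreg.
have d1 : eval2 (mderiv 0 f) (z1 p) (z2 p) = 0.
  by apply/eqP/negPn/negP => h; apply: nreg; left.
have d2 : eval2 (mderiv 1 f) (z1 p) (z2 p) = 0.
  by apply/eqP/negPn/negP => h; apply: nreg; right.
case: ns => [d_1|ns]; first by apply: (fd1 d_1); exact: (homogeneous1_nonsingular hf d_1 a1_gt0 a2_gt0 d1 d2).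
have [e1 e2] := ns _ _ pv d1 d2.
move/eqP: p0; apply; apply: z12_inj; rewrite ?e1 ?e2; apply/esym/eqP.
  by rewrite eq_complex /= !mxE eqxx.
by rewrite eq_complex /= !mxE eqxx.
Qed.
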